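(* Let $d\ge 1$, $0<k<N$, and for $\varepsilon>0$ consider the Cauchy problem on $\mathbb{R}^d\times\mathbb{R}_+$ for $$\begin{cases}\partial_t U^{I}+M^{12}(x,D)U^{II}=\frac1\varepsilon D^I(U^I,\varepsilon U^{II}),\\ \varepsilon^2\partial_t U^{II}+M^{21}(x,D)U^{I}+\varepsilon M^{22}(x,D)U^{II}=\frac1\varepsilon Q(x,U^I,\varepsilon U^{II})+D^{II}(U^I,\varepsilon U^{II}),\end{cases}$$ with unknowns $U^I(x,t)\in\mathbb{R}^k$, $U^{II}(x,t)\in\mathbb{R}^{N-k}$, and initial data $U^I(x,0)\in[L^2(\mathbb{R}^d)]^k$, $U^{II}(x,0)\in[L^2(\mathbb{R}^d)]^{N-k}$. Assume: (a) $M^{12}(x,\xi),M^{21}(x,\xi),M^{22}(x,\xi)$ are matrix symbols in the class $S^1$, of sizes $k\times(N-k)$, $(N-k)\times k$, $(N-k)\times(N-k)$; the principal symbol of $M(x,D)=OP\left\{-\begin{pmatrix}0 & M^{12}(x,\xi)\\ M^{21}(x,\xi) & M^{22}(x,\xi)\end{pmatrix}\right\}$ has purely imaginary eigenvalues for all $x$ and all $\xi\ne0$; and the values of $Q$ span $\mathbb{R}^{N-k}$. (b) There is $R(x,D)\in OPS^0_{1,0}$ such that $R(x,D)M(x,D)+(R(x,D)M(x,D))^*\in OPS^0_{1,0}$, whose symbol $R(x,\xi)$ is a positive definite matrix for $|\xi|>1$ and has the block form $R(x,\xi)=\begin{pmatrix}R_{11}(x,\xi) & 0\\ 0 & R_{22}(x,\xi)\end{pmatrix}$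 with $R_{11}(x,\xi)\in\mathcal M_{k\times k}$, $R_{22}(x,\xi)\in\mathcal M_{(N-k)\times(N-k)}$ symmetric positive definite. (c) $\det[(M^{21}(x,\xi))^TM^{21}(x,\xi)]\neq0$ for all $x$ and all $\xi\neq 0$. (d) $(D^I,D^{II})\in C^1(\mathbb{R}^N;\mathbb{R}^k\times\mathbb{R}^{N-k})$, $D^I(Z^I,0)=0$, $D^{II}(0,0)=0$, $D^I_\nu$ is bounded in $(Z^I,Z^{II})$, and $D^{II}$ is a Lipschitz function of $(Z^I,Z^{II})$ with Lipschitz norm $\alpha$. (e) $Q=Q_0+Q_1$ and $Q(x,Z^I,0)=0$ for any $(x,Z^I)\in\mathbb{R}^d\times\mathbb{R}^k$. Moreover: (e1) $Q_0\in C^1(\mathbb{R}^{N+d};\mathbb{R}^{N-k})$, $Q_{0\nu}(x,Z^I,Z^{II})$ is bounded in $(x,Z^I,Z^{II})$, $[Q_{0\nu},R_{22}^{1/2}(x,D)]=0$, and there is $\lambda_0>0$ such that $Q_{0\nu}(x,Z^I,Z^{II})\le-\lambda_0 I$ for any $x\in\mathbb{R}^d$, $(Z^I,Z^{II})\in\mathbb{R}^k\times\mathbb{R}^{N-k}$; (e2) $Q_1\in C^1(\mathbb{R}^{N+d};\mathbb{R}^{N-k})$, $Q_{1\nu}(x,Z^I,Z^{II})$ is bounded in $(x,Z^I,Z^{II})$, and the operator $R_{22}(x,D)Q_{1\nu}$ satisfies $\|R_{22}(x,D)Q_{1\nu}\|_{\mathcal L(L^2)}\le\lambda_1$, where $\lambda_1>0$,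 $\lambda_1\le\lambda_0/2$. Let $U^{I0}\in[L^2(\mathbb{R}^d\times[0,T])]^k$ and $U^{II0}\in[L^2(\mathbb{R}^d\times[0,T])]^{N-k}$ ($T>0$) be the limits of the solutions, along a (sub)sequence $\varepsilon\downarrow0$, in the sense that $U^I\to U^{I0}$ strongly in $L^2_{loc}(\mathbb{R}^d\times\mathbb{R}_+)$, $U^{II}\rightharpoonup U^{II0}$ weakly in $L^2(\mathbb{R}^d\times[0,T])$, $\varepsilon U^{II}\to 0$ strongly in $L^2_{loc}(\mathbb{R}^d\times\mathbb{R}_+)$ and $\varepsilon^2\partial_tU^{II}\to0$ in $H^{-1}_{loc}(\mathbb{R}^d\times\mathbb{R}_+)$. Then $(U^{I0},U^{II0})$ satisfies, in the sense of distributions, $$\begin{cases}\partial_tU^{I0}+M^{12}(x,D)U^{II0}=D^I_\nu(U^{I0},0)U^{II0},\\ M^{21}(x,D)U^{I0}=Q_\nu(x,U^{I0},0)U^{II0}+D^{II}(U^{I0},0).\end{cases}$$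
   Context: $\mathcal M_{m\times n}$ denotes the $m\times n$ matrices and $\mathcal L(L^2)$ the bounded operators on $L^2(\mathbb{R}^d)$. For a function $F(Z^I,Z^{II})$ (possibly depending also on $x$), $F_\nu$ denotes its derivative with respect to $Z^{II}$. $S^m_{1,0}$ is the set of $C^\infty$ symbols with $|D_x^\beta D_\xi^\alpha p(x,\xi)|\le C_{\alpha\beta}(1+|\xi|^2)^{(m-|\alpha|)/2}$; $S^m$ is the class of polyhomogeneous symbols $p\sim\sum_{j\ge0}p_{m-j}$, with $p_{m-j}$ smooth and homogeneous of degree $m-j$ in $\xi$ for $|\xi|\ge1$. The operator with symbol $p$ is $OP(p)f(x)=P(x,D)f(x)=\int p(x,\xi)\hat f(\xi)e^{ix\cdot\xi}d\xi$, $\hat f(\xi)=(2\pi)^{-d}\int f(x)e^{-ix\cdot\xi}dx$; $OPS^m_{1,0}$, $OPS^m$ are the corresponding operator classes. $R_{22}(x,D)=OP(R_{22}(x,\xi))$ and $R_{22}^{1/2}(x,D)$ is its square root. $[\cdot,\cdot]$ is the commutator, with the matrix functions $Q_{0\nu},Q_{1\nu}$ acting by multiplication. Matrix inequalities are in the sense of quadratic forms. The existence, under the hypotheses (a)–(e), of limits $U^{I0},U^{II0}$ with the stated convergences (after extracting subsequences) is the content of the results of the paper preceding this corollary. *)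

(* Defs.v *)
From HB Require Import structures.
From mathcomp Require Import all_boot all_order all_algebra.
From mathcomp Require Import all_classical all_reals all_analysis.
From mathcomp Require Import complex.

Set Implicit Arguments.
Unset Strict Implicit.
Unset Printing Implicit Defensive.

Import Order.TTheory GRing.Theory Num.Theory.
Import numFieldNormedType.Exports.

Local Open Scope classical_set_scope.
Local Open Scope ring_scope.
Local Open Scope complex_scope.

Section mx_measurable.
Variables (R : realType) (m n : nat).

Definition mx_generators : set (set 'M[R]_(m, n)) :=
  [set B | exists (i : 'I_m) (j : 'I_n) (Y : set R),
    measurable Y /\ B = [set A : 'M[R]_(m, n) | Y (A i j)]].

Definition mx_display : measure_display := sigma_display mx_generators.

HB.instance Definition _ := @isMeasurable.Build mx_display 'M[R]_(m, n)
  <<s mx_generators >> (@sigma_algebra0 _ setT mx_generators)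
  (@sigma_algebraC _ mx_generators)
  (@sigma_algebra_bigcup _ setT mx_generators).

Lemma measurable_coord i j :
  measurable_fun [set: 'M[R]_(m, n)] (fun A => A i j).
Proof.
by move=> _ Y mY; rewrite setTI; apply: sub_sigma_algebra; exists i, j, Y.
Qed.

Lemma measurable_mxP d (T : measurableType d) (f : T -> 'M[R]_(m, n)) :
  (forall i j, measurable_fun setT (fun x => f x i j)) ->
  measurable_fun setT f.
Proof.
move=> mf; apply: (measurability mx_generators) => //.
move=> _ [_ [i [j [Y [mY ->]]]] <-].
by rewrite setTI; have := mf i j measurableT Y mY; rewrite setTI.
Qed.

End mx_measurable.

Section lebesgue_rV.
Variable R : realType.

Definition rVcons n (p : R * 'rV[R]_n) : 'rV[R]_n.+1 := row_mx p.1%:M p.2.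

Definition rVuncons n (v : 'rV[R]_n.+1) : R * 'rV[R]_n :=
  (v 0 0, rsubmx (v : 'rV[R]_(1 + n))).

Lemma rVconsK n : cancel (@rVcons n) (@rVuncons n).
Proof.
move=> [r v]; rewrite /rVuncons /rVcons row_mxKr; congr pair.
have -> : 0 = lshift n 0 :> 'I_(1 + n) by apply/val_inj.
by rewrite (@row_mxEl _ 1 1 n) mxE eqxx.
Qed.

Lemma measurable_rVcons n : measurable_fun setT (@rVcons n).
Proof.
apply: measurable_mxP => i j; rewrite /rVcons.
case: (splitP (j : 'I_(1 + n))) => [j' jj'|j' jj'].
  have -> : j = lshift n j' by apply/val_inj.
  under eq_fun do rewrite (@row_mxEl _ 1 1 n) mxE ord1 (ord1 j') eqxx mulr1n.
  exact: measurable_fst.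
have -> : j = rshift 1 j' by apply/val_inj.
under eq_fun do rewrite (@row_mxEr _ 1 1 n).
exact: (measurableT_comp (measurable_coord _ _) measurable_snd).
Qed.

Lemma measurable_rVuncons n : measurable_fun setT (@rVuncons n).
Proof.
apply: measurable_fun_pair; first exact: measurable_coord.
apply: measurable_mxP => i j.
under eq_fun do rewrite mxE.
exact: measurable_coord.
Qed.

Section lebesgue_rVS.
Variables (n : nat) (nu : {sigma_finite_measure set 'rV[R]_n -> \bar R}).

Definition lebesgue_rVS (A : set 'rV[R]_n.+1) : \bar R :=
  (@lebesgue_measure R \x nu)%E (@rVcons n @^-1` A).

Let lebesgue_rVS0 : lebesgue_rVS set0 = 0%E.
Proof. by rewrite /lebesgue_rVS preimage_set0 measure0. Qed.

Let lebesgue_rVS_ge0 A : (0 <= lebesgue_rVS A)%E.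
Proof. exact: measure_ge0. Qed.

Let lebesgue_rVS_sigma_additive : semi_sigma_additive lebesgue_rVS.
Proof.
have mc (A : set 'rV[R]_n.+1) : measurable A -> measurable (@rVcons n @^-1` A).
  by move=> mA; rewrite -[X in measurable X]setTI; exact: measurable_rVcons.
move=> F mF tF mUF; rewrite /lebesgue_rVS preimage_bigcup.
apply: measure_semi_sigma_additive.
- by move=> i; exact: mc.
- apply/trivIsetP => /= i j _ _ ij; rewrite -preimage_setI.
  by move/trivIsetP : tF => /(_ _ _ _ _ ij) ->//; rewrite preimage_set0.
- by rewrite -preimage_bigcup; exact: mc.
Qed.

HB.instance Definition _ := isMeasure.Build _ _ _ lebesgue_rVS
  lebesgue_rVS0 lebesgue_rVS_ge0 lebesgue_rVS_sigma_additive.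

Let lebesgue_rVS_sigma_finite : sigma_finite setT lebesgue_rVS.
Proof.
have /sigma_finiteP[F [TF ndF Foo]] := sigma_finiteT (@lebesgue_measure R).
have /sigma_finiteP[G [TG ndG Goo]] := sigma_finiteT nu.
exists (fun i => @rVuncons n @^-1` (F i `*` G i)) => [|i].
  rewrite -preimage_bigcup (_ : \bigcup_i _ = setT) ?preimage_setT//.
  apply/seteqP; split=> // -[x y] _.
  have : [set: R] x by [].
  have : [set: 'rV[R]_n] y by [].
  rewrite {1}TF {1}TG => -[k _ Gky] [j _ Fjx]; exists (maxn j k) => //; split.
  - by move: Fjx; apply/subsetPset/ndF/leq_maxl.
  - by move: Gky; apply/subsetPset/ndG/leq_maxr.
have [mF Fi] := Foo i; have [mG Gi] := Goo i; split.
  rewrite -[X in measurable X]setTI.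
  exact: (@measurable_rVuncons n measurableT _ (measurableX mF mG)).
rewrite /lebesgue_rVS (_ : _ @^-1` _ = F i `*` G i).
  by rewrite product_measure1E// lte_mul_pinfty// ge0_fin_numE.
by apply/seteqP; split => p; rewrite /preimage/mkset rVconsK.
Qed.

HB.instance Definition _ := Measure_isSigmaFinite.Build _ _ _ lebesgue_rVS
  lebesgue_rVS_sigma_finite.

End lebesgue_rVS.

(* Lebesgue measure on R^n, as the n-fold product of the one on R. *)
Fixpoint leb n : {sigma_finite_measure set 'rV[R]_n -> \bar R} :=
  match n with
  | 0 => [the {sigma_finite_measure set 'rV[R]_0 -> \bar R} of
           \d_(0 : 'rV[R]_0)]
  | n.+1 => [the {sigma_finite_measure set 'rV[R]_n.+1 -> \bar R} of
              lebesgue_rVS (leb n)]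
  end.

End lebesgue_rV.

Section basics.
Variable R : realType.
Local Notation C := R[i].

Definition dotv m n (u v : 'M[R]_(m, n)) : R := \sum_i \sum_j u i j * v i j.
Definition norm2 m n (u : 'M[R]_(m, n)) : R := Num.sqrt (dotv u u).

Definition cmod (z : C) : R := Num.sqrt (complex.Re z ^+ 2 + complex.Im z ^+ 2).
Definition toC m n (A : 'M[R]_(m, n)) : 'M[C]_(m, n) := map_mx (real_complex R) A.
Definition expi (t : R) : C := cos t +i* sin t.

Definition cdot n (u v : 'cV[C]_n) : C := \sum_i u i 0 * v i 0.

Definition conj_tr m n (A : 'M[C]_(m, n)) : 'M[C]_(n, m) :=
  (map_mx (@conjc R) A)^T.

(* Hermitian positive definite; for real entries this is symmetric positive
   definite. *)
Definition posdef n (A : 'M[C]_n) : Prop :=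
  conj_tr A = A /\
  forall v : 'cV[C]_n, v != 0 -> 0 < (conj_tr v *m A *m v) 0 0.

Section smoothness.
Variable V : normedModType R.

Definition iter_derive (vs : seq V) (f : V -> R) : V -> R :=
  foldr (fun v g => 'D_v g) f vs.

Definition smooth (f : V -> R) : Prop :=
  forall vs x, differentiable (iter_derive vs f) x.

Definition csmooth (f : V -> C) : Prop :=
  smooth (fun x => complex.Re (f x)) /\ smooth (fun x => complex.Im (f x)).

Definition citer_derive (vs : seq V) (f : V -> C) (x : V) : C :=
  iter_derive vs (fun y => complex.Re (f y)) x +i*
  iter_derive vs (fun y => complex.Im (f y)) x.

Definition class_C1 (W : normedModType R) (f : V -> W) : Prop :=
  (forall x, differentiable f x) /\ (forall v, continuous ('D_v f)).

Definition smooth_on_compact n (K : set V) (phi : V -> 'cV[R]_n) : Prop :=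
  (forall i, smooth (fun x => phi x i 0)) /\ (forall x, ~ K x -> phi x = 0).

Definition test_function n (Omega : set V) (phi : V -> 'cV[R]_n) : Prop :=
  exists K, [/\ compact K, K `<=` Omega & smooth_on_compact K phi].

End smoothness.

Definition basis_vec d (j : 'I_d) : 'rV[R]_d := delta_mx 0 j.

(* A multi-index is encoded as the list of the coordinates with respect to
   which one differentiates; its order is the size of the list. *)
Definition schwartz d n (f : 'rV[R]_d -> 'cV[C]_n) : Prop :=
  forall i, csmooth (fun x => f x i 0) /\
    forall (a : seq 'I_d) (r : nat), exists c : R, forall x,
      norm2 x ^+ r *
        cmod (citer_derive (map (@basis_vec d) a) (fun y => f y i 0) x) <= c.

Definition jac m n (F : 'cV[R]_n -> 'cV[R]_m) (z : 'cV[R]_n) : 'M[R]_(m, n) :=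
  \matrix_(i, j) ('D_(delta_mx j 0) F z) i 0.

Section L2.
Variables (dT : measure_display) (T : measurableType dT).
Variable mu : {measure set T -> \bar R}.

Definition L2 m n (A : set T) (f : T -> 'M[R]_(m, n)) : Prop :=
  forall i j, measurable_fun A (fun x => f x i j) /\
    (\int[mu]_(x in A) ((f x i j) ^+ 2)%:E < +oo)%E.

Definition L2norm_sq m n (A : set T) (f : T -> 'M[R]_(m, n)) : \bar R :=
  (\int[mu]_(x in A) (dotv (f x) (f x))%:E)%E.

Definition cL2 m n (f : T -> 'M[C]_(m, n)) : Prop :=
  L2 setT (fun x => map_mx (@complex.Re R) (f x)) /\
  L2 setT (fun x => map_mx (@complex.Im R) (f x)).

Definition cL2norm_sq m n (f : T -> 'M[C]_(m, n)) : \bar R :=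
  (L2norm_sq setT (fun x => map_mx (@complex.Re R) (f x)) +
   L2norm_sq setT (fun x => map_mx (@complex.Im R) (f x)))%E.

Definition cintegral (A : set T) (f : T -> C) : C :=
  (\int[mu]_(x in A) complex.Re (f x)) +i* (\int[mu]_(x in A) complex.Im (f x)).

End L2.

Section pdo.
Variable d : nat.
Local Notation Rd := 'rV[R]_d.

Definition symbol m n := Rd -> Rd -> 'M[C]_(m, n).

Definition symbol_dirs (b a : seq 'I_d) : seq (Rd * Rd)%type :=
  [seq (basis_vec j, 0) | j <- b] ++ [seq (0, basis_vec j) | j <- a].

(* D = -i\partial has the same modulus as \partial, so the powers of i are
   dropped. *)
Definition S10 m n (r : R) (P : symbol m n) : Prop :=
  forall i j, let p := fun z : (Rd * Rd)%type => P z.1 z.2 i j in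
  csmooth p /\
  forall b a : seq 'I_d, exists c : R, forall x xi,
    cmod (citer_derive (symbol_dirs b a) p (x, xi)) <=
    c * (1 + dotv xi xi) `^ ((r - (size a)%:R) / 2).

(* P ~ \sum_j a_j, with a_j homogeneous of degree r - j for |xi| >= 1 *)
Definition expansion m n (r : R) (P : symbol m n) (a : nat -> symbol m n) :=
  [/\ forall l i j, csmooth (fun z : (Rd * Rd)%type => a l z.1 z.2 i j),
      forall l x xi (t : R), 1 <= norm2 xi -> 1 <= t ->
        a l x (t *: xi) = (t `^ (r - l%:R))%:C *: a l x xi
    & forall L : nat, S10 (r - L%:R)
        (fun x xi => P x xi - \sum_(l < L) a l x xi)].

Definition polyhomogeneous m n (r : R) (P : symbol m n) : Prop :=
  exists a, expansion r P a.

(* q is the leading term, extended to all xi <> 0 by homogeneity. *)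
Definition principal_symbol m n (r : R) (P q : symbol m n) : Prop :=
  exists2 a, expansion r P a &
    forall x xi, xi != 0 ->
      q x xi = (norm2 xi `^ r)%:C *: a 0%N x ((norm2 xi)^-1 *: xi).

Definition fourier (f : Rd -> C) (xi : Rd) : C :=
  (((2 * pi) ^+ d)^-1)%:C *
    cintegral (leb R d) setT (fun x => f x * expi (- dotv x xi)).

Definition OP1 (p : Rd -> Rd -> C) (f : Rd -> C) (x : Rd) : C :=
  cintegral (leb R d) setT
    (fun xi => p x xi * fourier f xi * expi (dotv x xi)).

(* Pointwise formula, meaningful for f in the Schwartz class. *)
Definition OP m n (P : symbol m n) (f : Rd -> 'cV[C]_n) (x : Rd) : 'cV[C]_m :=
  \col_i \sum_j OP1 (fun y xi => P y xi i j) (fun y => f y j 0) x.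

(* The formal transpose: integrating (OP1 p f) * phi first in x gives
   \int fourier f xi * g xi dxi with g xi = \int p x xi phi x e^{i x.xi} dx,
   which is \int f y * fourier g y dy.  For a test function phi and a symbol p
   of any order, g and OP1tr p phi are in the Schwartz class. *)
Definition OP1tr (p : Rd -> Rd -> C) (phi : Rd -> C) (y : Rd) : C :=
  fourier (fun xi => cintegral (leb R d) setT
    (fun x => p x xi * phi x * expi (dotv x xi))) y.

Definition OPtr m n (P : symbol m n) (phi : Rd -> 'cV[R]_m) (y : Rd) :
    'cV[C]_n :=
  \col_j \sum_i OP1tr (fun x xi => P x xi i j) (fun x => (phi x i 0)%:C) y.

(* P(x,D) u = v for u, v in L^2, by duality with test functions; this is how
   P(x,D) is extended beyond the Schwartz class. *)
Definition OP_dist m n (P : symbol m n) (u : Rd -> 'cV[C]_n)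
    (v : Rd -> 'cV[C]_m) : Prop :=
  forall phi : Rd -> 'cV[R]_m, test_function setT phi ->
    cintegral (leb R d) setT (fun x => cdot (v x) (toC (phi x))) =
    cintegral (leb R d) setT (fun y => cdot (u y) (OPtr P phi y)).

Definition inner n (f g : Rd -> 'cV[C]_n) : C :=
  cintegral (leb R d) setT (fun x => cdot (f x) (map_mx (@conjc R) (g x))).

Definition formal_adjoint n (A B : (Rd -> 'cV[C]_n) -> Rd -> 'cV[C]_n) :=
  forall f g, schwartz f -> schwartz g -> inner (A f) g = inner f (B g).

Definition OPS10 n (r : R) (A : (Rd -> 'cV[C]_n) -> Rd -> 'cV[C]_n) :=
  exists2 S : symbol n n, S10 r S &
    forall f, schwartz f -> forall x, A f x = OP S f x.

Definition sym_part_OPS0 n (A : (Rd -> 'cV[C]_n) -> Rd -> 'cV[C]_n) :=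
  exists2 B, formal_adjoint A B & OPS10 0 (fun f x => A f x + B f x).

Definition bounded_op n (A : (Rd -> 'cV[C]_n) -> Rd -> 'cV[C]_n) : Prop :=
  (forall (a : C) f g, cL2 (leb R d) f -> cL2 (leb R d) g ->
    {ae leb R d, forall x, A (fun y => a *: f y + g y) x = a *: A f x + A g x})
  /\ exists c : R, forall f, cL2 (leb R d) f ->
    cL2 (leb R d) (A f) /\
    (cL2norm_sq (leb R d) (A f) <= c%:E * cL2norm_sq (leb R d) f)%E.

(* P(x,D) need not be self-adjoint, so no positivity of S is imposed. *)
Definition op_sqrt n (P : symbol n n)
    (S : (Rd -> 'cV[C]_n) -> Rd -> 'cV[C]_n) : Prop :=
  bounded_op S /\ forall f, cL2 (leb R d) f -> OP_dist P f (S (S f)).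

Definition op_commutes n (B : Rd -> 'M[R]_n)
    (S : (Rd -> 'cV[C]_n) -> Rd -> 'cV[C]_n) : Prop :=
  forall f, cL2 (leb R d) f ->
    {ae leb R d, forall x, S (fun y => toC (B y) *m f y) x =
                           toC (B x) *m S f x}.

Definition op_mul_norm_le n (P : symbol n n) (B : Rd -> 'M[R]_n) (c : R) :=
  forall u, cL2 (leb R d) u -> exists v,
    [/\ cL2 (leb R d) v, OP_dist P (fun x => toC (B x) *m u x) v
      & (cL2norm_sq (leb R d) v <= (c ^+ 2)%:E * cL2norm_sq (leb R d) u)%E].

Local Notation ST := (Rd * R)%type.

Definition lebST : {measure set (Rd * measurableTypeR R)%type -> \bar R} :=
  (leb R d \x @lebesgue_measure R)%E.

Definition slab (T : R) : set ST := [set z | 0 <= z.2 <= T].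
Definition open_slab (T : R) : set ST := [set z | 0 < z.2 < T].
Definition half_space : set ST := [set z | 0 <= z.2].

Definition dt n (phi : ST -> 'cV[R]_n) (z : ST) : 'cV[R]_n :=
  \col_i 'D_((0, 1) : ST) (fun w => phi w i 0) z.
Definition dx n (j : 'I_d) (phi : ST -> 'cV[R]_n) (z : ST) : 'cV[R]_n :=
  \col_i 'D_((basis_vec j, 0) : ST) (fun w => phi w i 0) z.

Definition pairing n (A : set ST) (u phi : ST -> 'cV[R]_n) : R :=
  \int[lebST]_(z in A) dotv (u z) (phi z).

(* <P(x,D) u, phi> over A, with P(x,D) acting in the space variable *)
Definition OP_pairing m n (A : set ST) (P : symbol m n) (u : ST -> 'cV[R]_n)
    (phi : ST -> 'cV[R]_m) : C :=
  cintegral lebST A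
    (fun z => cdot (toC (u z)) (OPtr P (fun x => phi (x, z.2)) z.1)).

Definition cvg_L2loc n (Omega : set ST) (u : nat -> ST -> 'cV[R]_n)
    (v : ST -> 'cV[R]_n) : Prop :=
  forall K, compact K -> K `<=` Omega ->
    L2norm_sq lebST K (fun z => u h z - v z) @[h --> \oo] --> 0%E.

Definition cvg_L2weak n (A : set ST) (u : nat -> ST -> 'cV[R]_n)
    (v : ST -> 'cV[R]_n) : Prop :=
  forall g : ST -> 'cV[R]_n, L2 lebST A g ->
    pairing A (u h) g @[h --> \oo] --> pairing A v g.

Definition H1norm n (phi : ST -> 'cV[R]_n) : R :=
  Num.sqrt (\int[lebST]_z (dotv (phi z) (phi z) + dotv (dt phi z) (dt phi z)
    + \sum_(j < d) dotv (dx j phi z) (dx j phi z))).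

(* T_h --> 0 in H^{-1}_loc(Omega), for distributions given as functionals on
   test functions: the norm dual to H^1 of T_h tends to 0 on each compact. *)
Definition cvg0_Hm1loc n (Omega : set ST)
    (T : nat -> (ST -> 'cV[R]_n) -> R) : Prop :=
  forall K, compact K -> K `<=` Omega -> forall e : R, 0 < e ->
    \forall h \near \oo, forall phi, smooth_on_compact K phi ->
      `|T h phi| <= e * H1norm phi.

End pdo.

Arguments slab {d}.
Arguments open_slab {d}.
Arguments half_space {d}.

Section system.
Variables (d k l : nat).
Local Notation Rd := 'rV[R]_d.
Local Notation ST := (Rd * R)%type.

Definition system_symbol
    (M12 : symbol d k l) (M21 : symbol d l k) (M22 : symbol d l l) :
    symbol d (k + l) (k + l) :=
  fun x xi => - block_mx 0 (M12 x xi) (M21 x xi) (M22 x xi).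

(* Distributional solution on R^d x R_+ with initial data: testing against
   phi in C_c^oo(R^d x R), the data appear after integrating d_t by parts. *)
Definition cauchy_solution
    (M12 : symbol d k l) (M21 : symbol d l k) (M22 : symbol d l l)
    (DI : 'cV[R]_k -> 'cV[R]_l -> 'cV[R]_k)
    (DII : 'cV[R]_k -> 'cV[R]_l -> 'cV[R]_l)
    (Q : Rd -> 'cV[R]_k -> 'cV[R]_l -> 'cV[R]_l)
    (eps : R) (UI0 : Rd -> 'cV[R]_k) (UII0 : Rd -> 'cV[R]_l)
    (UI : ST -> 'cV[R]_k) (UII : ST -> 'cV[R]_l) : Prop :=
  [/\ forall T : R, 0 < T ->
        L2 (lebST d) (slab T) UI /\ L2 (lebST d) (slab T) UII,
      forall phi, test_function setT phi ->
        (- pairing half_space UI (dt phi)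
           - \int[leb R d]_x dotv (UI0 x) (phi (x, 0)))%:C
        + OP_pairing half_space M12 UII phi =
        (eps^-1 * pairing half_space
                    (fun z => DI (UI z) (eps *: UII z)) phi)%:C
    & forall phi, test_function setT phi ->
        (eps ^+ 2 * (- pairing half_space UII (dt phi)
           - \int[leb R d]_x dotv (UII0 x) (phi (x, 0))))%:C
        + OP_pairing half_space M21 UI phi
        + eps%:C * OP_pairing half_space M22 UII phi =
        (eps^-1 * pairing half_space
                    (fun z => Q z.1 (UI z) (eps *: UII z)) phi
         + pairing half_space
                    (fun z => DII (UI z) (eps *: UII z)) phi)%:C].

Definition limit_solution
    (M12 : symbol d k l) (M21 : symbol d l k)
    (DI : 'cV[R]_k -> 'cV[R]_l -> 'cV[R]_k)
    (DII : 'cV[R]_k -> 'cV[R]_l -> 'cV[R]_l)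
    (Q : Rd -> 'cV[R]_k -> 'cV[R]_l -> 'cV[R]_l)
    (T : R) (UI : ST -> 'cV[R]_k) (UII : ST -> 'cV[R]_l) : Prop :=
  (forall phi, test_function (open_slab T) phi ->
     (- pairing (slab T) UI (dt phi))%:C
     + OP_pairing (slab T) M12 UII phi =
     (pairing (slab T) (fun z => jac (DI (UI z)) 0 *m UII z) phi)%:C) /\
  (forall phi, test_function (open_slab T) phi ->
     OP_pairing (slab T) M21 UI phi =
     (pairing (slab T) (fun z => jac (Q z.1 (UI z)) 0 *m UII z) phi
      + pairing (slab T) (fun z => DII (UI z) 0) phi)%:C).

End system.
End basics.

Arguments half_space {R d}.

(* Main.v *)
(* For a test function phi, the transposes M12^T phi and M22^T phi are Schwartz
   in x, by integration by parts in the oscillatory integrals defining them.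
   Hence the linear terms in U^II pass to the limit by weak convergence, and the
   terms carrying a factor epsilon vanish.  If F(x, Z, 0) = 0 and F_nu is bounded,
   the mean value theorem turns F(x, U^I, eps U^II) / eps into
   F_nu(x, U^I, theta eps U^II) U^II; as U^I and eps U^II converge strongly on the
   support of phi and U^II is bounded in L^2 (uniform boundedness), F_nu may be
   replaced by F_nu(x, U^I0, 0), and weak convergence applies again.

   The delicate term is M21 U^I: gamma = M21^T phi is not compactly supported in
   x, whereas U^I converges only locally.  The first equation yields the missing
   tightness: test it with (chi(x / (r + s)) - chi(x / r)) Gamma, where Gamma is
   the antiderivative of - gamma in time vanishing at time T.  The cutoffs vary on
   the scale r, so the test function is O(1 / r) in every Schwartz seminorm, and
   the equation bounds the pairing of U^I with (1 - chi(x / r)) gamma by C / r,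
   uniformly in epsilon. *)
From HB Require Import structures.
Require Import Defs.
From mathcomp Require Import all_boot all_order all_algebra.
From mathcomp Require Import all_classical all_reals all_analysis measurable_realfun.
From mathcomp Require Import complex ring lra.

Import Order.TTheory GRing.Theory Num.Theory.
Import numFieldNormedType.Exports.

Local Open Scope classical_set_scope.
Local Open Scope ring_scope.
Local Open Scope complex_scope.

Set Implicit Arguments.
Unset Strict Implicit.
Unset Printing Implicit Defensive.

(** * Measurability and integration *)

(** Each [UI n] lies in $L^2$ of the slab, but no bound uniform in [n] is assumed on it, only local
    convergence. This is why two radii are needed in the tightness argument: the outer one goes to
    infinity with [n] fixed, where the individual norm of [UI n] is enough, and what remains is
    controlled by the equation through quantities that are bounded in [n], namely the initial data,
    [UII n], and the source over epsilon, which is at most a multiple of $|U^{II}|$.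

    To have the gain $1/r$ in every Schwartz seminorm at once, the analysis is carried out for
    families of functions indexed by a type [I], with bounds uniform in the index. A single test
    function is the case of a one-point index, and the pairs of radii are another index. The
    uniformity then passes through the transposed operators with no further estimate. *)

Section open_measurable.
Context {R : realType}.

(** The sigma-algebra is generated by conditions on single entries, so [O] is exhausted by boxes
    [q M] with rational centre and half-width, of which there are countably many. *)
Lemma open_measurable_mx m n (O : set 'M[R]_(m, n)) : open O -> measurable O.
Proof.
move=> oO.
pose q (M : 'M[rat]_(m, n) * rat) := [set A : 'M[R]_(m, n) |
  forall i j, ratr (M.1 i j) - ratr M.2 < A i j < ratr (M.1 i j) + ratr M.2].
have mq M : measurable (q M).
  rewrite /q (_ : mkset _ = \bigcap_(k in [set: ('I_m * 'I_n)%type])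
     [set A : 'M[R]_(m, n) | A k.1 k.2 \in
       `]ratr (M.1 k.1 k.2) - ratr M.2, ratr (M.1 k.1 k.2) + ratr M.2[]).
    apply: fin_bigcap_measurable => // -[i j] _ /=.
    apply: sub_sigma_algebra; exists i, j.
    exists [set` `]ratr (M.1 i j) - ratr M.2, ratr (M.1 i j) + ratr M.2[] => //.
  apply/seteqP; split=> A /= h.
    by move=> [i j] _ /=; rewrite in_itv /=; apply: h.
  by move=> i j; have := h (i, j) I; rewrite /= in_itv.
have -> : O = \bigcup_(M in [set: ('M[rat]_(m, n) * rat)%type])
    (if `[< q M `<=` O >] then q M else set0).
  apply/seteqP; split => [A OA|A [M _]]; last by case: asboolP => // h /h.
  have /nbhs_ballP [e /= e0 eO] : nbhs A O by exact: open_nbhs_nbhs.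
  have [r re] : exists r : rat, 0 < (ratr r : R) < e / 2.
    have [r] : exists r, ratr r \in `]0, e / 2[ by apply: rat_in_itvoo; rewrite divr_gt0.
    by rewrite in_itv /= => h; exists r.
  have hM i j : exists s : rat, A i j - ratr r < ratr s < A i j + ratr r.
    have [s] : exists s, ratr s \in `]A i j - ratr r, A i j + ratr r[.
      by apply: rat_in_itvoo; case/andP: re => r0 _; lra.
    by rewrite in_itv /= => h; exists s.
  (* A centre within [r] of [A] and a half-width [r < e / 2]: the box contains [A] and stays in the
     ball of radius [e]. *)
  pose M : 'M[rat]_(m, n) := \matrix_(i, j) sval (cid (hM i j)).
  have MA i j : A i j - ratr r < ratr (M i j) < A i j + ratr r.
    by rewrite mxE; case: cid.
  exists (M, r) => //; case: asboolP => [_ i j /=|[]].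
    by have := MA i j; lra.
  move=> B /= hB; apply: eO; split => // i j.
  by rewrite /ball /= ltr_norml; have := hB i j; have := MA i j; lra.
apply: countable_bigcupT_measurable; first exact: countableP.
by move=> M; case: asboolP.
Qed.

Lemma continuous_measurable_mx m n (f : 'M[R]_(m, n) -> R) :
  continuous f -> measurable_fun setT f.
Proof.
move=> /continuousP cf; apply: (measurability _ (RGenOpens.measurableE R)).
move=> _ [_ [a [b ->] <-]]; rewrite setTI; apply: open_measurable_mx.
exact/cf/interval_open.
Qed.

Lemma measurable_comp_mx d (T : measurableType d) D m n (u : T -> 'M[R]_(m, n))
    (f : 'M[R]_(m, n) -> R) : measurable D -> continuous f ->
  (forall i j, measurable_fun D (fun x => u x i j)) ->
  measurable_fun D (fun x => f (u x)).
Proof.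
move=> mD cf mu; apply: (measurableT_comp (continuous_measurable_mx cf)).
apply: (measurability (@mx_generators R m n)) => //.
move=> _ [_ [i [j [Y [mY ->]]]] <-].
by have := mu i j mD Y mY.
Qed.

Lemma rVuncons_continuous d : continuous (fun v : 'rV[R]_(d + 1) =>
  (lsubmx v, v 0 (rshift d 0))).
Proof.
move=> v.
have h1 : (lsubmx w : 'rV[R]_d) @[w --> v] --> (lsubmx v : 'rV[R]_d).
  exact/differentiable_continuous/differentiable_lsubmx.
have h2 : w 0 (rshift d 0) @[w --> v] --> v 0 (rshift d 0).
  exact: coord_continuous.
exact: (cvg_pair h1 h2).
Qed.

(** The product sigma-algebra of space-time is compared with the topology by packing [(x, t)] into
    one row of length [d + 1], where open sets are already known to be measurable. *)
Lemma continuous_measurable_ST d (f : 'rV[R]_d * R -> R) : continuous f ->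
  measurable_fun [set: 'rV[R]_d * measurableTypeR R] (f : _ -> measurableTypeR R).
Proof.
move=> cf; rewrite [X in measurable_fun _ X](_ : _ = fun z : 'rV[R]_d * measurableTypeR R =>
   f (lsubmx (row_mx z.1 (z.2%:M : 'M[R]_1)), row_mx z.1 (z.2%:M : 'M[R]_1) 0 (rshift d 0))); last first.
  by apply/funext => -[x t]; rewrite row_mxKl row_mxEr mxE eqxx mulr1n.
apply: (@measurable_comp_mx _ _ setT _ _
    (fun z : 'rV[R]_d * measurableTypeR R => row_mx z.1 (z.2%:M : 'M[R]_1))
    (fun v => f (lsubmx v, v 0 (rshift d 0)))) => //.
  by move=> v; apply: continuous_comp; [exact: rVuncons_continuous|exact: cf].
move=> i j; case: (splitP j) => k jk.
  have -> : j = lshift 1 k by apply/val_inj.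
  under eq_fun do rewrite row_mxEl.
  exact: (measurableT_comp (measurable_coord _ _) measurable_fst).
have -> : j = rshift d k by apply/val_inj.
under eq_fun do rewrite row_mxEr mxE ord1 (ord1 k) eqxx mulr1n.
exact: measurable_snd.
Qed.

End open_measurable.

Section integrable_aux.
Context d (T : measurableType d) (R : realType) (mu : {measure set T -> \bar R}).
Local Open Scope ereal_scope.

Lemma integrable_le (D : set T) (f g : T -> R) : measurable D ->
  measurable_fun D f -> (forall x, D x -> `|f x| <= g x)%R ->
  mu.-integrable D (EFin \o g) -> mu.-integrable D (EFin \o f).
Proof.
move=> mD mf fg ig; apply: le_integrable ig => //; first exact/measurable_EFinP.
by move=> x Dx /=; rewrite lee_fin (le_trans (fg _ Dx))// ler_norm.
Qed.

Lemma integrable_normr_le (D : set T) (f g : T -> R) : measurable D ->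
  measurable_fun D f -> (forall x, D x -> `|f x| <= g x)%R ->
  mu.-integrable D (EFin \o g) ->
  (`|\int[mu]_(x in D) f x| <= \int[mu]_(x in D) g x)%R.
Proof.
move=> mD mf fg ig; have i_f := integrable_le mD mf fg ig.
apply: le_trans (le_normr_Rintegral mD i_f) _.
by apply: le_Rintegral => //; exact: integrable_norm.
Qed.

Lemma integrable_prod_mul d' (T' : measurableType d')
    (m1 : {sigma_finite_measure set T -> \bar R})
    (m2 : {sigma_finite_measure set T' -> \bar R}) (f : T -> R) (g : T' -> R) :
  m1.-integrable setT (EFin \o f) -> m2.-integrable setT (EFin \o g) ->
  (m1 \x m2).-integrable setT (EFin \o (fun z => f z.1 * g z.2)%R).
Proof.
move=> i_f ig.
have mf : measurable_fun setT f by exact/measurable_EFinP/measurable_int/i_f.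
have mg : measurable_fun setT g by exact/measurable_EFinP/measurable_int/ig.
apply/integrable12ltyP.
  apply/measurable_EFinP/measurable_funM; exact: measurableT_comp.
have /integrableP[_ fy] := i_f; have /integrableP[_ gy] := ig.
have gfin : \int[m2]_y `|(g y)%:E| \is a fin_num.
  by rewrite ge0_fin_numE// integral_ge0.
under eq_integral => x _.
  under eq_integral => y _ do rewrite /= normrM EFinM.
  rewrite ge0_integralZl//; last exact/measurable_EFinP/measurableT_comp.
  over.
under eq_integral do rewrite /= -(fineK gfin).
rewrite ge0_integralZr//.
- apply: lte_mul_pinfty; rewrite ?ltry//; first exact: integral_ge0.
  by rewrite ge0_fin_numE// integral_ge0.
- exact/measurable_EFinP/measurableT_comp.
- by rewrite lee_fin fine_ge0// integral_ge0.
Qed.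

End integrable_aux.

(** * Calculus on the real line *)

Section line.
Context {R : realType}.

(** Along the line the two difference quotients are the same function of [h]. Only the derivative of
    [f] in direction [w] enters, so no chain rule for differentials is involved. *)
Lemma is_derive_affine (V W U : normedModType R) (A : V -> W) (f : W -> U) x v w d :
  (forall h, A (h *: v + x) = h *: w + A x) ->
  is_derive (A x) w f d -> is_derive x v (f \o A) d.
Proof.
move=> hA [fd dd].
have E : (fun h : R => h^-1 *: (((f \o A) \o shift x) (h *: v) - (f \o A) x)) =
    (fun h => h^-1 *: ((f \o shift (A x)) (h *: w) - f (A x))).
  by apply/funext => h; rewrite /= hA.
split; first by rewrite /derivable E.
by rewrite /derive E.
Qed.

Notation mu := (@lebesgue_measure R).

Lemma integrable_oneDsqrV :
  mu.-integrable setT (EFin \o (fun x : R => (1 + x ^+ 2)^-1)).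
Proof.
have c : continuous (fun x : R => (1 + x ^+ 2)^-1) by exact: continuous_oneDsqrV.
have p (x : R) : 0 <= (1 + x ^+ 2)^-1 by rewrite invr_ge0 addr_ge0// sqr_ge0.
apply/integrableP; split.
  by apply/measurable_EFinP; exact: continuous_measurable_fun.
under eq_integral do rewrite /= ger0_norm//.
rewrite ge0_symfun_integralT//; last by move=> x; rewrite /= sqrrN.
rewrite (_ : [set x | 0 <= x] = `[0, +oo[%classic); last first.
  by rewrite set_itvcy.
by have := @integral0y_oneDsqr R; rewrite /oneDsqr => ->; rewrite -EFinM ltry.
Qed.

(** On [[- (n + 1), n + 1]] the fundamental theorem leaves boundary terms; the bound on [f] sends
    them to 0, and the bound on [g] allows dominated convergence. *)
Lemma integral_derive0 (f g : R -> R) (C : R) :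
  (forall x : R, is_derive x (1 : R) f (g x)) -> continuous g ->
  (forall x, `|f x| <= C * (1 + x ^+ 2)^-1) ->
  (forall x, `|g x| <= C * (1 + x ^+ 2)^-1) ->
  (\int[mu]_x (g x)%:E = 0)%E.
Proof.
move=> fg cg bf bg.
have mg : measurable_fun setT g by exact: continuous_measurable_fun.
have iC : mu.-integrable setT (EFin \o (fun x : R => C * (1 + x ^+ 2)^-1)).
  exact: (integrableZl measurableT C integrable_oneDsqrV).
pose I n : set R := `[- n.+1%:R, n.+1%:R]%classic.
have [||||_ _] := @dominated_convergence _ _ _ mu setT measurableT
  (fun n => EFin \o (g \_ (I n))) (EFin \o g) (EFin \o (fun x : R => C * (1 + x ^+ 2)^-1)) _ _ _ iC.
- move=> n; apply/measurable_EFinP; apply/measurable_restrict => //.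
    exact: measurable_itv.
  exact: measurable_funS mg.
- exact/measurable_EFinP.
- apply: aeW => x _ /=; apply: cvg_near_cst.
  exists (Num.trunc `|x|) => // n /= xn; congr EFin; rewrite patchE.
  rewrite mem_set// /I /= in_itv /= -ler_norml.
  apply: ltW; apply: lt_le_trans (truncnS_gt _) _.
  by rewrite ler_nat.
- apply: aeW => x n _ /=; rewrite lee_fin patchE.
  by case: ifP => // _; rewrite normr0 (le_trans _ (bg x)).
rewrite /= => h.
have E n : (\int[mu]_x ((g \_ (I n)) x)%:E = (f n.+1%:R - f (- n.+1%:R))%:E)%E.
  transitivity (\int[mu]_(x in I n) (g x)%:E)%E.
    by rewrite [RHS]integral_mkcond restrict_EFin.
  rewrite (@continuous_FTC2 _ _ f)//.
  - by rewrite gtrN.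
  - exact: continuous_subspaceT.
  - have cf : continuous f.
      move=> x; have [df _] := fg x.
      by apply/differentiable_continuous/derivable1_diffP.
    split; [|exact/cvg_at_right_filter/cf|exact/cvg_at_left_filter/cf].
    by move=> x _; have [] := fg x.
  - by move=> x _; rewrite derive1E; have [_ ->] := fg x.
move: h; rewrite (funext E : _ = (fun n => (f n.+1%:R - f (- n.+1%:R))%:E)) => h.
apply: (cvg_unique _ h) => //.
apply: cvg_EFin; first by near=> n.
apply: norm_cvg0.
apply: (@squeeze_cvgr _ _ _ _ (cst 0) (fun n => 2 * C / n.+1%:R)).
- near=> n; rewrite normr_ge0 /=; apply: le_trans (ler_normB _ _) _.
  have C0 : 0 <= C.
    by have := bf 0; rewrite expr0n addr0 invr1 mulr1; apply: le_trans.
  have H : C * (1 + n.+1%:R ^+ 2)^-1 <= C / n.+1%:R.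
    have p : 0 < 1 + n.+1%:R ^+ 2 :> R by rewrite ltr_pwDl// sqr_ge0.
    apply: ler_wpM2l => //; rewrite lef_pV2 ?posrE//.
    have : 1 <= n.+1%:R :> R by rewrite ler1n.
    by rewrite expr2; nra.
  rewrite -mulrA mulr_natl mulr2n; apply: lerD.
    exact: le_trans (bf _) H.
  by apply: le_trans (bf _) _; rewrite sqrrN.
- exact: cvg_cst.
- rewrite -[X in _ --> X](mulr0 (2 * C)).
  by apply: cvgMr; exact: cvg_harmonic.
Unshelve. all: by end_near. Qed.

End line.

(** * The product weight and integration by parts on R^d *)

Section weight.
Context {R : realType}.

(** A product in place of a power of $1+|x|^2$: its inverse is integrable by Fubini one coordinate
    at a time, freezing a coordinate leaves a weight of the same form, and two integrations by parts
    in one direction gain exactly one factor. *)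
Definition wt d (x : 'rV[R]_d) : R := \prod_(j < d) (1 + x 0 j ^+ 2).

Lemma wt_ge1 d (x : 'rV[R]_d) : 1 <= wt x.
Proof.
rewrite /wt; elim/big_ind : _ => // [a b|i _]; first exact: mulr_ege1.
by rewrite lerDl sqr_ge0.
Qed.

Lemma wt_gt0 d (x : 'rV[R]_d) : 0 < wt x.
Proof. exact: lt_le_trans (wt_ge1 x). Qed.

Lemma wtV_gt0 d (x : 'rV[R]_d) : 0 < (wt x)^-1.
Proof. by rewrite invr_gt0 wt_gt0. Qed.

Lemma wt_cons n (p : R * 'rV[R]_n) : wt (rVcons p) = (1 + p.1 ^+ 2) * wt p.2.
Proof.
rewrite /wt big_ord_recl; congr (_ * _).
  have -> : ord0 = lshift n ord0 :> 'I_(1 + n) by apply/val_inj.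
  by rewrite (@row_mxEl _ 1 1 n) mxE eqxx.
apply: eq_bigr => i _.
have -> : lift ord0 i = rshift 1 i :> 'I_(1 + n) by apply/val_inj.
by rewrite (@row_mxEr _ 1 1 n).
Qed.

Lemma coord_le_norm d (x : 'rV[R]_d) j : `|x 0 j| <= `|x|.
Proof.
rewrite [`|x|]mx_normrE.
exact: (le_bigmax _ (fun ij : 'I_1 * 'I_d => `|x ij.1 ij.2|) (0, j)).
Qed.

Lemma wt_factor_le d (x : 'rV[R]_d) j : 1 + x 0 j ^+ 2 <= wt x.
Proof.
rewrite /wt (bigD1 j)//= ler_peMr ?addr_ge0 ?sqr_ge0//.
elim/big_ind : _ => // [a b|i _]; first exact: mulr_ege1.
by rewrite lerDl sqr_ge0.
Qed.

Lemma coord_le_wt d (x : 'rV[R]_d) j : `|x 0 j| <= wt x.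
Proof.
apply: le_trans (wt_factor_le x j).
by have := sqr_ge0 (`|x 0 j| - 1); rewrite -(real_normK (num_real (x 0 j))); nra.
Qed.

Lemma dotv_le_wt d (x : 'rV[R]_d) : 1 + dotv x x <= wt x.
Proof.
suff: (0 <= dotv x x) && (1 + dotv x x <= wt x) by case/andP.
rewrite /dotv big_ord1 /wt; elim/big_rec2 : _ => [|i a b _ /andP[a0 ab]].
  by rewrite addr0 !lexx.
have b0 : 0 <= x 0 i * x 0 i by rewrite -expr2 sqr_ge0.
rewrite addr_ge0//= expr2; set s := _ * _ in b0 *.
have : 0 <= s * (a - 1) by rewrite mulr_ge0//; lra.
nra.
Qed.

End weight.

Section leb_integral.
Context {R : realType}.
Local Open Scope ereal_scope.
Notation mu := (@lebesgue_measure R).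

Lemma rVconsE0 n (p : R * 'rV[R]_n) : rVcons p ord0 ord0 = p.1.
Proof.
have -> : ord0 = lshift n ord0 :> 'I_(1 + n) by apply/val_inj.
by rewrite (@row_mxEl _ 1 1 n) mxE eqxx.
Qed.

Lemma rVconsES n (p : R * 'rV[R]_n) j : rVcons p ord0 (lift ord0 j) = p.2 ord0 j.
Proof.
have -> : lift ord0 j = rshift 1 j :> 'I_(1 + n) by apply/val_inj.
by rewrite (@row_mxEr _ 1 1 n).
Qed.

Lemma rVunconsK n : cancel (@rVuncons R n) (@rVcons R n).
Proof.
move=> v; apply/rowP => i.
case: (unliftP ord0 i) => [i' ->|->]; last by rewrite rVconsE0.
rewrite rVconsES /= mxE; congr (v _ _); exact/val_inj.
Qed.

(* [R] carries its own measurable structure, convertible to that of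
   [measurableTypeR R]. *)
Let rVcons_measurable n :
  measurable_fun [set: measurableTypeR R * 'rV[R]_n] (@rVcons R n).
Proof. exact: measurable_rVcons. Qed.

(** [leb R n.+1] is the image of the product measure under [rVcons]; the change of variables for
    nonnegative functions and the inverse map [rVuncons] transfer integrability both ways. *)
Lemma leb_integrableS n (f : 'rV[R]_n.+1 -> R) :
  (leb R n.+1).-integrable setT (EFin \o f) <->
  (mu \x leb R n).-integrable setT (EFin \o (fun p => f (rVcons p))).
Proof.
have E : forall g : 'rV[R]_n.+1 -> \bar R, measurable_fun setT g ->
   (forall x, 0 <= g x) ->
   \int[leb R n.+1]_x g x = \int[mu \x leb R n]_p g (rVcons p).
  move=> g mg g0.
  have := ge0_integral_pushforward (@rVcons_measurable n)
    (mu \x leb R n)%E measurableT mg (fun y _ => g0 y).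
  by rewrite preimage_setT => <-; exact: eq_measure_integral.
split=> /integrableP[mf fy]; apply/integrableP.
  have mf' : measurable_fun setT (EFin \o (fun p => f (rVcons p))).
    exact: (measurableT_comp mf (@measurable_rVcons R n)).
  by split=> //; rewrite E// in fy; exact: measurableT_comp.
have mf' : measurable_fun setT (EFin \o f).
  rewrite (_ : EFin \o f = (EFin \o (fun p => f (rVcons p))) \o (@rVuncons R n)).
    exact: (measurableT_comp mf (@measurable_rVuncons R n)).
  by apply/funext => v /=; rewrite rVunconsK.
by split=> //; rewrite E//; exact: measurableT_comp.
Qed.

Lemma leb_integralS n (f : 'rV[R]_n.+1 -> R) :
  (leb R n.+1).-integrable setT (EFin \o f) ->
  \int[leb R n.+1]_x (f x)%:E = \int[mu \x leb R n]_p (f (rVcons p))%:E.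
Proof.
move=> i_f.
have mf := measurable_int _ i_f.
have if' := (leb_integrableS f).1 i_f.
have := integral_pushforward (@rVcons_measurable n) mf if' measurableT.
by rewrite preimage_setT => <-; exact: eq_measure_integral.
Qed.

Lemma integrable_wtV n : (leb R n).-integrable setT (EFin \o (fun x : 'rV[R]_n => (wt x)^-1)%R).
Proof.
elim: n => [|n ih].
  rewrite (_ : _ \o _ = cst 1); last first.
    by apply/funext => x /=; rewrite /wt big_ord0 invr1.
  apply/integrableP; split=> //.
  under eq_integral do rewrite /= normr1.
  by rewrite integral_cst// mul1e /= diracT ltry.
apply/leb_integrableS; rewrite (_ : _ \o _ =
  EFin \o (fun p : R * 'rV[R]_n => ((1 + p.1 ^+ 2)^-1 * (wt p.2)^-1)%R)); last first.
  by apply/funext => p /=; rewrite wt_cons invfM.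
exact: (integrable_prod_mul integrable_oneDsqrV ih).
Qed.

Lemma rVcons_shift0 n (r h : R) (v : 'rV[R]_n) :
  rVcons (h + r, v)%R = (h *: basis_vec R ord0 + rVcons (r, v))%R.
Proof.
apply/rowP => i; rewrite [in RHS]mxE [in RHS]mxE [in RHS]mxE eqxx /=.
case: (unliftP ord0 i) => [i' ->|->]; first by rewrite !rVconsES /= mulr0 add0r.
by rewrite !rVconsE0 /= mulr1.
Qed.

Lemma rVcons_shift n (r h : R) (v : 'rV[R]_n) j :
  rVcons (r, h *: basis_vec R j + v)%R = (h *: basis_vec R (lift ord0 j) + rVcons (r, v))%R.
Proof.
apply/rowP => i; rewrite [in RHS]mxE [in RHS]mxE [in RHS]mxE eqxx /=.
case: (unliftP ord0 i) => [i' ->|->]; last by rewrite !rVconsE0 /= mulr0 add0r.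
by rewrite !rVconsES /= !mxE eqxx /= (inj_eq lift_inj).
Qed.

Lemma rVcons_continuousl n (v : 'rV[R]_n) : continuous (fun r : R => rVcons (r, v)).
Proof.
move=> r A /= /nbhs_ballP[e /= e0 eA]; apply/nbhs_ballP; exists e => //= s rs.
apply: eA; split=> // i j; rewrite ord1.
by case: (unliftP ord0 j) => [j' ->|->]; rewrite ?rVconsES ?rVconsE0//; exact: ballxx.
Qed.

Lemma rVcons_continuousr n (r : R) : continuous (fun v : 'rV[R]_n => rVcons (r, v)).
Proof.
move=> v A /= /nbhs_ballP[e /= e0 eA]; apply/nbhs_ballP; exists e => //= s [_ rs].
apply: eA; split=> // i j; rewrite ord1.
by case: (unliftP ord0 j) => [j' ->|->]; rewrite ?rVconsES ?rVconsE0//; exact: ballxx.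
Qed.

(** Fubini, with the direction of differentiation integrated in the inner integral: the first
    coordinate is the one-dimensional case, and for any other the first coordinate [r] is frozen,
    which leaves the constant [C / (1 + r ^ 2)] to the induction hypothesis. *)
Lemma leb_integral_derive0 n (f g : 'rV[R]_n -> R) (j : 'I_n) (C : R) :
  (forall x, is_derive x (basis_vec R j) f (g x)) -> continuous g ->
  (forall x, `|f x| <= C * (wt x)^-1)%R ->
  (forall x, `|g x| <= C * (wt x)^-1)%R ->
  \int[leb R n]_x (g x)%:E = 0.
Proof.
elim: n => [|n ih] in f g j C *; first by case: j.
move=> fg cg bf bg.
have ig : (leb R n.+1).-integrable setT (EFin \o g).
  apply: (@integrable_le _ _ _ _ _ g (fun x => C * (wt x)^-1)%R) => //.
    exact: continuous_measurable_mx.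
  exact: (integrableZl measurableT C (integrable_wtV _)).
have [ig'] := (leb_integrableS g).1 ig.
rewrite leb_integralS//.
case: (unliftP ord0 j) => [j' jj'|j0].
  rewrite -integral12_prod_meas1// integral0_eq// => r _.
  apply: (ih (fun v => f (rVcons (r, v))) (fun v => g (rVcons (r, v))) j' (C / (1 + r ^+ 2))%R).
  - move=> v; apply: (is_derive_affine (w := basis_vec R j)) => //.
    by move=> h; rewrite rVcons_shift jj'.
  - by move=> v; apply: continuous_comp; [exact: rVcons_continuousr|exact: cg].
  - by move=> v; have := bf (rVcons (r, v)); rewrite wt_cons invfM mulrA.
  - by move=> v; have := bg (rVcons (r, v)); rewrite wt_cons invfM mulrA.
rewrite -integral21_prod_meas1// integral0_eq// => v _.
apply: (@integral_derive0 _ (fun r => f (rVcons (r, v))) (fun r => g (rVcons (r, v))) (C / wt v)%R).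
- move=> r; apply: (@is_derive_affine _ R _ _ (fun r => rVcons (r, v)) f r 1 (basis_vec R ord0)).
    by move=> h; rewrite [h *: 1]mulr1 rVcons_shift0.
  by rewrite -j0.
- by move=> r; apply: continuous_comp; [exact: rVcons_continuousl|exact: cg].
- by move=> r; have := bf (rVcons (r, v)); rewrite wt_cons invfM mulrCA mulrC.
- by move=> r; have := bg (rVcons (r, v)); rewrite wt_cons invfM mulrCA mulrC.
Qed.

End leb_integral.

(** * Smooth families with weighted bounds on all derivatives *)

Section iter_derive.
Context {R : realType}.
Implicit Types V W : normedModType R.

Lemma iter_derive_rcons V (vs : seq V) v (f : V -> R) :
  iter_derive (rcons vs v) f = iter_derive vs ('D_v f).
Proof. by rewrite /iter_derive foldr_rcons. Qed.

Lemma iter_derive_cat V (us vs : seq V) (f : V -> R) :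
  iter_derive (us ++ vs) f = iter_derive us (iter_derive vs f).
Proof. by rewrite /iter_derive foldr_cat. Qed.

(* [al] is a weight: [BC al f] says that all derivatives of the smooth
   functions [f i] are [O(1 / al)], uniformly in [i]; [BCn n] stops at order [n]. *)
Definition BCn (n : nat) V (I : Type) (al : V -> R) (f : I -> V -> R) :=
  forall vs : seq V, (size vs <= n)%N ->
    (forall i x, differentiable (iter_derive vs (f i)) x) /\
    exists C, forall i x, al x * `|iter_derive vs (f i) x| <= C.

Definition BC V (I : Type) (al : V -> R) (f : I -> V -> R) :=
  forall vs : seq V,
    (forall i x, differentiable (iter_derive vs (f i)) x) /\
    exists C, forall i x, al x * `|iter_derive vs (f i) x| <= C.

Definition BC0 V (I : Type) (al : V -> R) (f : I -> V -> R) :=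
  (forall i x, differentiable (f i) x) /\
  exists C, forall i x, al x * `|f i x| <= C.

Lemma BCP V I (al : V -> R) (f : I -> V -> R) : BC al f <-> forall n, BCn n al f.
Proof.
split=> [h n vs _|h vs]; first exact: h.
exact: (h (size vs) vs (leqnn _)).
Qed.

(** [iter_derive] folds from the right, so the last direction of the list is differentiated first;
    [rcons] therefore isolates the innermost derivative. *)
Lemma BCnS V I n (al : V -> R) (f : I -> V -> R) :
  BCn n.+1 al f <-> BC0 al f /\ forall v, BCn n al (fun i => 'D_v (f i)).
Proof.
split=> [h|[h0 h] vs].
  split=> [|v vs vsn]; first exact: (h [::]).
  have := h (rcons vs v); rewrite size_rcons ltnS => /(_ vsn)[df [C hC]].
  split=> [i x|]; first by rewrite -iter_derive_rcons.
  by exists C => i x; rewrite -iter_derive_rcons.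
case/lastP: vs => [_|vs v]; first exact: h0.
rewrite size_rcons ltnS => vsn; have [df [C hC]] := h v _ vsn.
split=> [i x|]; first by rewrite iter_derive_rcons.
by exists C => i x; rewrite iter_derive_rcons.
Qed.

Lemma BCn0 V I (al : V -> R) (f : I -> V -> R) : BCn 0 al f <-> BC0 al f.
Proof. by split=> [h|h vs]; [exact: (h [::])|case: vs]. Qed.

Lemma BC_BC0 V I (al : V -> R) (f : I -> V -> R) : BC al f -> BC0 al f.
Proof. by move/(_ [::]). Qed.

(** Most families below are differentiated into families of the same shape. Taking that shape as [P]
    spares any formula for iterated derivatives. *)
Lemma BC_coind V I (al : V -> R) (P : (I -> V -> R) -> Prop) :
  (forall f, P f -> BC0 al f) ->
  (forall f v, P f -> P (fun i => 'D_v (f i))) ->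
  forall f, P f -> BC al f.
Proof.
move=> P0 PD f Pf; apply/BCP => n; elim: n => [|n ih] in f Pf *.
  by apply/BCn0/P0.
by apply/BCnS; split; [exact: P0|move=> v; exact/ih/PD].
Qed.

Lemma BC_derive V I (al : V -> R) (f : I -> V -> R) v :
  BC al f -> BC al (fun i => 'D_v (f i)).
Proof. by move=> /BCP h; apply/BCP => n; have /BCnS[_] := h n.+1; exact. Qed.

Lemma BC_coindS V I (al : V -> R) (f : I -> V -> R) :
  BC0 al f -> (forall v, BC al (fun i => 'D_v (f i))) -> BC al f.
Proof.
move=> h0 h; apply/BCP => -[|n]; first exact/BCn0.
by apply/BCnS; split=> // v; have /BCP := h v; exact.
Qed.

Lemma BC_smooth V I (al : V -> R) (f : I -> V -> R) i : BC al f -> smooth (f i).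
Proof. by move=> h vs x; have [+ _] := h vs; exact. Qed.

(** With the weight 0 the bounds are void, so smoothness becomes an instance of [BC] and inherits
    its closure properties. *)
Lemma smooth_BC V (f : V -> R) : smooth f -> BC (cst 0) (fun _ : unit => f).
Proof. by move=> sf vs; split=> // ; exists 0 => i x; rewrite mul0r. Qed.

Lemma smooth_derive V (f : V -> R) v : smooth f -> smooth ('D_v f).
Proof. by move/smooth_BC/(BC_derive v)/(BC_smooth tt). Qed.

Lemma smooth_differentiable V (f : V -> R) x : smooth f -> differentiable f x.
Proof. by move/(_ [::]). Qed.

Lemma smooth_continuous V (f : V -> R) : smooth f -> continuous f.
Proof. by move=> sf x; apply/differentiable_continuous/smooth_differentiable. Qed.

Lemma BC_weight V I (al be : V -> R) (f : I -> V -> R) (K : R) : 0 <= K ->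
  (forall x, be x <= K * al x) -> BC al f -> BC be f.
Proof.
move=> K0 bal h vs; have [df [C hC]] := h vs; split=> //; exists (K * C) => i x.
by apply: le_trans (ler_wpM2r _ (bal x)) _ => //; rewrite -mulrA ler_wpM2l.
Qed.

Lemma BC_reindex V I J (al : V -> R) (f : I -> V -> R) (h : J -> I) :
  BC al f -> BC al (fun j => f (h j)).
Proof. by move=> bf vs; have [df [C hC]] := bf vs; split=> //; exists C. Qed.

Lemma BC_ext V I (al : V -> R) (f g : I -> V -> R) :
  (forall i x, f i x = g i x) -> BC al f -> BC al g.
Proof. by move=> fg; rewrite (_ : f = g)//; apply/funext => i; exact/funext. Qed.

Lemma BCnD n V I (al : V -> R) (f g : I -> V -> R) : (forall x, 0 <= al x) ->
  BCn n al f -> BCn n al g -> BCn n al (fun i x => f i x + g i x).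
Proof.
move=> al0.
have h0 f1 g1 : BC0 al f1 -> BC0 al g1 -> BC0 al (fun (i : I) x => f1 i x + g1 i x).
  move=> [df [C hC]] [dg [D hD]]; split=> [i x|]; first exact: differentiableD.
  exists (C + D) => i x; apply: le_trans (lerD (hC i x) (hD i x)).
  by rewrite -mulrDr ler_wpM2l// ler_normD.
elim: n => [|n ih] in f g *.
  by move=> /BCn0 f0 /BCn0 g0; exact/BCn0/h0.
move=> /BCnS[f0 fS] /BCnS[g0 gS]; apply/BCnS; split; first exact: h0.
move=> v; have -> : (fun i => 'D_v (fun x => f i x + g i x)) =
    (fun i x => 'D_v (f i) x + 'D_v (g i) x).
  apply/funext => i; apply/funext => x.
  by rewrite -deriveD//; apply: diff_derivable; [apply: f0.1|apply: g0.1].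
by apply: ih; [apply: fS|apply: gS].
Qed.

Lemma BCD V I (al : V -> R) (f g : I -> V -> R) : (forall x, 0 <= al x) ->
  BC al f -> BC al g -> BC al (fun i x => f i x + g i x).
Proof. by move=> al0 /BCP hf /BCP hg; apply/BCP => n; exact: BCnD. Qed.

Lemma BC_cst V I (al : V -> R) (c : I -> R) (K L : R) :
  (forall i, `|c i| <= K) -> (forall x, 0 <= al x <= L) ->
  BC al (fun i (_ : V) => c i).
Proof.
move=> cK alL.
apply: (@BC_coind V I al (fun f => exists2 c : I -> R, exists K, forall i, `|c i| <= K &
    f = fun i _ => c i)); last by exists c => //; exists K.
- move=> _ [c' [K' hK] ->]; split=> [i x|]; first exact: differentiable_cst.
  exists (L * K') => i x; have /andP[a0 aL] := alL x; exact: ler_pM.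
- move=> _ v [c' [K' hK] ->]; exists (fun=> 0).
    by exists 0 => i; rewrite normr0.
  by apply/funext => i; apply/funext => x; exact: derive_cst.
Qed.

(** Induction on the order, because the product rule yields a sum of two products in which one
    factor is not differentiated and must still be bounded up to the lower order. *)
Lemma BCnM n V I (al be : V -> R) (f g : I -> V -> R) :
  (forall x, 0 <= al x) -> (forall x, 0 <= be x) ->
  BCn n al f -> BCn n be g ->
  BCn n (fun x => al x * be x) (fun i x => f i x * g i x).
Proof.
move=> al0 be0.
have h0 f1 g1 : BC0 al f1 -> BC0 be g1 ->
    BC0 (fun x => al x * be x) (fun (i : I) x => f1 i x * g1 i x).
  move=> [df [C hC]] [dg [D hD]]; split=> [i x|]; first exact: differentiableM.
  exists (C * D) => i x; rewrite normrM mulrACA.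
  by apply: ler_pM => //; exact: mulr_ge0.
elim: n => [|n ih] in f g *.
  by move=> /BCn0 f0 /BCn0 g0; exact/BCn0/h0.
move=> fn gn; have /BCnS[f0 fS] := fn; have /BCnS[g0 gS] := gn.
have fn' : BCn n al f by move=> vs vsn; apply/fn/leqW.
have gn' : BCn n be g by move=> vs vsn; apply/gn/leqW.
apply/BCnS; split; first exact: h0.
move=> v; have -> : (fun i => 'D_v (fun x => f i x * g i x)) =
    (fun i x => f i x * 'D_v (g i) x + 'D_v (f i) x * g i x).
  apply/funext => i; apply/funext => x.
  rewrite (@deriveM _ _ (f i) (g i)); last 2 first.
  - by apply: diff_derivable; apply: f0.1.
  - by apply: diff_derivable; apply: g0.1.
  by rewrite [g i x *: _]mulrC.
apply: BCnD; first by move=> x; exact: mulr_ge0.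
- by apply: ih; [|apply: gS].
- by apply: ih; [apply: fS|].
Qed.

Lemma BCM V I (al be : V -> R) (f g : I -> V -> R) :
  (forall x, 0 <= al x) -> (forall x, 0 <= be x) ->
  BC al f -> BC be g -> BC (fun x => al x * be x) (fun i x => f i x * g i x).
Proof. by move=> al0 be0 /BCP hf /BCP hg; apply/BCP => n; exact: BCnM. Qed.

Lemma BCZ V I (al : V -> R) (c : I -> R) (f : I -> V -> R) (K : R) :
  (forall x, 0 <= al x) -> (forall i, `|c i| <= K) ->
  BC al f -> BC al (fun i x => c i * f i x).
Proof.
move=> al0 cK bf; apply: (@BC_weight _ _ (fun x => 1 * al x) al _ 1) => //.
  by move=> x; rewrite !mul1r.
apply: BCM => //; apply: (BC_cst (K := K) (L := 1)) => //.
by move=> x; rewrite ler01 lexx.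
Qed.

Lemma BC_zero V I (al : V -> R) : BC al (fun (_ : I) (_ : V) => 0).
Proof.
apply: (@BC_coind _ _ al (eq (fun _ _ => 0))) => // [_ <-|_ v <-].
  split=> [_ x|]; first exact: differentiable_cst.
  by exists 0 => _ x; rewrite normr0 mulr0.
by apply/funext => _; apply/funext => x; rewrite derive_cst.
Qed.

Lemma BC_sum V I (T : Type) (r : seq T) (al : V -> R) (f : T -> I -> V -> R) :
  (forall x, 0 <= al x) -> (forall t, BC al (f t)) ->
  BC al (fun i x => \sum_(t <- r) f t i x).
Proof.
move=> al0 bf; elim: r => [|t r ih].
  by apply: (BC_ext _ (@BC_zero V I al)) => i x; rewrite big_nil.
apply: (@BC_ext _ _ _ (fun i x => f t i x + \sum_(t <- r) f t i x)) => [i x|].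
  by rewrite big_cons.
exact: BCD.
Qed.

Lemma BC_affine V W I (al : W -> R) (f : I -> W -> R) (A L : V -> W) :
  (forall h v x, A (h *: v + x) = h *: L v + A x) ->
  (forall x, differentiable A x) ->
  BC al f -> BC (al \o A) (fun i => f i \o A).
Proof.
move=> hA dA bf.
apply: (@BC_coind V I (al \o A) (fun g => exists2 f, BC al f & g = fun i => f i \o A)).
- move=> _ [f' bf' ->]; have [df [C hC]] := BC_BC0 bf'; split.
    by move=> i x; exact: differentiable_comp.
  by exists C => i x; exact: hC.
- move=> _ v [f' bf' ->]; exists (fun i => 'D_(L v) (f' i)); first exact: BC_derive.
  apply/funext => i; apply/funext => x /=.
  apply: derive_val; apply: (@is_derive_affine _ _ _ _ A (f' i) x v (L v)) => //.
  by apply/derivableP/diff_derivable; exact: (BC_BC0 bf').1.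
- by exists f.
Qed.

Lemma BC_scalar V I (al : V -> R) (l : {linear V -> R}) (K : R) : continuous l ->
  (forall x, al x * `|l x| <= K) -> (forall x, 0 <= al x <= K) ->
  BC al (fun _ : I => l : V -> R).
Proof.
move=> cl hl hal; apply: BC_coindS.
  by split=> [i x|]; [exact: linear_differentiable|exists K].
move=> v; apply: (@BC_ext _ _ _ (fun _ _ => l v)) => [i x|].
  rewrite deriveE; first by rewrite diff_lin.
  exact: linear_differentiable.
exact: (BC_cst (K := `|l v|) (L := K)).
Qed.

(** Each derivative brings out one more factor [la i] of modulus at most 1; the class for the
    coinduction carries the accumulated factor as a coefficient [c i]. *)
Lemma BC_dilation V I (f : V -> R) (la : I -> R) :
  (forall i, `|la i| <= 1) -> BC (cst 1) (fun _ : unit => f) ->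
  BC (cst 1) (fun i x => f (la i *: x)).
Proof.
move=> la1 bf.
apply: (@BC_coind V I (cst 1) (fun g => exists (c : I -> R) (f : V -> R),
  [/\ forall i, `|c i| <= 1, BC (cst 1) (fun _ : unit => f) &
    g = fun i x => c i * f (la i *: x)])).
- move=> _ [c [f' [c1 bf' ->]]]; have [df [C hC]] := BC_BC0 bf'; split.
    move=> i x; apply: differentiableM => //; apply: differentiable_comp => //.
    exact: df tt _.
  exists C => i x; apply: le_trans (hC tt (la i *: x)).
  by rewrite !mul1r normrM ler_piMl.
- move=> _ v [c [f' [c1 bf' ->]]].
  exists (fun i => c i * la i), ('D_v f'); split.
  + by move=> i; rewrite normrM mulr_ile1.
  + exact: (BC_derive v bf').
  + apply/funext => i; apply/funext => x.
    have dfx y w : derivable f' y w by apply/diff_derivable; exact: (BC_BC0 bf').1 tt _.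
    have D : is_derive x v (f' \o (fun y => la i *: y)) ('D_(la i *: v) f' (la i *: x)).
      apply: (@is_derive_affine _ _ _ _ (fun y => la i *: y) f' x v (la i *: v)) => //.
      by move=> h; rewrite scalerDr !scalerA mulrC.
    rewrite (deriveZ (c i) (@ex_derive _ _ _ _ _ _ _ D)) (@derive_val _ _ _ _ _ _ _ D).
    have df' y : differentiable f' y by exact: (BC_BC0 bf').1 tt _.
    rewrite (deriveE _ (df' _)) linearZ -(deriveE _ (df' _)).
    by rewrite -mulrA.
- exists (fun=> 1), f; split=> //; first by move=> i; rewrite normr1.
  by apply/funext => i; apply/funext => x; rewrite mul1r.
Qed.

End iter_derive.

(** * Coordinate frames and directional derivatives *)

Section frame.
Context {R : realType}.
Implicit Types V W : normedModType R.

(** Common form of the standard bases of $\mathbb R^d$, of $\mathbb R$, of columns and of products: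
    a derivative in an arbitrary direction becomes a finite sum of derivatives along [e], with
    coefficients at most the norm of the direction. *)
Record frame V (T : finType) (e : T -> V) (c : T -> V -> R) : Prop := Frame {
  frame_lin : forall i a u v, c i (a *: u + v) = a * c i u + c i v;
  frame_cont : forall i, continuous (c i);
  frame_sum : forall v, v = \sum_i c i v *: e i;
  frame_norm : forall i v, `|c i v| <= `|v| }.

Lemma frame_rV d : frame (@basis_vec R d) (fun j v => v 0 j).
Proof.
split.
- by move=> i a u v; rewrite !mxE.
- by move=> i; exact: coord_continuous.
- by move=> v; rewrite {1}[v]row_sum_delta.
- by move=> i v; exact: coord_le_norm.
Qed.

Lemma frame_R : frame (fun _ : unit => 1 : R^o) (fun _ t => t : R).
Proof.
split => //.
- by move=> _ x; exact: cvg_id.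
- by move=> v; rewrite big_const cardT enumT unlock /= addr0 [_ *: _]mulr1.
Qed.

Lemma frame_prod V W (T U : finType) (e : T -> V) c (f : U -> W) c' :
  frame e c -> frame f c' ->
  frame (fun i : T + U => match i with inl i => (e i, 0) | inr i => (0, f i) end)
   (fun i (v : V * W) => match i with inl i => c i v.1 | inr i => c' i v.2 end).
Proof.
move=> [c1 c2 c3 c4] [d1 d2 d3 d4]; split.
- by move=> [i|i] a u v /=; [exact: c1|exact: d1].
- move=> [i|i] v.
    by apply: (continuous_comp (f := fst)); [exact: cvg_fst|exact: c2].
  by apply: (continuous_comp (f := snd)); [exact: cvg_snd|exact: d2].
- move=> [v w]; rewrite big_sumType /= [in LHS](c3 v) [in LHS](d3 w).
  apply/pair_equal_spec; split.
    rewrite !(big_morph fst (id1 := 0) (op1 := +%R))//= [X in _ + X]big1 ?addr0//.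
    by move=> i _; rewrite scaler0.
  rewrite !(big_morph snd (id1 := 0) (op1 := +%R))//= [X in X + _]big1 ?add0r//.
  by move=> i _; rewrite scaler0.
- move=> [i|i] [v w] /=; rewrite [`|(v, w)|]/(Num.max _ _) le_max.
    by rewrite c4.
  by rewrite d4 orbT.
Qed.

Lemma derive_frame V (T : finType) (e : T -> V) c (f : V -> R) x v :
  frame e c -> differentiable f x ->
  'D_v f x = \sum_i c i v * 'D_(e i) f x.
Proof.
move=> fr df; rewrite deriveE// {1}[v](frame_sum fr) linear_sum.
by apply: eq_bigr => i _; rewrite linearZ deriveE.
Qed.

Lemma is_derive_lincomb V (T : Type) (r : seq T) (a : T -> R) (f : T -> V -> R)
    (df : T -> R) x v : (forall t, is_derive x v (f t) (df t)) ->
  is_derive x v (fun x => \sum_(t <- r) a t * f t x) (\sum_(t <- r) a t * df t).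
Proof.
move=> fdf; elim: r => [|t r ih].
  rewrite big_nil (_ : (fun x => _) = cst 0); first exact: is_derive_cst.
  by apply/funext => y; rewrite big_nil.
rewrite big_cons (_ : (fun x => _) =
    (a t \*: f t) + (fun x => \sum_(t <- r) a t * f t x)).
  by apply: is_deriveD.
by apply/funext => y; rewrite big_cons.
Qed.

Lemma iter_derive_sum V (T : finType) (a : T -> R) (f : T -> V -> R) vs :
  (forall t, smooth (f t)) ->
  iter_derive vs (fun x => \sum_t a t * f t x) =
  fun x => \sum_t a t * iter_derive vs (f t) x.
Proof.
move=> sf; elim: vs => [//|v vs ih] /=; rewrite ih; apply/funext => x.
apply: derive_val; apply: is_derive_lincomb => t.
by apply/derivableP/diff_derivable; exact: sf.
Qed.

Lemma BC_frame V (T : finType) (e : T -> V) c I (al : V -> R) (f : I -> V -> R) :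
  frame e c -> (forall x, 0 <= al x) -> (forall i, smooth (f i)) ->
  (forall bs : seq T, exists C, forall i x,
     al x * `|iter_derive (map e bs) (f i) x| <= C) -> BC al f.
Proof.
move=> fr al0 sf hb vs; split=> [i x|]; first exact: sf.
(* The prefix [bs] of frame directions makes the induction possible: each arbitrary direction is
   expanded in the frame and joins the prefix. *)
suff H bs : exists C, forall i x, al x * `|iter_derive (map e bs ++ vs) (f i) x| <= C.
  exact: (H [::]).
elim: vs bs => [|v vs ih] bs; first by rewrite cats0; exact: hb.
have E i : iter_derive (map e bs ++ v :: vs) (f i) =
    fun x => \sum_j c j v * iter_derive (map e (rcons bs j) ++ vs) (f i) x.
  rewrite iter_derive_cat /=.
  have -> : 'D_v (iter_derive vs (f i)) =
     (fun x => \sum_j c j v * 'D_(e j) (iter_derive vs (f i)) x).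
    by apply/funext => x; rewrite (derive_frame _ fr)//; exact: sf.
  rewrite iter_derive_sum => [|j]; last first.
    by apply: smooth_derive => us x; rewrite -iter_derive_cat; exact: sf.
  apply/funext => x; apply: eq_bigr => j _.
  by rewrite map_rcons cat_rcons iter_derive_cat.
have {}ih : forall j, {C | forall i x, al x * `|iter_derive (map e (rcons bs j) ++ vs) (f i) x| <= C}.
  by move=> j; apply: cid; exact: ih.
exists (\sum_j `|c j v| * sval (ih j)) => i x.
rewrite E; apply: le_trans (ler_wpM2l (al0 x) (ler_norm_sum _ _ _)) _.
rewrite mulr_sumr; apply: ler_sum => j _; rewrite normrM mulrCA ler_wpM2l//.
exact: (svalP (ih j)).
Qed.

(** A quadratic remainder is in particular a little o, and uniqueness of the differential identifies
    it with [L]. *)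
Lemma differentiable_quadratic V (G : V -> R) x (L : {linear V -> R}) (C : R) :
  continuous L ->
  (forall h, `|h| <= 1 -> `|G (h + x) - G x - L h| <= C * `|h| ^+ 2) ->
  differentiable G x /\ forall v, 'D_v G x = L v.
Proof.
move=> cL hC.
have C0 : 0 <= `|C| by [].
have E : G \o shift x = cst (G x) + L +o_ 0 id.
  apply/eqaddoP => _/posnumP[eps]; near=> h.
  rewrite /= [X in `|X|](_ : _ = G (h + x) - G x - L h); last first.
    by rewrite !fctE /= opprD addrA.
  have h1 : `|h| <= 1 by near: h; apply: nbhs0_le.
  apply: le_trans (hC h h1) _.
  rewrite expr2 mulrA ler_wpM2r//; apply: le_trans (ler_wpM2r _ (ler_norm C)) _ => //.
  have : `|h| <= eps%:num / (`|C| + 1).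
    by near: h; apply: nbhs0_le; rewrite divr_gt0// ltr_wpDl.
  rewrite ler_pdivlMr ?ltr_wpDl// => hh.
  by apply: le_trans hh; rewrite mulrC ler_wpM2l// lerDl.
have dE := diff_unique cL E.
have dG : differentiable G x.
  by apply/diff_locallyP; rewrite dE.
by split=> // v; rewrite deriveE// dE.
Unshelve. all: by end_near. Qed.

End frame.

(** * Differentiation under the integral sign *)

Section under_integral.
Context {R : realType}.
Variable Z : normedModType R.

Lemma continuous_sum (T : Type) (r : seq T) (f : T -> Z -> R) :
  (forall i, continuous (f i)) -> continuous (fun v => \sum_(i <- r) f i v).
Proof.
move=> cf; elim: r => [|i r ih] v.
  rewrite (_ : (fun v => _) = cst 0); first exact: cvg_cst.
  by apply/funext => w; rewrite big_nil.
rewrite (_ : (fun v => _) = (fun v => f i v + \sum_(i <- r) f i v)).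
  by apply: cvgD; [exact: cf|exact: ih].
by apply/funext => w; rewrite big_cons.
Qed.

(** Two applications of the mean value theorem bound the remainder by [M] in place of [M / 2], which
    is enough. *)
Lemma taylor1 (f f1 f2 : R -> R) (M : R) :
  (forall s, is_derive s (1 : R) f (f1 s)) -> (forall s, is_derive s (1 : R) f1 (f2 s)) ->
  (forall s, 0 <= s <= 1 -> `|f2 s| <= M) ->
  `|f 1 - f 0 - f1 0| <= M.
Proof.
move=> d1 d2 fM.
have cont (u u' : R -> R) : (forall s, is_derive s (1 : R) u (u' s)) -> continuous u.
  move=> du s; apply/differentiable_continuous/derivable1_diffP.
  by have [] := du s.
have [s1] : exists2 s, s \in `[0, 1]%R & f 1 - f 0 = f1 s * (1 - 0).
  by apply: MVT_segment => //; apply: continuous_subspaceT; exact: cont d1.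
rewrite in_itv /= => /andP[s0 s11] ->; rewrite subr0 mulr1.
have [s2] : exists2 s, s \in `[0, s1]%R & f1 s1 - f1 0 = f2 s * (s1 - 0).
  by apply: MVT_segment => //; apply: continuous_subspaceT; exact: cont d2.
rewrite in_itv /= => /andP[s20 s21] ->; rewrite subr0 normrM (ger0_norm s0).
have /fM h : 0 <= s2 <= 1 by rewrite s20 (le_trans s21).
by rewrite (le_trans _ h)// ler_piMr.
Qed.

(** The segment from [z] to [h + z] reduces this to one variable; the second derivative along [h] is
    a double sum over the frame, whence the square of the number of frame vectors. *)
Lemma taylor_frame (T : finType) (e : T -> Z) c (f : Z -> R) (z h : Z) (M : R) :
  frame e c -> smooth f ->
  (forall i j y, `|y| <= `|h| -> `|'D_(e j) ('D_(e i) f) (y + z)| <= M) ->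
  `|f (h + z) - f z - 'D_h f z| <= (#|T|%:R ^+ 2 * M) * `|h| ^+ 2.
Proof.
move=> fr sf fM.
have sf1 : smooth ('D_h f) by exact: smooth_derive.
have line (g : Z -> R) (s : R) : smooth g ->
    is_derive s (1 : R) (fun s : R => g (s *: h + z)) ('D_h g (s *: h + z)).
  move=> sg.
  apply: (@is_derive_affine _ R Z _ (fun s : R => s *: h + z) g s 1 h).
    by move=> a; rewrite scalerDl [a *: 1]mulr1 addrA.
  exact/derivableP/diff_derivable/smooth_differentiable.
have := @taylor1 (fun s => f (s *: h + z)) (fun s => 'D_h f (s *: h + z))
  (fun s => 'D_h ('D_h f) (s *: h + z)) ((#|T|%:R ^+ 2 * M) * `|h| ^+ 2).
rewrite scale1r scale0r add0r; apply => [s|s|s /andP[s0 s1]].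
- exact: line.
- exact: line.
have E : 'D_h f = fun x => \sum_i c i h * 'D_(e i) f x.
  by apply/funext => x; rewrite (derive_frame _ fr)//; exact: smooth_differentiable.
have df i x : derivable ('D_(e i) f) x h.
  exact/diff_derivable/smooth_differentiable/smooth_derive.
have -> : 'D_h ('D_h f) (s *: h + z) =
    \sum_i c i h * \sum_j c j h * 'D_(e j) ('D_(e i) f) (s *: h + z).
  transitivity ('D_h (fun x => \sum_i c i h * 'D_(e i) f x) (s *: h + z)).
    by rewrite -E.
  apply: derive_val; apply: is_derive_lincomb => i.
  rewrite -(derive_frame _ fr); first exact/derivableP.
  exact/smooth_differentiable/smooth_derive.
have hs : `|s *: h| <= `|h| by rewrite normrZ ger0_norm// ler_piMl.
apply: le_trans (ler_norm_sum _ _ _) _.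
apply: le_trans (_ : \sum_(i : T) `|h| * (#|T|%:R * (`|h| * M)) <= _).
  apply: ler_sum => i _; rewrite normrM ler_pM//; first exact: frame_norm fr _ _.
  apply: le_trans (ler_norm_sum _ _ _) _.
  apply: le_trans (_ : \sum_(j : T) `|h| * M <= _).
    by apply: ler_sum => j _; rewrite normrM ler_pM//; [exact: frame_norm fr _ _|exact: fM].
  by rewrite sumr_const mulr_natl.
rewrite sumr_const -mulr_natl le_eqVlt; apply/orP; left; apply/eqP.
rewrite -[#|xpredT|]/(#|T|); ring.
Qed.

Context d (X : measurableType d) (mu : {measure set X -> \bar R}).

(** The quadratic Taylor remainder of the integrand is integrated as it stands: [g] dominates it, so
    the integral has a genuine differential, and no limit is exchanged with the integral. *)
Lemma derive_under_integral (T : finType) (e : T -> Z) c (F : X -> Z -> R) (z : Z)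
    (g : X -> R) :
  frame e c -> (forall x, smooth (F x)) ->
  (forall y, `|y| <= 1 -> mu.-integrable setT (EFin \o (fun x => F x (y + z)))) ->
  (forall i, mu.-integrable setT (EFin \o (fun x => 'D_(e i) (F x) z))) ->
  mu.-integrable setT (EFin \o g) ->
  (forall i j x y, `|y| <= 1 -> `|'D_(e j) ('D_(e i) (F x)) (y + z)| <= g x) ->
  differentiable (fun z => \int[mu]_x F x z) z /\
  forall v, 'D_v (fun z => \int[mu]_x F x z) z = \int[mu]_x 'D_v (F x) z.
Proof.
move=> fr sF iF iD ig Fg.
(* The candidate differential is assembled from the integrals of the partial derivatives, so its
   linearity and continuity are those of the coordinates [c i]. *)
pose l i := \int[mu]_x 'D_(e i) (F x) z.
pose L v := \sum_i c i v * l i.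
have LE v : mu.-integrable setT (EFin \o (fun x => 'D_v (F x) z)) /\
    L v = \int[mu]_x 'D_v (F x) z.
  have E : (fun x => 'D_v (F x) z) = (fun x => \sum_i c i v * 'D_(e i) (F x) z).
    by apply/funext => x; rewrite (derive_frame _ fr)//; exact: smooth_differentiable.
  rewrite E /L; elim: (index_enum T) => [|i r [ih1 ih2]].
    rewrite (_ : (fun x => _) = cst 0); last by apply/funext => x; rewrite big_nil.
    by split; [exact: integrable0|rewrite big_nil Rintegral_cst// mul0r].
  rewrite (_ : (fun x => \sum_(j <- i :: r) c j v * 'D_(e j) (F x) z) =
     (fun x => c i v * 'D_(e i) (F x) z + \sum_(j <- r) c j v * 'D_(e j) (F x) z)); last first.
    by apply/funext => x; rewrite big_cons.
  have i1 : mu.-integrable setT (EFin \o (fun x => c i v * 'D_(e i) (F x) z)).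
    exact: (integrableZl measurableT (c i v) (iD i)).
  split; first exact: (integrableD measurableT i1 ih1).
  by rewrite big_cons RintegralD// RintegralZl// ih2.
have lL : linear L.
  move=> a u v; rewrite /L scaler_sumr -big_split; apply: eq_bigr => i _ /=.
  by rewrite (frame_lin fr) mulrDl -mulrA.
pose LL : {linear Z -> R} := HB.pack L (GRing.isLinear.Build _ _ _ _ L lL).
have cL : continuous L.
  rewrite /L; apply: (@continuous_sum _ _ (fun i v => c i v * l i)) => i v.
  by apply: cvgMl; exact: (frame_cont fr).
have [//|] := @differentiable_quadratic _ _ (fun z => \int[mu]_x F x z) z LL
   (#|T|%:R ^+ 2 * \int[mu]_x g x) cL.
  move=> h h1.
  have iz : mu.-integrable setT (EFin \o (fun x => F x z)).
    by have := iF 0; rewrite normr0 => /(_ ler01); under eq_fun do rewrite add0r.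
  have ihz : mu.-integrable setT (EFin \o (fun x => F x (h + z))) by exact: iF.
  have ii0 : mu.-integrable setT (EFin \o (fun x => F x (h + z) - F x z)).
    exact: (integrableB measurableT ihz iz).
  have ii : mu.-integrable setT (EFin \o (fun x => F x (h + z) - F x z - 'D_h (F x) z)).
    exact: (integrableB measurableT ii0 (LE h).1).
  rewrite /= (LE h).2 -RintegralB// -RintegralB//; last exact: (LE h).1.
  rewrite mulrAC -RintegralZl//.
  apply: integrable_normr_le => //.
  - exact/measurable_EFinP/(measurable_int _ ii).
  - move=> x _; rewrite mulrAC; apply: taylor_frame fr (sF x) _ => i j y yh.
    by apply: Fg; apply: le_trans h1.
  - exact: (integrableZl measurableT _ ig).
by move=> dG DG; split=> // v; rewrite DG -(LE v).2.
Qed.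

End under_integral.

(** * Oscillatory integrals *)

Section oscillatory.
Context {R : realType}.
Variable d : nat.
Local Notation Rd := 'rV[R]_d.
Local Notation ST := (Rd * R)%type.
Local Notation V := (Rd * Rd * R)%type.

(* Amplitudes [a (x, xi, t)]: Schwartz in [x], of growth [wt xi ^+ m] in [xi]. *)
Definition amp I (m : nat) (a : I -> V -> R) :=
  forall M, BC (fun z : V => wt z.1.1 ^+ M / wt z.1.2 ^+ m) a.

(* Schwartz in the space variable only, uniformly in time. *)
Definition sch I (f : I -> ST -> R) := forall M, BC (fun z : ST => wt z.1 ^+ M) f.

(** A real phase with a shift [c]: sines and derivatives of cosines are cosines with [c] changed by
    multiples of [pi / 2]. One real family thus serves both parts of the exponential and is stable
    under differentiation. *)
Definition osc_int I (c : R) (a : I -> V -> R) (i : I) (x : Rd) (z : ST) : R :=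
  a i (x, z.1, z.2) * cos (dotv x z.1 + c).

Definition osc I (c : R) (a : I -> V -> R) (i : I) (z : ST) : R :=
  \int[leb R d]_x osc_int c a i x z.

Lemma dotvC m n (u v : 'M[R]_(m, n)) : dotv u v = dotv v u.
Proof. by apply: eq_bigr => i _; apply: eq_bigr => j _; rewrite mulrC. Qed.

Lemma dotvDl m n (u v w : 'M[R]_(m, n)) a :
  dotv (a *: u + v) w = a * dotv u w + dotv v w.
Proof.
rewrite /dotv mulr_sumr -big_split; apply: eq_bigr => i _ /=.
by rewrite mulr_sumr -big_split; apply: eq_bigr => j _ /=; rewrite !mxE mulrDl mulrA.
Qed.

Lemma dotvDr m n (u v w : 'M[R]_(m, n)) a :
  dotv w (a *: u + v) = a * dotv w u + dotv w v.
Proof. by rewrite !(dotvC w) dotvDl. Qed.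

Lemma dotv_continuous n (u : 'rV[R]_n) : continuous (dotv u).
Proof.
rewrite (_ : dotv u = fun v => \sum_j u 0 j * v 0 j); last first.
  by apply/funext => v; rewrite /dotv big_ord1.
apply: continuous_sum => j v; apply: (continuousM (s := fun=> u 0 j)).
  exact: cst_continuous.
exact: coord_continuous.
Qed.

Lemma dotv_continuousl n (u : 'rV[R]_n) : continuous (fun v => dotv v u).
Proof.
by rewrite (_ : (fun v => _) = dotv u)//; [exact: dotv_continuous|apply/funext => v; exact: dotvC].
Qed.

Lemma dotv_basis n (u : 'rV[R]_n) j : dotv u (basis_vec R j) = u 0 j.
Proof.
rewrite /dotv big_ord1 (bigD1 j)//= big1 ?addr0 ?mxE ?eqxx ?mulr1//.
by move=> i ij; rewrite mxE eqxx /= (negbTE ij) mulr0.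
Qed.

Lemma wgt_ge0 M m (z : V) : 0 <= wt z.1.1 ^+ M / wt z.1.2 ^+ m.
Proof. by rewrite divr_ge0// exprn_ge0// ltW// wt_gt0. Qed.

Lemma is_derive_cosl (W : normedModType R) (l : W -> R) (dl : R) (c : R) z h :
  (forall s : R, l (s *: h + z) = s * dl + l z) ->
  is_derive z h (fun z => cos (l z + c)) (dl * cos (l z + c + pi / 2)).
Proof.
move=> hl.
have D1 : is_derive (l z) dl (fun s => cos (s + c)) (dl * cos (l z + c + pi / 2)).
  rewrite cosDpihalf.
  have Dc : is_derive (l z) (1 : R) (fun s => cos (s + c)) (- sin (l z + c)).
    apply: (@is_derive_affine _ R R _ (fun s : R => s + c) (@cos R) (l z) 1 1).
    by move=> s; rewrite addrA.
  have dfc : differentiable (fun s => cos (s + c)) (l z).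
    by apply/derivable1_diffP; have [] := Dc.
  split; first exact: diff_derivable.
  rewrite deriveE// -[dl in LHS]mulr1 linearZ -deriveE// (@derive_val _ _ _ _ _ _ _ Dc).
  by [].
exact: (@is_derive_affine _ W R _ l (fun s => cos (s + c)) z h dl).
Qed.

Lemma smooth_coslin (W : normedModType R) (l : {linear W -> R}) (c : R) :
  continuous l -> smooth (fun z => cos (l z + c)).
Proof.
move=> cl.
apply: (@BC_smooth _ _ unit (cst 0) (fun=> fun z => cos (l z + c)) tt).
apply: (@BC_coind _ W unit (cst 0) (fun f => exists (k c : R),
    f = fun=> fun z => k * cos (l z + c))).
- move=> _ [k [c' ->]]; split=> [_ x|]; last by exists 0 => i x; rewrite mul0r.
  apply: differentiableM => //.
  apply: (@differentiable_comp _ _ _ _ (fun z => l z + c') (@cos R)).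
    by apply: differentiableD => //; exact: linear_differentiable.
  by apply/derivable1_diffP; exact: ex_derive.
- move=> _ v [k [c' ->]]; exists (k * l v), (c' + pi / 2).
  apply/funext => _; apply/funext => x.
  have D : is_derive x v (fun z => cos (l z + c')) (l v * cos (l x + c' + pi / 2)).
    by apply: is_derive_cosl => s; rewrite linearP.
  rewrite (deriveZ k (@ex_derive _ _ _ _ _ _ _ D)) (@derive_val _ _ _ _ _ _ _ D).
  by rewrite addrA -mulrA.
- by exists 1, c; apply/funext => _; apply/funext => x; rewrite mul1r.
Qed.

Lemma amp_derive I m (a : I -> V -> R) v : amp m a -> amp m (fun i => 'D_v (a i)).
Proof. by move=> ha M; apply: BC_derive. Qed.

Lemma amp_smooth I m (a : I -> V -> R) i : amp m a -> smooth (a i).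
Proof. by move=> ha; exact: BC_smooth (ha 0%N). Qed.

Let coordx (h : Rd) (z : V) : R := dotv z.1.1 h.

(** A factor linear in [x] costs one power of [wt x]. Amplitudes satisfy their bound for all [M],
    and the bound for [M.+1] pays for it. *)
Lemma ampX I m (a : I -> V -> R) h : amp m a -> amp m (fun i z => dotv z.1.1 h * a i z).
Proof.
move=> ha M.
have lX : linear (coordx h).
  by move=> s u v; rewrite /coordx /= dotvDl.
pose L : {linear V -> R} := HB.pack (coordx h) (GRing.isLinear.Build _ _ _ _ _ lX).
have cX : continuous (coordx h).
  rewrite (_ : coordx h = (fun z => dotv h z.1.1)); last first.
    by apply/funext => z; rewrite /coordx dotvC.
  move=> z; apply: (continuous_comp (f := fun z : V => z.1.1)).
    by apply: (continuous_comp (f := fst)); exact: cvg_fst.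
  exact: dotv_continuous.
have bX : BC (fun z : V => (wt z.1.1)^-1) (fun _ : I => coordx h).
  apply: (@BC_scalar _ _ I _ L (Num.max 1 (\sum_j `|h 0 j|))) => //.
  - move=> z; rewrite le_max; apply/orP; right.
    rewrite /= /coordx /dotv big_ord1 mulrC ler_pdivrMr ?wt_gt0//.
    apply: le_trans (ler_norm_sum _ _ _) _; rewrite mulr_suml.
    by apply: ler_sum => j _; rewrite normrM mulrC ler_wpM2l// coord_le_wt.
  - move=> z; rewrite ltW ?wtV_gt0//= le_max invf_le1 ?wt_gt0// wt_ge1 //.
have := BCM _ _ bX (ha M.+1).
move=> /(_ (fun z => ltW (wtV_gt0 _)) (fun z => wgt_ge0 _ _ _)).
apply: (@BC_weight _ _ _ _ _ _ 1) => // z; rewrite mul1r exprS mulrA mulrA mulVf ?mul1r//.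
by rewrite gt_eqF// wt_gt0.
Qed.

End oscillatory.

Lemma continuous_pair (X Y Z : topologicalType) (f : X -> Y) (g : X -> Z) :
  continuous f -> continuous g -> continuous (fun x => (f x, g x)).
Proof. by move=> cf cg x; exact: (cvg_pair (cf x) (cg x)). Qed.

Section oscillatory_integral.
Context {R : realType}.
Variable d : nat.
Local Notation Rd := 'rV[R]_d.
Local Notation ST := (Rd * R)%type.
Local Notation V := (Rd * Rd * R)%type.

Lemma amp_bound I m (a : I -> V -> R) : amp m a ->
  exists2 C : R, 0 <= C & forall i x xi t, `|a i (x, xi, t)| <= C * wt xi ^+ m * (wt x)^-1.
Proof.
move=> /(_ 1%N)/BC_BC0[_ [C hC]]; exists `|C| => // i x xi t.
have := hC i (x, xi, t); rewrite /= expr1.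
rewrite mulrAC ler_pdivrMr ?exprn_gt0 ?wt_gt0// => /le_trans h.
rewrite ler_pdivlMr ?wt_gt0// mulrC; apply: h.
by rewrite ler_wpM2r ?ler_norm// exprn_ge0// ltW// wt_gt0.
Qed.

Lemma osc_int_bound I c m (a : I -> V -> R) : amp m a ->
  exists2 C : R, 0 <= C & forall i x z,
    `|osc_int c a i x z| <= C * wt z.1 ^+ m * (wt x)^-1.
Proof.
move=> /amp_bound[C C0 hC]; exists C => // i x [xi t].
rewrite /osc_int normrM; apply: le_trans (hC i x xi t).
by rewrite ler_piMr// cos_max.
Qed.

Let dotl (x : Rd) (z : ST) : R := dotv x z.1.

Let dotl_lin x : linear (dotl x).
Proof. by move=> s u v; rewrite /dotl /= dotvDr. Qed.

Let dotl_cont x : continuous (dotl x).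
Proof.
move=> z; apply: (continuous_comp (f := fst)); first exact: cvg_fst.
exact: dotv_continuous.
Qed.

Let emb (x : Rd) (z : ST) : V := (x, z.1, z.2).

Let emb_differentiable x z : differentiable (emb x) z.
Proof.
rewrite (_ : emb x = fun z => ((x, 0, 0) : V) + ((0, z.1, z.2) : V)); last first.
  by apply/funext => u; congr (_, _, _); rewrite /= ?addr0 ?add0r.
apply: differentiableD => //.
have lF : linear (fun z : ST => ((0, z.1, z.2) : V)).
  by move=> s u v; congr (_, _, _); rewrite /= ?scaler0 ?addr0.
pose L : {linear ST -> V} := HB.pack (fun z : ST => ((0, z.1, z.2) : V)) (GRing.isLinear.Build _ _ _ _ _ lF).
apply: (@linear_differentiable _ _ _ L).
apply: continuous_pair; last by move=> u; exact: cvg_snd.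
by apply: continuous_pair => u; [exact: cst_continuous|exact: cvg_fst].
Qed.

Let emb_shift x h s z : emb x (s *: h + z) = s *: (0, h.1, h.2) + emb x z.
Proof. by congr (_, _, _); rewrite /= ?scaler0 ?add0r. Qed.

Lemma osc_int_smooth I c m (a : I -> V -> R) i x : amp m a -> smooth (osc_int c a i x).
Proof.
move=> ha.
have s1 : smooth (a i \o emb x).
  have b0 := smooth_BC (amp_smooth i ha).
  have := @BC_affine _ _ _ _ _ _ (emb x) (fun h => (0, h.1, h.2)) (fun s h z => emb_shift x h s z) (emb_differentiable x) b0.
  by move/(BC_smooth tt).
pose L : {linear ST -> R} := HB.pack (dotl x) (GRing.isLinear.Build _ _ _ _ _ (dotl_lin x)).
have s2 : smooth (fun z => cos (dotl x z + c)).
  exact: (@smooth_coslin _ _ L c (@dotl_cont x)).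
have := BCM _ _ (smooth_BC s1) (smooth_BC s2).
by move=> /(_ (fun=> lexx _) (fun=> lexx _))/(BC_smooth tt).
Qed.

(** The direction [h] concerns [(xi, t)]. It hits either the amplitude or the phase; in the second
    case it brings down [dotv x h.1] and advances the phase by a quarter period. *)
Lemma osc_int_derive I c m (a : I -> V -> R) i x z h : amp m a ->
  'D_h (osc_int c a i x) z =
  osc_int c (fun i => 'D_(0, h.1, h.2) (a i)) i x z +
  osc_int (c + pi / 2) (fun i z => dotv z.1.1 h.1 * a i z) i x z.
Proof.
move=> ha.
have D1 : is_derive z h (a i \o emb x) ('D_(0, h.1, h.2) (a i) (emb x z)).
  apply: (is_derive_affine (w := (0, h.1, h.2))).
    by move=> s; rewrite emb_shift.
  exact/derivableP/diff_derivable/smooth_differentiable/amp_smooth/ha.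
have D2 : is_derive z h (fun z => cos (dotl x z + c)) (dotv x h.1 * cos (dotl x z + c + pi / 2)).
  by apply: is_derive_cosl => s; rewrite dotl_lin.
have [Dm1 Dv1] := D1; have [Dm2 Dv2] := D2.
rewrite [LHS](_ : _ = 'D_h ((a i \o emb x) * (fun z => cos (dotl x z + c))) z)//.
rewrite deriveM// Dv1 Dv2 /osc_int /= /emb /dotl addrA /GRing.scale /=; ring.
Qed.

Lemma osc_int_continuousl I c m (a : I -> V -> R) i z : amp m a ->
  continuous (fun x => osc_int c a i x z).
Proof.
move=> ha x; apply: continuousM.
  apply: (continuous_comp (f := fun x : Rd => (x, z.1, z.2))).
    apply: continuous_pair; last exact: cst_continuous.
    by apply: continuous_pair => u; [exact: cvg_id|exact: cst_continuous].
  exact/smooth_continuous/amp_smooth/ha.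
apply: (continuous_comp (f := fun x => dotv x z.1 + c)); last exact: continuous_cos.
by apply: continuousD; [exact: dotv_continuousl|exact: cst_continuous].
Qed.

Lemma osc_int_measurable I c m (a : I -> V -> R) i z : amp m a ->
  measurable_fun setT (fun x => osc_int c a i x z).
Proof.
by move=> ha; apply: continuous_measurable_mx; exact: osc_int_continuousl ha.
Qed.

Lemma osc_integrable I c m (a : I -> V -> R) i z : amp m a ->
  (leb R d).-integrable setT (EFin \o (fun x => osc_int c a i x z)).
Proof.
move=> ha; have [C C0 hC] := osc_int_bound c ha.
apply: (integrable_le (g := fun x => C * wt z.1 ^+ m * (wt x)^-1)) => //.
  exact: osc_int_measurable ha.
exact: (integrableZl measurableT (C * wt z.1 ^+ m) (integrable_wtV d)).
Qed.

Lemma osc_bound I c m (a : I -> V -> R) : amp m a ->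
  exists2 C : R, 0 <= C & forall i z, `|osc c a i z| <= C * wt z.1 ^+ m.
Proof.
move=> ha; have [C C0 hC] := osc_int_bound c ha.
exists (C * \int[leb R d]_x (wt x)^-1).
  by rewrite mulr_ge0// Rintegral_ge0// => x _; rewrite ltW// wtV_gt0.
move=> i z; rewrite mulrAC -RintegralZl//; last exact: integrable_wtV.
apply: integrable_normr_le => //.
- exact: osc_int_measurable ha.
- exact: (integrableZl measurableT (C * wt z.1 ^+ m) (integrable_wtV d)).
Qed.

(** The integral of the derivative of [a * cos (x.xi + c)] with respect to [x_j] vanishes, and the
    cosine contributes [xi_j] times itself with phase advanced by [pi / 2]. *)
Lemma osc_ibp I c m (a : I -> V -> R) (j : 'I_d) i (z : ST) : amp m a ->
  z.1 0 j * osc (c + pi / 2) a i z =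
  - osc c (fun i => 'D_(basis_vec R j, 0, 0) (a i)) i z.
Proof.
move=> ha; set a' := fun i => _.
have ha' : amp m a' by exact: amp_derive.
apply/eqP; rewrite -subr_eq0 opprK /osc -RintegralZl//; last exact: osc_integrable ha.
rewrite -RintegralD//; last 2 first.
- exact: (integrableZl measurableT _ (osc_integrable _ _ _ ha)).
- exact: osc_integrable ha'.
have [C1 C10 hC1] := osc_int_bound c ha; have [C2 C20 hC2] := osc_int_bound (c + pi / 2) ha.
have [C3 C30 hC3] := osc_int_bound c ha'.
have wV (x : Rd) : 0 <= (wt x)^-1 by rewrite ltW// wtV_gt0.
have wm : 0 <= wt z.1 ^+ m by rewrite exprn_ge0// ltW// wt_gt0.
have cg : continuous (fun x : Rd => z.1 0 j * osc_int (c + pi / 2) a i x z + osc_int c a' i x z).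
  move=> x; have h1 := @osc_int_continuousl I (c + pi / 2) m a i z ha x.
  have h2 := @osc_int_continuousl I c m a' i z ha' x.
  have h3 : {for x, continuous (fun x : Rd => z.1 0 j * osc_int (c + pi / 2) a i x z)}.
    exact: continuousM (@cst_continuous _ _ _ _) h1.
  exact: (@continuousD _ _ _ (fun x : Rd => z.1 0 j * osc_int (c + pi / 2) a i x z) _ _ h3 h2).
rewrite /Rintegral [X in fine X](_ : _ = 0%E)//.
apply: (@leb_integral_derive0 _ _ (fun x => osc_int c a i x z) _ j
  ((C1 + `|z.1 0 j| * C2 + C3) * wt z.1 ^+ m)).
- move=> x; apply: is_derive_eq.
    apply: (is_deriveM (f := fun x => a i (x, z.1, z.2))
      (g := fun x => cos (dotv x z.1 + c))).
      apply: (@is_derive_affine _ _ _ _ (fun x : Rd => (x, z.1, z.2)) (a i) x (basis_vec R j)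
        (basis_vec R j, 0, 0)).
        by move=> s; congr (_, _, _); rewrite /= ?scaler0 ?add0r.
      exact/derivableP/diff_derivable/smooth_differentiable/amp_smooth/ha.
    apply: (@is_derive_cosl _ _ (fun x => dotv x z.1) (z.1 0 j)).
    by move=> s; rewrite dotvDl (dotvC _ z.1) dotv_basis.
  rewrite /osc_int addrC /a' addrA /GRing.scale /=; ring.
- exact: cg.
- move=> x; apply: le_trans (hC1 i x z) _.
  by rewrite ler_wpM2r// ler_wpM2r// -addrA lerDl addr_ge0// mulr_ge0.
- move=> x; apply: le_trans (ler_normD _ _) _; rewrite normrM.
  apply: le_trans (lerD (ler_wpM2l _ (hC2 i x z)) (hC3 i x z)) _ => //.
  rewrite 2!mulrA -!mulrDl ler_wpM2r// ler_wpM2r// lerD2r lerDr//.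
Qed.

End oscillatory_integral.

Section oscillatory_sch.
Context {R : realType}.
Variable d : nat.
Local Notation Rd := 'rV[R]_d.
Local Notation ST := (Rd * R)%type.
Local Notation V := (Rd * Rd * R)%type.

(** Two integrations by parts in direction [j] trade [xi_j ^ 2] for two derivatives of the
    amplitude, which is still of order [m]. A coordinate may recur in [s], so any power is
    reached. *)
Lemma osc_decay I m (s : seq 'I_d) c (a : I -> V -> R) : amp m a ->
  exists2 C : R, 0 <= C & forall i (z : ST),
    \prod_(j <- s) (1 + z.1 0 j ^+ 2) * `|osc c a i z| <= C * wt z.1 ^+ m.
Proof.
elim: s c a => [|j s ih] c a ha.
  have [C C0 hC] := osc_bound c ha; exists C => // i z.
  by rewrite big_nil mul1r.
pose a1 i := 'D_(basis_vec R j, 0, 0) (a i).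
pose a2 i := 'D_(basis_vec R j, 0, 0) (a1 i).
have ha1 : amp m a1 by exact: amp_derive.
have ha2 : amp m a2 by exact: amp_derive.
have [C1 C10 hC1] := ih c a ha.
have [C2 C20 hC2] := ih (c - pi / 2 - pi / 2) a2 ha2.
exists (C1 + C2) => [|i z]; first exact: addr_ge0.
(* Each integration by parts sets the phase back by [pi / 2] and changes the sign; after two of them
   the signs cancel. *)
have E : z.1 0 j ^+ 2 * osc c a i z = osc (c - pi / 2 - pi / 2) a2 i z.
  have h1 := osc_ibp (c - pi / 2) j i z ha.
  have h2 := osc_ibp (c - pi / 2 - pi / 2) j i z ha1.
  rewrite !subrK in h1 h2.
  by rewrite expr2 -mulrA h1 mulrN h2 opprK.
rewrite big_cons mulrAC [_ * \prod_(_ <- _) _]mulrC.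
apply: le_trans (_ : \prod_(j <- s) (1 + z.1 0 j ^+ 2) *
   (`|osc c a i z| + `|osc (c - pi / 2 - pi / 2) a2 i z|) <= _).
  rewrite ler_wpM2l//.
    by rewrite prodr_ge0// => k _; rewrite addr_ge0// sqr_ge0.
  by rewrite mulrDl mul1r -E normrM (ger0_norm (sqr_ge0 _)).
rewrite mulrDr [leRHS]mulrDl; apply: lerD; [exact: hC1|exact: hC2].
Qed.

(** Listing every coordinate [M + m] times gains [wt xi ^ (M + m)], of which [m] powers absorb the
    growth of the amplitude. *)
Lemma osc_weight I m c (a : I -> V -> R) M : amp m a ->
  exists C : R, forall i z, wt z.1 ^+ M * `|osc c a i z| <= C.
Proof.
move=> ha.
have [s hs] : exists s : seq 'I_d, forall x : Rd, \prod_(j <- s) (1 + x 0 j ^+ 2) = wt x ^+ (M + m).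
  elim: (M + m)%N => [|n [s hs]]; first by exists [::] => x; rewrite big_nil.
  by exists (index_enum 'I_d ++ s) => x; rewrite big_cat /= hs exprS.
have [C C0 hC] := osc_decay s c ha; exists C => i z.
have := hC i z; rewrite hs exprD mulrAC ler_pM2r//.
by rewrite exprn_gt0// wt_gt0.
Qed.

(** Differentiation under the integral asks for a bound on a whole unit ball of parameters, hence
    for a bound on the weight there that depends on the centre only. *)
Lemma wt_near (x y : Rd) : `|y| <= 1 -> wt (y + x) <= \prod_(j < d) (1 + (1 + `|x|) ^+ 2).
Proof.
move=> y1; rewrite /wt; apply: ler_prod => j _.
rewrite addr_ge0 ?sqr_ge0//= lerD2l -(real_normK (num_real _)).
rewrite ler_sqr ?nnegrE ?addr_ge0// mxE (le_trans (ler_normD _ _))// lerD//.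
  by rewrite (le_trans (coord_le_norm _ _)).
exact: coord_le_norm.
Qed.

Lemma osc_int_derive2_bound I c m (a : I -> V -> R) (h k : ST) : amp m a ->
  exists2 C : R, 0 <= C & forall i x z,
    `|'D_k ('D_h (osc_int c a i x)) z| <= C * wt z.1 ^+ m * (wt x)^-1.
Proof.
move=> ha.
pose a1 i := 'D_(0, h.1, h.2) (a i); pose a2 i (z : V) := dotv z.1.1 h.1 * a i z.
have ha1 : amp m a1 by exact: amp_derive.
have ha2 : amp m a2 by exact: ampX.
have [C1 p1 b1] := osc_int_bound c (amp_derive (0, k.1, k.2) ha1).
have [C2 p2 b2] := osc_int_bound (c + pi / 2) (ampX k.1 ha1).
have [C3 p3 b3] := osc_int_bound (c + pi / 2) (amp_derive (0, k.1, k.2) ha2).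
have [C4 p4 b4] := osc_int_bound (c + pi / 2 + pi / 2) (ampX k.1 ha2).
exists (C1 + C2 + (C3 + C4)) => [|i x z]; first by rewrite !addr_ge0.
have -> : 'D_h (osc_int c a i x) = osc_int c a1 i x + osc_int (c + pi / 2) a2 i x.
  by apply/funext => y; rewrite (osc_int_derive _ _ _ _ _ ha).
rewrite deriveD; last 2 first.
- exact/diff_derivable/smooth_differentiable/osc_int_smooth/ha1.
- exact/diff_derivable/smooth_differentiable/osc_int_smooth/ha2.
rewrite (osc_int_derive _ _ _ _ _ ha1) (osc_int_derive _ _ _ _ _ ha2).
have -> : (C1 + C2 + (C3 + C4)) * wt z.1 ^+ m * (wt x)^-1 =
  C1 * wt z.1 ^+ m * (wt x)^-1 + C2 * wt z.1 ^+ m * (wt x)^-1 +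
  (C3 * wt z.1 ^+ m * (wt x)^-1 + C4 * wt z.1 ^+ m * (wt x)^-1) by ring.
apply: (le_trans (ler_normD _ _)); apply: lerD;
  apply: (le_trans (ler_normD _ _)); apply: lerD.
- exact: b1.
- exact: b2.
- exact: b3.
- exact: b4.
Qed.

Lemma osc_derive I c m (a : I -> V -> R) i z : amp m a ->
  differentiable (osc c a i) z /\ forall h,
  'D_h (osc c a i) z = osc c (fun i => 'D_(0, h.1, h.2) (a i)) i z +
     osc (c + pi / 2) (fun i z => dotv z.1.1 h.1 * a i z) i z.
Proof.
move=> ha; have fr := frame_prod (frame_rV d) (@frame_R R).
set e := (fun _ => _) in fr.
have [K hK] : exists K : R, forall p q i x y, `|y| <= 1 ->
    `|'D_(e q) ('D_(e p) (osc_int c a i x)) (y + z)| <= K * (wt x)^-1.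
  have /choice[Cf hCf] : forall pq, exists C : R, 0 <= C /\ forall i x z,
      `|'D_(e pq.2) ('D_(e pq.1) (osc_int c a i x)) z| <= C * wt z.1 ^+ m * (wt x)^-1.
    by move=> pq; have [C C0 hC] := osc_int_derive2_bound c (e pq.1) (e pq.2) ha; exists C.
  pose W := (\prod_(j < d) (1 + (1 + `|z.1|) ^+ 2)) ^+ m : R.
  exists ((\sum_pq Cf pq) * W) => p q i' x y y1.
  apply: le_trans ((hCf (p, q)).2 i' x (y + z)) _ => /=.
  rewrite ler_wpM2r ?(ltW (wtV_gt0 _))// ler_pM//; first exact: (hCf _).1.
  - by rewrite exprn_ge0// ltW// wt_gt0.
  - rewrite (bigD1 (p, q))//= lerDl sumr_ge0// => pq _; exact: (hCf pq).1.
  - rewrite lerXn2r ?nnegrE ?(ltW (wt_gt0 _))//.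
      by rewrite prodr_ge0// => j _; rewrite addr_ge0// sqr_ge0.
    by apply: wt_near; apply: le_trans y1; rewrite [`|y|]/(Num.max _ _) le_max lexx.
have [] := @derive_under_integral _ _ _ _ (leb R d) _ e _ (osc_int c a i) z
  (fun x => K * (wt x)^-1) fr.
- by move=> x; exact: osc_int_smooth ha.
- by move=> y _; exact: osc_integrable ha.
- move=> p; rewrite (_ : (fun x => _) = (fun x =>
    osc_int c (fun i => 'D_(0, (e p).1, (e p).2) (a i)) i x z +
    osc_int (c + pi / 2) (fun i z => dotv z.1.1 (e p).1 * a i z) i x z)).
    have i1 := osc_integrable c i z (amp_derive (0, (e p).1, (e p).2) ha).
    have i2 := osc_integrable (c + pi / 2) i z (ampX (e p).1 ha).
    exact: (integrableD measurableT i1 i2).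
  by apply/funext => x; rewrite (osc_int_derive _ _ _ _ _ ha).
- exact: (integrableZl measurableT K (integrable_wtV d)).
- by move=> p q x y y1; exact: hK.
move=> dosc Dosc; split=> // h; rewrite Dosc.
under eq_Rintegral do rewrite (osc_int_derive _ _ _ _ _ ha).
rewrite RintegralD//.
  exact/osc_integrable/amp_derive/ha.
exact/osc_integrable/ampX/ha.
Qed.

(** The derivative of an oscillatory integral is a sum of two such integrals, so the stable class
    for the coinduction has to be closed under sums. *)
Inductive osc_span I (m : nat) : (I -> ST -> R) -> Prop :=
| Osc_base c (a : I -> V -> R) : amp m a -> osc_span m (osc c a)
| Osc_add f g : osc_span m f -> osc_span m g -> osc_span m (fun i z => f i z + g i z).

(** Decay in [xi] comes from integrating by parts in [x], and derivatives in [xi] are paid by the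
    decay in [x]. All constants are those of the family [a], hence uniform in the index and in
    time. *)
Theorem osc_sch I c m (a : I -> V -> R) : amp m a -> sch (osc c a).
Proof.
move=> ha M; apply: (@BC_coind _ _ I _ (@osc_span I m)); last exact: Osc_base.
- move=> f; elim => [c' a' ha'|f' g' _ [df [C hC]] _ [dg [D hD]]].
    by split=> [i x|]; [exact: (osc_derive _ _ _ ha').1|exact: osc_weight ha'].
  split=> [i x|]; first exact: differentiableD.
  exists (C + D) => i x; apply: le_trans (lerD (hC i x) (hD i x)).
  by rewrite -mulrDr ler_wpM2l ?ler_normD// exprn_ge0// ltW// wt_gt0.
- move=> f v; elim => [c' a' ha'|f' g' sf IHf sg IHg].
    rewrite (_ : (fun i => _) = (fun i z => osc c' (fun i => 'D_(0, v.1, v.2) (a' i)) i z +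
       osc (c' + pi / 2) (fun i z => dotv z.1.1 v.1 * a' i z) i z)).
      by apply: Osc_add; apply: Osc_base; [exact: amp_derive|exact: ampX].
    by apply/funext => i; apply/funext => z; exact: (osc_derive _ _ _ ha').2.
  rewrite (_ : (fun i => _) = (fun i z => 'D_v (f' i) z + 'D_v (g' i) z)).
    exact: Osc_add.
  have diff (g : I -> ST -> R) i x : osc_span m g -> derivable (g i) x v.
    move=> sg'; apply: diff_derivable.
    elim: sg' => [c' a' ha'|f1 g1 _ df _ dg]; first exact: (osc_derive _ _ _ ha').1.
    exact: differentiableD.
  by apply/funext => i; apply/funext => z; rewrite -deriveD//; apply: diff.
Qed.

End oscillatory_sch.

(** * Transposed pseudodifferential operators on test functions *)

Section schwarz.
Context {R : realType}.
Implicit Types V : normedModType R.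

Lemma line_derive V (g : V -> R) (u z : V) (s : R) : smooth g ->
  is_derive s (1 : R) (fun s : R => g (s *: u + z)) ('D_u g (s *: u + z)).
Proof.
move=> sg; apply: (@is_derive_affine _ R V _ (fun s : R => s *: u + z) g s 1 u).
  by move=> a; rewrite scalerDl [a *: 1]mulr1 addrA.
exact/derivableP/diff_derivable/smooth_differentiable.
Qed.

(** The mean value theorem in direction [u] for the difference in direction [v], then in direction
    [v], leads to the mixed derivative at one point of the parallelogram. *)
Lemma double_difference V (f : V -> R) (u v z : V) (h : R) : smooth f -> 0 < h ->
  exists s t, [/\ 0 <= s <= h, 0 <= t <= h &
   f (h *: u + (h *: v + z)) - f (h *: u + z) - (f (h *: v + z) - f z) =
   'D_v ('D_u f) (t *: v + (s *: u + z)) * h ^+ 2].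
Proof.
move=> sf h0.
have cont (k k' : R -> R) : (forall s, is_derive s (1 : R) k (k' s)) -> continuous k.
  move=> du s; apply/differentiable_continuous/derivable1_diffP.
  by have [] := du s.
have dg (s : R) : is_derive s (1 : R)
    ((fun s : R => f (s *: u + (h *: v + z))) - (fun s : R => f (s *: u + z)))
    ('D_u f (s *: u + (h *: v + z)) - 'D_u f (s *: u + z)).
  by apply: is_deriveB; exact: line_derive.
have [s] : exists2 s, s \in `[0, h]%R & _ := MVT_segment (ltW h0) (fun s _ => dg s)
  (continuous_subspaceT (cont _ _ dg)).
rewrite in_itv /= => sh E1.
have sfu : smooth ('D_u f) by exact: smooth_derive.
have dk (t : R) := line_derive v (s *: u + z) t sfu.
have [t] : exists2 t, t \in `[0, h]%R & _ := MVT_segment (ltW h0) (fun s _ => dk s)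
  (continuous_subspaceT (cont _ _ dk)).
rewrite in_itv /= => th E2.
exists s, t; split=> //.
move: E1 E2; rewrite !fctE !scale0r !add0r !subr0 => ->.
by rewrite addrCA => ->; rewrite expr2 mulrA.
Qed.

(** Needed because symbol estimates list the [x]-directions outermost, whereas [BC] allows any
    order. The double difference is symmetric in [u] and [v], so the two mixed derivatives agree at
    two points close to [z], and continuity carries this to [z]. *)
Lemma derive_comm V (f : V -> R) (u v : V) : smooth f -> 'D_u ('D_v f) = 'D_v ('D_u f).
Proof.
move=> sf; apply/funext => z; apply/eqP; rewrite -subr_eq0 -normr_le0.
apply/ler_addgt0Pl => e e0; rewrite addr0.
have cuv : {for z, continuous ('D_u ('D_v f))}.
  exact/smooth_continuous/smooth_derive/smooth_derive.
have cvu : {for z, continuous ('D_v ('D_u f))}.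
  exact/smooth_continuous/smooth_derive/smooth_derive.
have e2 : 0 < e / 2 by rewrite divr_gt0.
have /cvgrPdist_le/(_ _ e2)/nbhs_ballP[d1 /= d10 h1] := cuv.
have /cvgrPdist_le/(_ _ e2)/nbhs_ballP[d2 /= d20 h2] := cvu.
(* Small enough for the parallelogram with sides [h u] and [h v] to lie in both balls of continuity;
   the added 1 covers [u = v = 0]. *)
pose h := Num.min d1 d2 / 2 / (`|u| + `|v| + 1).
have p0 : 0 < `|u| + `|v| + 1 by rewrite ltr_wpDl// addr_ge0.
have m0 : 0 < Num.min d1 d2 by rewrite lt_min d10 d20.
have h0 : 0 < h by rewrite !divr_gt0.
have near (a b : V) (s t : R) : `|a| + `|b| <= `|u| + `|v| -> 0 <= s <= h -> 0 <= t <= h ->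
   ball z (Num.min d1 d2) (t *: b + (s *: a + z)).
  move=> ab /andP[s0 sh] /andP[t0 th].
  rewrite -ball_normE /ball_ /= addrA opprD addrCA subrr addr0 normrN.
  apply: le_lt_trans (ler_normD _ _) _; rewrite !normrZ !ger0_norm//.
  apply: le_lt_trans (_ : h * (`|u| + `|v|) < _).
    rewrite (le_trans _ (ler_wpM2l (ltW h0) ab))// mulrDr addrC lerD// ler_wpM2r//.
  rewrite /h mulrAC ltr_pdivrMr//.
  have q : 0 <= `|u| + `|v| by rewrite addr_ge0.
  nra.
have [s [t [sh th E1]]] := double_difference u v z sf h0.
have [s' [t' [sh' th' E2]]] := double_difference v u z sf h0.
have E : 'D_v ('D_u f) (t *: v + (s *: u + z)) = 'D_u ('D_v f) (t' *: u + (s' *: v + z)).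
  apply: (@mulIf _ (h ^+ 2)); first by rewrite gt_eqF// exprn_gt0.
  have A : h *: u + (h *: v + z) = h *: v + (h *: u + z) by rewrite addrCA.
  apply: (etrans (esym E1)); apply: etrans E2; rewrite A.
  have alg (w1 w2 w3 w4 : R) : w1 - w2 - (w3 - w4) = w1 - w3 - (w2 - w4) by ring.
  exact: alg.
have a1 := h1 (t' *: u + (s' *: v + z)).
have a2 := h2 (t *: v + (s *: u + z)).
have {}a1 : `|'D_u ('D_v f) z - 'D_u ('D_v f) (t' *: u + (s' *: v + z))| <= e / 2.
  have vu : `|v| + `|u| <= `|u| + `|v| by rewrite addrC.
  by apply: a1; apply: (le_ball _ (near v u s' t' vu sh' th')); rewrite ge_min lexx.
have {}a2 : `|'D_v ('D_u f) z - 'D_v ('D_u f) (t *: v + (s *: u + z))| <= e / 2.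
  by apply: a2; apply: (le_ball _ (near u v s t (lexx _) sh th)); rewrite ge_min lexx orbT.
rewrite E distrC in a2; rewrite (splitr e).
exact: le_trans (ler_distD _ _ _) (lerD a1 a2).
Qed.

Lemma derive_iter_comm V (f : V -> R) (v : V) vs : smooth f ->
  'D_v (iter_derive vs f) = iter_derive vs ('D_v f).
Proof.
move=> sf; elim: vs => [//|u vs ih] /=; rewrite derive_comm ?ih//.
by move=> us x; rewrite -iter_derive_cat; exact: sf.
Qed.

End schwarz.

(** * Symbol estimates as weighted bounds *)

Section symbols.
Context {R : realType}.
Variable d : nat.
Local Notation Rd := 'rV[R]_d.

Lemma ler_Re_cmod (z : R[i]) : `|complex.Re z| <= cmod z.
Proof. by rewrite /cmod -sqrtr_sqr ler_sqrt ?lerDl ?sqr_ge0// addr_ge0 ?sqr_ge0. Qed.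

Lemma ler_Im_cmod (z : R[i]) : `|complex.Im z| <= cmod z.
Proof. by rewrite /cmod -sqrtr_sqr ler_sqrt ?lerDr ?sqr_ge0// addr_ge0 ?sqr_ge0. Qed.

Let dirs (i : 'I_d + 'I_d) : (Rd * Rd)%type :=
  match i with inl j => (basis_vec R j, 0) | inr j => (0, basis_vec R j) end.

Let iter_dirs (f : Rd * Rd -> R) bs : smooth f -> exists b a : seq 'I_d,
  iter_derive (map dirs bs) f = iter_derive (symbol_dirs R b a) f.
Proof.
move=> sf; elim: bs => [|[j|j] bs [b [a E]]] /=; first by exists [::], [::].
  by exists (j :: b), a; rewrite /= E.
exists b, (j :: a); rewrite E /symbol_dirs !iter_derive_cat /=.
by rewrite derive_iter_comm// => us x; rewrite -iter_derive_cat; exact: sf.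
Qed.

Lemma symbol_BC k l (r : R) (P : symbol R d k l) i j (q : Rd * Rd -> R) (m : nat) :
  r <= m%:R *+ 2 -> S10 r P ->
  q = (fun z => complex.Re (P z.1 z.2 i j)) \/ q = (fun z => complex.Im (P z.1 z.2 i j)) ->
  BC (fun z : Rd * Rd => (wt z.2 ^+ m)^-1) (fun _ : unit => q).
Proof.
move=> rm /(_ i j)[[s1 s2] hP] hq.
have sq : smooth q by case: hq => ->.
have fr := frame_prod (@frame_rV R d) (@frame_rV R d).
have w0 (z : Rd * Rd) : 0 < wt z.2 ^+ m by rewrite exprn_gt0// wt_gt0.
apply: (BC_frame fr).
- by move=> z; rewrite invr_ge0 ltW.
- by move=> _; exact: sq.
move=> bs.
have [b [a E]] := iter_dirs bs sq.
have [c hc] := hP b a; exists `|c| => _ [x xi].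
rewrite [X in `|X|](_ : _ = iter_derive (symbol_dirs R b a) q (x, xi)); last by rewrite -E.
rewrite mulrC ler_pdivrMr//=.
have hq' : `|iter_derive (symbol_dirs R b a) q (x, xi)| <=
    cmod (citer_derive (symbol_dirs R b a) (fun z : Rd * Rd => P z.1 z.2 i j) (x, xi)).
  case: hq => ->.
    exact: (ler_Re_cmod (citer_derive _ (fun z : Rd * Rd => P z.1 z.2 i j) _)).
  exact: (ler_Im_cmod (citer_derive _ (fun z : Rd * Rd => P z.1 z.2 i j) _)).
apply: le_trans hq' _; apply: le_trans (hc x xi) _.
have d0 : 0 <= dotv xi xi.
  by rewrite /dotv sumr_ge0// => i' _; rewrite sumr_ge0// => j' _; rewrite -expr2 sqr_ge0.
have h1 : 1 <= 1 + dotv xi xi by rewrite lerDl.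
apply: le_trans (_ : `|c| * (1 + dotv xi xi) `^ ((r - (size a)%:R) / 2) <= _).
  by rewrite ler_wpM2r ?powR_ge0// ler_norm.
(* Derivatives in [xi] only lower the exponent. With [r / 2 <= m] and $1+|\xi|^2$ at most [wt xi],
   the bound becomes [wt xi ^ m]. *)
rewrite ler_wpM2l//; apply: le_trans (_ : (1 + dotv xi xi) `^ m%:R <= _).
  apply: ler_powR => //.
  by rewrite ler_pdivrMr// mulr_natr (le_trans _ rm)// gerBl.
rewrite powR_mulrn; last exact: le_trans h1.
apply: lerXn2r; rewrite ?nnegrE ?dotv_le_wt//; first exact: le_trans h1.
  exact/ltW/wt_gt0.
exact: (w0 (x, xi)).
Qed.

End symbols.

(** * Schwartz families and the transposed operator *)

Section sch_calculus.
Context {R : realType}.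
Variable d : nat.
Local Notation Rd := 'rV[R]_d.
Local Notation ST := (Rd * R)%type.
Local Notation V := (Rd * Rd * R)%type.

Lemma wtX_ge0 n (x : Rd) : 0 <= wt x ^+ n.
Proof. by rewrite exprn_ge0// ltW// wt_gt0. Qed.

Lemma schD I (f g : I -> ST -> R) : sch f -> sch g -> sch (fun i z => f i z + g i z).
Proof. by move=> hf hg M; apply: BCD => // x; exact: wtX_ge0. Qed.

(** Growth of order [n] in the multiplier is offset by the bound of order [n + M] on [f]. *)
Lemma schM I (f g : I -> ST -> R) (n : nat) :
  BC (fun z : ST => (wt z.1 ^+ n)^-1) g -> sch f -> sch (fun i z => g i z * f i z).
Proof.
move=> hg hf M.
have w0 (z : ST) : 0 < wt z.1 ^+ n by rewrite exprn_gt0// wt_gt0.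
have := BCM _ _ hg (hf (n + M)%N).
move=> /(_ (fun z => _) (fun z => wtX_ge0 _ _)) h.
apply: (@BC_weight _ _ _ _ _ _ 1 _ _ (h _)) => // z; last by rewrite invr_ge0 ltW.
by rewrite mul1r exprD mulrA mulVf ?mul1r// gt_eqF.
Qed.

Lemma schZ I (c : R) (f : I -> ST -> R) : sch f -> sch (fun i z => c * f i z).
Proof.
move=> hf M; apply: (@BCZ _ _ _ _ (fun=> c) f `|c|) => // x; exact: wtX_ge0.
Qed.

Lemma sch_sum I (T : Type) (r : seq T) (f : T -> I -> ST -> R) :
  (forall t, sch (f t)) -> sch (fun i z => \sum_(t <- r) f t i z).
Proof. by move=> hf M; apply: BC_sum => [x|t]; [exact: wtX_ge0|exact: hf]. Qed.

Lemma sch_ext I (f g : I -> ST -> R) : (forall i z, f i z = g i z) -> sch f -> sch g.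
Proof. by move=> fg hf M; apply: BC_ext (hf M). Qed.

Lemma linear_diff (U W : normedModType R) (L : U -> W) x :
  linear L -> continuous L -> differentiable L x.
Proof.
move=> lL cL; pose LL : {linear U -> W} := HB.pack L (GRing.isLinear.Build _ _ _ _ _ lL).
exact: (@linear_differentiable _ _ _ LL).
Qed.

Lemma BC_linear (U W : normedModType R) I (al : W -> R) (f : I -> W -> R) (L : U -> W) :
  linear L -> continuous L -> BC al f -> BC (al \o L) (fun i => f i \o L).
Proof.
move=> lL cL; apply: (@BC_affine _ _ _ _ _ _ L L) => [h v x|x].
  exact: lL.
exact: linear_diff.
Qed.

Let pxt (z : V) : ST := (z.1.1, z.2).

Let BC_pxt I al (f : I -> ST -> R) : BC al f -> BC (al \o pxt) (fun i => f i \o pxt).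
Proof.
apply: BC_linear => //; apply: continuous_pair; last by move=> u; exact: cvg_snd.
move=> z; apply: (continuous_comp (f := fst)); exact: cvg_fst.
Qed.

Let BC_pxxi I al (f : I -> Rd * Rd -> R) : BC al f -> BC (al \o fst) (fun i => f i \o (fst : V -> _)).
Proof. by apply: BC_linear => // z; exact: cvg_fst. Qed.

Lemma sch_amp I (f : I -> ST -> R) : sch f -> amp 0 (fun i (z : V) => f i (z.1.1, z.2)).
Proof.
move=> hf M; apply: (@BC_weight _ _ _ _ _ _ 1 _ _ (BC_pxt (hf M))) => // z.
by rewrite expr0 divr1 mul1r.
Qed.

Lemma symbol_amp I m (q : Rd * Rd -> R) (f : I -> ST -> R) :
  BC (fun z => (wt z.2 ^+ m)^-1) (fun _ : unit => q) -> sch f ->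
  amp m (fun i (z : V) => f i (z.1.1, z.2) * q z.1).
Proof.
move=> hq hf M.
have hq' := BC_reindex (fun _ : I => tt) (BC_pxxi hq).
have := BCM _ _ (BC_pxt (hf M)) hq'.
apply.
  by move=> z; exact: wtX_ge0.
by move=> z /=; rewrite invr_ge0 wtX_ge0.
Qed.

Lemma cos_pihalf_sub (t : R) : cos (t + - (pi / 2)) = sin t.
Proof. by rewrite -cosBpihalf. Qed.

(** The transpose is two oscillatory integrals in succession: integration over [x] produces
    functions that are Schwartz in [xi], and these are amplitudes of order 0 for the Fourier
    transform. *)
Lemma sch_OP1tr I m (p : Rd -> Rd -> R[i]) (f : I -> ST -> R) :
  BC (fun z => (wt z.2 ^+ m)^-1) (fun (_ : unit) (z : Rd * Rd) => complex.Re (p z.1 z.2)) ->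
  BC (fun z => (wt z.2 ^+ m)^-1) (fun (_ : unit) (z : Rd * Rd) => complex.Im (p z.1 z.2)) ->
  sch f ->
  sch (fun i z => complex.Re (OP1tr p (fun x => (f i (x, z.2))%:C) z.1)) /\
  sch (fun i z => complex.Im (OP1tr p (fun x => (f i (x, z.2))%:C) z.1)).
Proof.
move=> pr pi_ hf.
have ar := symbol_amp pr hf; have ai := symbol_amp pi_ hf.
set a1 := (fun i z => _) in ar; set a2 := (fun i z => _) in ai.
(* Real and imaginary parts of the inner integral; [cos (t + pi / 2) = - sin t] accounts for the
   minus sign in the real part. *)
pose gr i z := osc 0 a1 i z + osc (pi / 2) a2 i z.
pose gi i z := osc (- (pi / 2)) a1 i z + osc 0 a2 i z.
have sgr : sch gr by apply: schD; exact: osc_sch.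
have sgi : sch gi by apply: schD; exact: osc_sch.
have br := sch_amp sgr; have bi := sch_amp sgi.
set b1 := (fun i z => _) in br; set b2 := (fun i z => _) in bi.
have inner i t xi : cintegral (leb R d) setT
    (fun x => p x xi * (f i (x, t))%:C * expi (dotv x xi)) = gr i (xi, t) +i* gi i (xi, t).
  rewrite /cintegral; congr (_ +i* _).
  - rewrite /gr /osc -RintegralD//; [|exact: osc_integrable ar|exact: osc_integrable ai].
    apply: eq_Rintegral => x _; rewrite /osc_int /= addr0 cosDpihalf /a1 /a2 /=.
    by case: (p x xi) => u v /=; ring.
  - rewrite /gi /osc -RintegralD//; [|exact: osc_integrable ar|exact: osc_integrable ai].
    apply: eq_Rintegral => x _; rewrite /osc_int /= addr0 cos_pihalf_sub /a1 /a2 /=.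
    by case: (p x xi) => u v /=; ring.
pose k : R := ((2 * pi) ^+ d)^-1.
(* The Fourier transform has the conjugate exponential, so the quarter shifts occur with the
   opposite sign. *)
have outer i z : OP1tr p (fun x => (f i (x, z.2))%:C) z.1 =
    (k * (osc 0 b1 i z + osc (- (pi / 2)) b2 i z)) +i*
    (k * (osc (pi / 2) b1 i z + osc 0 b2 i z)).
  rewrite /OP1tr /fourier.
  under [X in cintegral _ _ X]funext => xi do rewrite inner.
  rewrite /cintegral [in LHS]/GRing.mul /= !mul0r subr0 addr0; congr (_ +i* _); congr (_ * _).
  - rewrite /osc -RintegralD//; [|exact: osc_integrable br|exact: osc_integrable bi].
    apply: eq_Rintegral => x _; rewrite /osc_int /= addr0 cos_pihalf_sub /b1 /b2 /=.
    by rewrite cosN sinN mulrN opprK.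
  - rewrite /osc -RintegralD//; [|exact: osc_integrable br|exact: osc_integrable bi].
    apply: eq_Rintegral => x _; rewrite /osc_int /= addr0 cosDpihalf /b1 /b2 /=.
    by rewrite cosN sinN.
split.
  apply: (@sch_ext _ (fun i z => k * (osc 0 b1 i z + osc (- (pi / 2)) b2 i z))).
    by move=> i z; rewrite outer.
  by apply: schZ; apply: schD; [exact: osc_sch br|exact: osc_sch bi].
apply: (@sch_ext _ (fun i z => k * (osc (pi / 2) b1 i z + osc 0 b2 i z))).
  by move=> i z; rewrite outer.
by apply: schZ; apply: schD; [exact: osc_sch br|exact: osc_sch bi].
Qed.

Lemma Re_sum (T : Type) (r : seq T) (F : T -> R[i]) :
  complex.Re (\sum_(t <- r) F t) = \sum_(t <- r) complex.Re (F t).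
Proof. by apply: (big_morph (@complex.Re R)) => // -[? ?] [? ?]. Qed.

Lemma Im_sum (T : Type) (r : seq T) (F : T -> R[i]) :
  complex.Im (\sum_(t <- r) F t) = \sum_(t <- r) complex.Im (F t).
Proof. by apply: (big_morph (@complex.Im R)) => // -[? ?] [? ?]. Qed.

Definition ReOPtr k l (P : symbol R d k l) (phi : ST -> 'cV[R]_k) (z : ST) : 'cV[R]_l :=
  map_mx (@complex.Re R) (OPtr P (fun x => phi (x, z.2)) z.1).

Definition ImOPtr k l (P : symbol R d k l) (phi : ST -> 'cV[R]_k) (z : ST) : 'cV[R]_l :=
  map_mx (@complex.Im R) (OPtr P (fun x => phi (x, z.2)) z.1).

Definition vsch I n (phi : I -> ST -> 'cV[R]_n) := forall j, sch (fun i z => phi i z j 0).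

Lemma vsch_OPtr I k l (P : symbol R d k l) (phi : I -> ST -> 'cV[R]_k) :
  polyhomogeneous 1 P -> vsch phi ->
  vsch (fun i => ReOPtr P (phi i)) /\ vsch (fun i => ImOPtr P (phi i)).
Proof.
(* The expansion with no term subtracted says that [P] itself is a symbol of order 1. *)
move=> [a [_ _ /(_ 0%N) hS]] hphi.
have {hS} hS : S10 1 P.
  move: hS; rewrite subr0; congr (S10 _ _).
  by apply/funext => x; apply/funext => xi; rewrite big_ord0 subr0.
have r1 : 1 <= 1%:R *+ 2 :> R by rewrite mulr2n lerDl.
have h i j := @sch_OP1tr I 1 (fun x xi => P x xi i j) _
  (symbol_BC r1 hS (or_introl erefl)) (symbol_BC r1 hS (or_intror erefl)) (hphi i).
split=> j.
  apply: (@sch_ext _ (fun i z => \sum_i' complex.Re (OP1tr (fun x xi => P x xi i' j)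
      (fun x => (phi i (x, z.2) i' 0)%:C) z.1))).
    by move=> i z; rewrite !mxE Re_sum.
  by apply: sch_sum => i'; exact: (h i' j).1.
apply: (@sch_ext _ (fun i z => \sum_i' complex.Im (OP1tr (fun x xi => P x xi i' j)
    (fun x => (phi i (x, z.2) i' 0)%:C) z.1))).
  by move=> i z; rewrite !mxE Im_sum.
by apply: sch_sum => i'; exact: (h i' j).2.
Qed.

End sch_calculus.

(** * Square-integrable functions and the uniform boundedness principle *)

Section L2_scalar.
Context d (T : measurableType d) {R : realType} (mu : {measure set T -> \bar R}).
Implicit Types f g h : T -> R.

Definition L2T f := measurable_fun setT f /\
  mu.-integrable setT (EFin \o (fun x => f x ^+ 2)).

Definition ip f g : R := \int[mu]_x (f x * g x).

Definition nrm f : R := Num.sqrt (ip f f).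

Lemma L2T_mul f g : L2T f -> L2T g -> mu.-integrable setT (EFin \o (fun x => f x * g x)).
Proof.
move=> [mf if2] [mg ig2].
apply: (@integrable_le _ _ _ mu setT _ (fun x => f x ^+ 2 + g x ^+ 2)) => //.
- exact: measurable_funM.
- move=> x _; rewrite normrM -(real_normK (num_real (f x))) -(real_normK (num_real (g x))).
  have := sqr_ge0 (`|f x| - `|g x|); have := sqr_ge0 (`|f x| + `|g x|); nra.
- exact: (integrableD measurableT if2 ig2).
Qed.

Lemma L2TZ a f : L2T f -> L2T (fun x => a * f x).
Proof.
move=> [mf if2]; split; first exact: measurable_funM.
rewrite (_ : _ \o _ = (fun x => (a ^+ 2)%:E * (f x ^+ 2)%:E)%E); last first.
  by apply/funext => x; rewrite /= exprMn EFinM.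
exact: (integrableZl measurableT).
Qed.

Lemma L2TD f g : L2T f -> L2T g -> L2T (fun x => f x + g x).
Proof.
move=> hf hg; have [mf if2] := hf; have [mg ig2] := hg.
split; first exact: measurable_funD.
apply: (@integrable_le _ _ _ mu setT _
    (fun x => f x ^+ 2 + f x ^+ 2 + (g x ^+ 2 + g x ^+ 2))) => //.
- exact/measurable_funX/measurable_funD.
- move=> x _; rewrite ger0_norm ?sqr_ge0//.
  by have := sqr_ge0 (f x - g x); rewrite sqrrB sqrrD; lra.
- exact: (integrableD measurableT (integrableD measurableT if2 if2)
    (integrableD measurableT ig2 ig2)).
Qed.

Lemma L2TB f g : L2T f -> L2T g -> L2T (fun x => f x - g x).
Proof.
move=> hf hg; have := L2TD hf (L2TZ (-1) hg); congr L2T.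
by apply/funext => x; rewrite mulN1r.
Qed.

Lemma ipC f g : ip f g = ip g f.
Proof. by apply: eq_Rintegral => x _; rewrite mulrC. Qed.

Lemma ipDl f g h : L2T f -> L2T g -> L2T h ->
  ip (fun x => f x + g x) h = ip f h + ip g h.
Proof.
move=> hf hg hh; rewrite /ip -RintegralD//; [|exact: L2T_mul|exact: L2T_mul].
by apply: eq_Rintegral => x _; rewrite mulrDl.
Qed.

Lemma ipZl a f g : L2T f -> L2T g -> ip (fun x => a * f x) g = a * ip f g.
Proof.
move=> hf hg; rewrite /ip -RintegralZl//; last exact: L2T_mul.
by apply: eq_Rintegral => x _; rewrite mulrA.
Qed.

Lemma ipDr f g h : L2T f -> L2T g -> L2T h ->
  ip h (fun x => f x + g x) = ip h f + ip h g.
Proof. by move=> hf hg hh; rewrite ipC ipDl// !(ipC h). Qed.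

Lemma ipZr a f g : L2T f -> L2T g -> ip g (fun x => a * f x) = a * ip g f.
Proof. by move=> hf hg; rewrite ipC ipZl// (ipC g). Qed.

Lemma ipBl f g h : L2T f -> L2T g -> L2T h ->
  ip (fun x => f x - g x) h = ip f h - ip g h.
Proof.
move=> hf hg hh; rewrite /ip -RintegralB//; [|exact: L2T_mul|exact: L2T_mul].
by apply: eq_Rintegral => x _; rewrite mulrBl.
Qed.

Lemma ipBr f g h : L2T f -> L2T g -> L2T h ->
  ip h (fun x => f x - g x) = ip h f - ip h g.
Proof. by move=> hf hg hh; rewrite ipC ipBl// !(ipC h). Qed.

Lemma ip_ge0 f : 0 <= ip f f.
Proof. by apply: Rintegral_ge0 => x _; rewrite -expr2 sqr_ge0. Qed.

Lemma nrm_sqr f : nrm f ^+ 2 = ip f f.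
Proof. by rewrite sqr_sqrtr// ip_ge0. Qed.

Lemma nrm_ge0 f : 0 <= nrm f. Proof. exact: sqrtr_ge0. Qed.

(** The quadratic polynomial in [s] is nonnegative; its minimum gives the inequality. If the leading
    coefficient vanishes the polynomial is affine, and the chosen [s] gives it the value -1 unless
    [ip f g] is 0. *)
Lemma cauchy_schwarz f g : L2T f -> L2T g -> `|ip f g| <= nrm f * nrm g.
Proof.
move=> hf hg; rewrite /nrm -sqrtrM ?ip_ge0// -sqrtr_sqr ler_wsqrtr//.
have quad s : 0 <= s ^+ 2 * ip f f + 2 * s * ip f g + ip g g.
  have hs := L2TZ s hf.
  have := ip_ge0 (fun x => s * f x + g x).
  rewrite ipDl// ?ipDr//; [|exact: L2TD..].
  rewrite !ipZl// !ipZr// (ipC g f).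
  by congr (0 <= _); ring.
have [f0|f0] := eqVneq (ip f f) 0.
  rewrite f0 mul0r; have [->|c0] := eqVneq (ip f g) 0; first by rewrite expr0n.
  have := quad (- (ip g g + 1) / (2 * ip f g)); rewrite f0 mulr0 add0r.
  rewrite (_ : 2 * _ * _ = - (ip g g + 1)); last by field.
  lra.
have fp : 0 < ip f f by rewrite lt_def f0 ip_ge0.
have := quad (- ip f g / ip f f).
rewrite (_ : _ + _ = ip g g - ip f g ^+ 2 / ip f f); last by field.
by rewrite subr_ge0 ler_pdivrMr// mulrC.
Qed.

Lemma nrmD f g : L2T f -> L2T g -> nrm (fun x => f x + g x) <= nrm f + nrm g.
Proof.
move=> hf hg; rewrite -ler_sqr ?nnegrE ?addr_ge0 ?nrm_ge0//.
rewrite nrm_sqr ipDl//; last exact: L2TD.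
rewrite !ipDr// (ipC g f) sqrrD !nrm_sqr.
have := cauchy_schwarz hf hg; rewrite ler_norml => /andP[_]; lra.
Qed.

Lemma nrmZ a f : L2T f -> nrm (fun x => a * f x) = `|a| * nrm f.
Proof.
move=> hf; rewrite /nrm ipZl//; last exact: L2TZ.
by rewrite ipZr// mulrA -expr2 sqrtrM ?sqr_ge0// sqrtr_sqr.
Qed.

Lemma L2T0 : L2T (fun=> 0).
Proof.
split=> //; rewrite (_ : _ \o _ = cst 0%E); first exact: integrable0.
by apply/funext => x; rewrite /= expr0n.
Qed.

Lemma ip_sqr f : ip f f = \int[mu]_x (f x ^+ 2).
Proof. by apply: eq_Rintegral => x _; rewrite expr2. Qed.

Lemma integral_sqr f : L2T f -> (\int[mu]_x (f x ^+ 2)%:E = (ip f f)%:E)%E.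
Proof.
by move=> hf; rewrite ip_sqr /Rintegral fineK// integrable_fin_num//; exact: hf.2.
Qed.

(** Fatou's lemma stands in for completeness of $L^2$: it needs pointwise limits, and this is why
    the gliding hump below is made to converge pointwise. *)
Lemma L2T_fatou (y : nat -> T -> R) (x : T -> R) (M : R) :
  (forall n, L2T (y n)) -> (forall z, y n z @[n --> \oo] --> x z) ->
  (\forall n \near \oo, ip (y n) (y n) <= M) -> L2T x /\ ip x x <= M.
Proof.
move=> hy yx hM.
have mx : measurable_fun setT x.
  by apply: (measurable_fun_cvg (h := y)) => [n|z _]; [exact: (hy n).1|exact: yx].
have mx2 : measurable_fun setT (fun z => x z ^+ 2) by exact: measurable_funX.
have fin : (\int[mu]_z (x z ^+ 2)%:E <= M%:E)%E.
  have := @fatou _ _ _ mu setT measurableT (fun n z => (y n z ^+ 2)%:E).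
  rewrite (_ : (fun x0 => limn_einf _) = (fun z => (x z ^+ 2)%:E)); last first.
    apply/funext => z; apply: (cvg_limn_einf_sup _).1.
    apply: cvg_EFin; first exact: nearW.
    by rewrite /comp /=; under [X in X @ _]funext do rewrite expr2; rewrite expr2; apply: cvgM; exact: yx.
  move=> /(_ _ _)/le_trans; apply.
  - by move=> n; apply/measurable_EFinP/measurable_funX; exact: (hy n).1.
  - by move=> n z _; rewrite lee_fin sqr_ge0.
  rewrite limn_einf_lim; apply: lime_le; first exact: is_cvg_einfs.
  case: hM => N _ hN; near=> n; apply: le_trans (_ : (\int[mu]_z (y (maxn n N) z ^+ 2)%:E <= _)%E).
    apply: ereal_inf_lbound; exists (maxn n N) => //=; exact: leq_maxl.
  have [_ iy] := hy (maxn n N).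
  rewrite -(fineK (integrable_fin_num measurableT iy)) lee_fin.
  apply: le_trans (hN (maxn n N) (leq_maxr _ _)).
  by rewrite ip_sqr.
have L2x : L2T x.
  split=> //; apply/integrableP; split; first exact/measurable_EFinP.
  under eq_integral do rewrite /= ger0_norm ?sqr_ge0//.
  exact: le_lt_trans fin (ltry _).
split=> //; rewrite -lee_fin; apply: le_trans fin.
by rewrite ip_sqr /Rintegral fineK// integrable_fin_num//; exact: L2x.2.
Unshelve. all: by end_near. Qed.

End L2_scalar.

Section banach_steinhaus.
Context d (T : measurableType d) {R : realType} (mu : {measure set T -> \bar R}).
Local Notation L2T := (L2T mu).
Local Notation ip := (ip mu).
Local Notation nrm := (nrm mu).

(* Sokal's gliding hump: [x_k+1 = x_k +- 3 ^- k * w_k / nrm (w_k)] has a limit whose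
   product with [w k] is large; [sw] makes the series converge pointwise. *)
Section sokal.
Variable w : nat -> T -> R.
Hypothesis hw : forall k, L2T (w k).
Hypothesis nw : forall k, 4 ^+ k <= nrm (w k).
Hypothesis sw : forall z, exists B, forall n,
  \sum_(0 <= j < n) 3 ^- j * (w j z / nrm (w j)) ^+ 2 <= B.

Let nw0 k : 0 < nrm (w k).
Proof. by apply: lt_le_trans (nw k); rewrite exprn_gt0. Qed.

(* The sign makes [ip (w k) (sokal_seq k.+1)] at least [3 ^- k * nrm (w k)]. *)
Fixpoint sokal_seq (k : nat) : T -> R := match k with
  | 0 => fun=> 0
  | k.+1 => fun z => sokal_seq k z +
      ((if 0 <= ip (w k) (sokal_seq k) then 1 else -1) * (3 ^- k / nrm (w k))) * w k z
  end.

Let s k := (if 0 <= ip (w k) (sokal_seq k) then 1 else -1) * (3 ^- k / nrm (w k)).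

Let x := sokal_seq.

Let xS k : x k.+1 = (fun z => x k z + s k * w k z). Proof. by []. Qed.

Let normsE k : `|s k| = 3 ^- k / nrm (w k).
Proof.
have p : 0 <= 3 ^- k / nrm (w k) :> R by rewrite divr_ge0 ?invr_ge0 ?exprn_ge0// ltW.
rewrite /s normrM (ger0_norm p).
by case: ifP => _; rewrite ?normrN normr1 mul1r.
Qed.

Let hx k : L2T (x k).
Proof. by elim: k => [|k ih]; [exact: L2T0|rewrite xS; apply: L2TD => //; exact: L2TZ]. Qed.

Let ip_x k : 3 ^- k * nrm (w k) <= `|ip (w k) (x k.+1)|.
Proof.
rewrite xS ipDr//; last exact: L2TZ.
rewrite ipZr// -nrm_sqr /s.
have p : 0 <= 3 ^- k * nrm (w k) by rewrite mulr_ge0 ?invr_ge0 ?exprn_ge0// ltW.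
have -> (t : R) : t * (3 ^- k / nrm (w k)) * nrm (w k) ^+ 2 = t * (3 ^- k * nrm (w k)).
  by rewrite -!mulrA expr2 mulKf ?gt_eqF.
rewrite -/x; have [h|h] := leP 0 (ip (w k) (x k)); rewrite ?mul1r ?mulN1r.
  by rewrite ger0_norm ?addr_ge0// lerDr.
rewrite -normrN opprD opprK ger0_norm; first by rewrite lerDr oppr_ge0 ltW.
by rewrite addr_ge0// oppr_ge0 ltW.
Qed.

(** The sum of [3 ^- k] over [k >= m], hence a bound on the distance from [x m] to the limit. *)
Let b m : R := 3 / 2 * 3 ^- m.

Let nrm_x m p : nrm (fun z => x (m + p) z - x m z) <= b m - b (m + p).
Proof.
elim: p => [|p ih].
  rewrite addn0 subrr (_ : (fun z => _) = (fun z => 0 * x m z)).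
    by rewrite nrmZ// normr0 mul0r.
  by apply/funext => z; rewrite mul0r subrr.
rewrite addnS xS (_ : (fun z => _) = (fun z => (x (m + p) z - x m z) + s (m + p) * w (m + p)%N z)).
  apply: le_trans (nrmD _ _) _; [exact: L2TB|exact: L2TZ|].
  rewrite nrmZ// normsE divfK ?gt_eqF//.
  apply: le_trans (lerD ih (lexx _)) _.
  rewrite -addrA lerD2l /b exprS invfM; lra.
by apply/funext => z; rewrite addrAC.
Qed.

Let x_cvg z : cvgn (x ^~ z).
Proof.
have E : x ^~ z = series (fun k => s k * w k z).
  apply/funext => n; rewrite /series /=; elim: n => [|n ih]; first by rewrite big_geq.
  by rewrite big_nat_recr//= -ih.
rewrite E; apply: normed_cvg; apply: nondecreasing_is_cvgn.
  by apply: nondecreasing_series => n _ _; exact: normr_ge0.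
have [B hB] := sw z.
exists (3 / 2 + B) => _ [n _ <-]; rewrite /series /=.
(* [t <= 1 + t ^ 2] for the normalized values compares the series with a geometric one plus the sum
   that [sw] controls. *)
apply: le_trans (_ : \sum_(0 <= k < n) (3 ^- k + 3 ^- k * (w k z / nrm (w k)) ^+ 2) <= _).
  apply: ler_sum_nat => k _; rewrite normrM normsE -mulrA.
  have p : 0 <= 3 ^- k :> R by rewrite invr_ge0 exprn_ge0.
  rewrite -[X in X + _]mulr1 -mulrDr ler_wpM2l//.
  rewrite -(real_normK (num_real (_ / _))) normrM [in leRHS]normfV (gtr0_norm (nw0 k)) mulrC.
  by set t := _ / _; have := sqr_ge0 (t - 1); nra.
rewrite big_split lerD//=.
have -> : \sum_(0 <= i < n) 3 ^- i = 3 / 2 - b n :> R.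
  elim: n => [|n ih]; first by rewrite big_geq// /b expr0 invr1 mulr1 subrr.
  rewrite big_nat_recr//= ih /b exprS invfM; lra.
by rewrite gerBl /b mulr_ge0 ?invr_ge0 ?exprn_ge0// divr_ge0.
Qed.

(** After step [k] the product with [w k] is at least [3 ^- k * nrm (w k)] in modulus, and all later
    steps together change it by at most half of that, since [b k.+1 = 3 ^- k / 2]. *)
Lemma sokal : exists2 X, L2T X & forall k, 3 ^- k / 2 * nrm (w k) <= `|ip (w k) X|.
Proof.
pose X z := limn (x ^~ z).
(* Used with [g = 0] to see that [X] is square integrable, and with [g = x k.+1] to measure the
   remainder. *)
have key m (g : T -> R) : L2T g ->
    (forall p, nrm (fun z => x (m + p) z - g z) <= b m) ->
    L2T (fun z => X z - g z) /\ nrm (fun z => X z - g z) <= b m.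
  move=> hg h.
  have b0 : 0 <= b m by apply: le_trans (nrm_ge0 _ _) (h 0%N).
  have [|||h1 h2] := @L2T_fatou _ _ _ mu (fun n z => x n z - g z) (fun z => X z - g z) (b m ^+ 2).
  - by move=> n; exact: L2TB.
  - by move=> z; apply: cvgB; [exact: x_cvg|exact: cvg_cst].
  - exists m => // n /= mn; rewrite -nrm_sqr lerXn2r ?nnegrE ?nrm_ge0//.
    by rewrite -(subnKC mn).
  - by split=> //; rewrite /nrm -[b m]ger0_norm// -sqrtr_sqr ler_wsqrtr.
have hX : L2T X.
  have [|+ _] := key 0%N (fun=> 0) (L2T0 mu).
    move=> p; apply: le_trans (nrm_x 0 p) _; rewrite gerBl.
    by rewrite /b mulr_ge0 ?invr_ge0 ?exprn_ge0// divr_ge0.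
  by congr (L2T _); apply/funext => z; rewrite subr0.
exists X => // k.
have [p|h1 h2] := key k.+1 (x k.+1) (hx _).
  apply: le_trans (nrm_x _ p) _; rewrite gerBl.
  by rewrite /b mulr_ge0 ?invr_ge0 ?exprn_ge0// divr_ge0.
have E : ip (w k) (x k.+1) = ip (w k) X - ip (w k) (fun z => X z - x k.+1 z).
  by rewrite ipBr//; ring.
have := ip_x k; rewrite E => h.
have := cauchy_schwarz (hw k) h1 => h'.
have h'' : nrm (w k) * nrm (fun z => X z - x k.+1 z) <= nrm (w k) * (3 ^- k / 2).
  rewrite ler_wpM2l ?nrm_ge0//; apply: le_trans h2 _; rewrite /b exprS invfM; lra.
have := ler_normB (ip (w k) X) (ip (w k) (fun z => X z - x k.+1 z)).
lra.
Qed.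

End sokal.

(** If the norms were unbounded, choosing terms of norm at least [4 ^ k] would yield, by the gliding
    hump, one function whose products with them are at least [(4 / 3) ^ k / 2]. *)
Theorem L2_banach_steinhaus (u : nat -> T -> R) : (forall n, L2T (u n)) ->
  (forall g, L2T g -> exists B : R, forall n, `|ip (u n) g| <= B) ->
  exists B : R, forall n, nrm (u n) <= B.
Proof.
move=> hu hb; apply: contrapT => nB.
have /choice[r hr] : forall k, exists n, 4 ^+ k <= nrm (u n).
  move=> k; apply: contrapT => h; apply: nB; exists (4 ^+ k) => n.
  by rewrite leNgt; apply/negP => ?; apply: h; exists n; exact: ltW.
pose w k := u (r k).
have nw k : 0 < nrm (w k) by apply: lt_le_trans (hr k); rewrite exprn_gt0.
pose f k z := 3 ^- k * (w k z / nrm (w k)) ^+ 2 : R.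
have f0 k z : 0 <= f k z by rewrite mulr_ge0 ?sqr_ge0// invr_ge0 exprn_ge0.
have mw k : measurable_fun setT (w k) by exact: (hu _).1.
have mf k : measurable_fun setT (EFin \o f k).
  by apply/measurable_EFinP/measurable_funM => //; apply/measurable_funX/measurable_funM.
(* The squares are normalized, so the integral of [S] is the sum of the [3 ^- k]; hence [S] is
   finite almost everywhere, which provides the pointwise bound of the gliding hump. *)
pose S z := (\sum_(k <oo) (f k z)%:E)%E.
have mS : measurable_fun setT S.
  have f0' k z : [set: T] z -> xpredT k -> (0 <= (f k z)%:E)%E by rewrite lee_fin.
  exact: (@ge0_emeasurable_sum _ _ _ setT _ xpredT f0' (fun k _ => mf k)).
have iS : (\int[mu]_z S z < +oo)%E.
  rewrite integral_nneseries//; last by move=> n z _; rewrite lee_fin.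
  have E k : (\int[mu]_z (f k z)%:E = (3 ^- k)%:E)%E.
    have L2w := L2TZ (nrm (w k))^-1 (hu (r k)).
    under eq_integral do rewrite /f EFinM mulrC.
    rewrite ge0_integralZl//.
    - rewrite (integral_sqr L2w) -EFinM -nrm_sqr nrmZ// normfV (gtr0_norm (nw k)).
      by rewrite mulVf ?gt_eqF// expr1n mulr1.
    - by apply/measurable_EFinP/measurable_funX; exact: L2w.1.
    - by move=> z _; rewrite lee_fin sqr_ge0.
  under eq_eseriesr do rewrite E.
  apply: le_lt_trans (ltry (3 / 2)); apply: lime_le.
    by apply: is_cvg_ereal_nneg_natsum => n _; rewrite lee_fin invr_ge0 exprn_ge0.
  apply: nearW => n; rewrite sumEFin lee_fin.
  have -> : \sum_(0 <= i < n) 3 ^- i = 3 / 2 - 3 / 2 * 3 ^- n :> R.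
    elim: n => [|n ih]; first by rewrite big_geq// expr0 invr1 mulr1 subrr.
    rewrite big_nat_recr//= ih exprS invfM; lra.
  by rewrite gerBl mulr_ge0 ?invr_ge0 ?exprn_ge0// divr_ge0.
pose E := [set z | (S z < +oo)%E].
have S0 z : (0 <= S z)%E by apply: nneseries_ge0 => n _ _; rewrite lee_fin.
have mE : measurable E.
  rewrite (_ : E = ~` (S @^-1` [set +oo%E])); last first.
    by apply/seteqP; split=> z; rewrite /E /= lt_neqAle leey andbT => /eqP.
  by apply: measurableC; rewrite -[X in measurable X]setTI; apply: mS.
have aeE : {ae mu, forall z, E z}.
  have : mu.-integrable setT S.
    apply/integrableP; split=> //.
    by under eq_integral do rewrite gee0_abs//.
  move/integrable_ae => /(_ measurableT); apply: filterS => z /(_ I).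
  by rewrite /E /= ge0_fin_numE.
(* Replacing the functions by 0 on the null set where [S] is infinite gives that bound everywhere
   and alters neither norms nor products. *)
pose w' k z := w k z * \1_E z.
have mw' k : measurable_fun setT (w' k).
  by apply: measurable_funM => //; exact: measurable_indic.
have hw' k : L2T (w' k).
  split=> //; apply: (@integrable_le _ _ _ mu setT _ (fun z => w k z ^+ 2)) => //.
  - exact: measurable_funX.
  - move=> z _; rewrite ger0_norm ?sqr_ge0// /w' indicE exprMn.
    by case: (_ \in _); rewrite ?expr1n ?mulr1// expr0n mulr0 sqr_ge0.
  - exact: (hu _).2.
have ipw' k g : L2T g -> ip (w' k) g = ip (w k) g.
  move=> hg; congr fine; apply: ae_eq_integral => //.
  - by apply/measurable_EFinP/measurable_funM => //; exact: hg.1.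
  - by apply/measurable_EFinP/measurable_funM => //; exact: hg.1.
  - by apply: filterS aeE => z Ez _; rewrite /w' indicE mem_set// mulr1.
have nw' k : nrm (w' k) = nrm (w k).
  by rewrite /nrm ipw'// ipC ipw'//; exact: hu.
have [] := @sokal w'.
- by [].
- by move=> k; rewrite nw'.
- move=> z; have [Ez|nEz] := pselect (E z); last first.
    exists 0 => n; rewrite big1// => j _.
    by rewrite /w' indicE memNset// mulr0 mul0r expr0n mulr0.
  exists (fine (S z)) => n; rewrite -lee_fin fineK ?ge0_fin_numE//.
  under eq_bigr do rewrite nw' /w' indicE mem_set// mulr1.
  rewrite -sumEFin; apply: (@nneseries_lim_ge _ (fun k => (f k z)%:E) xpredT 0).
  by move=> k _ _; rewrite lee_fin.
move=> X hX hk; have [B hB] := hb X hX.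
have k43 k : 2^-1 * (4 / 3) ^+ k <= B.
  apply: le_trans (hB (r k)); rewrite -ipw'//; apply: le_trans (hk k).
  rewrite nw'; apply: le_trans (ler_wpM2l _ (hr k)).
    by rewrite expr_div_n; set p := 4 ^+ k; set q := 3 ^- k; lra.
  by rewrite divr_ge0// invr_ge0 exprn_ge0.
have bern k : 1 + k%:R / 3 <= (4 / 3) ^+ k :> R.
  elim: k => [|k ih]; first by rewrite mul0r addr0 expr0.
  rewrite exprS -natr1; have : 0 <= k%:R :> R by []. 
  set a := (4 / 3) ^+ k in ih *; set n := k%:R in ih *; lra.
have h2 : 0 <= 2^-1 :> R by rewrite invr_ge0.
have := le_trans (ler_wpM2l h2 (bern (Num.trunc (6 * `|B|)).+1)) (k43 _).
have := truncnS_gt (6 * `|B|); have := ler_norm B.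
set n := _%:R; lra.
Qed.

End banach_steinhaus.

(** * Vector-valued square-integrable functions *)

Section L2_vector.
Context d (T : measurableType d) {R : realType} (mu : {measure set T -> \bar R}).

(** Extension by zero moves every integral to the whole space, so one product and one norm serve for
    all sets. *)
Definition cut n (S : set T) (u : T -> 'cV[R]_n) (z : T) : 'cV[R]_n := \1_S z *: u z.

Definition vL2 n (u : T -> 'cV[R]_n) := forall j, L2T mu (fun z => u z j 0).

Definition vip n (u v : T -> 'cV[R]_n) : R :=
  \sum_j ip mu (fun z => u z j 0) (fun z => v z j 0).

(** A norm equivalent to that of $|u|$ in $L^2$, which reduces vector estimates to scalar ones. *)
Definition vn n (u : T -> 'cV[R]_n) : R := \sum_j nrm mu (fun z => u z j 0).

Lemma cutE n (S : set T) (u : T -> 'cV[R]_n) z j : cut S u z j 0 = \1_S z * u z j 0.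
Proof. by rewrite mxE. Qed.

Lemma dotv_cV n (u v : 'cV[R]_n) : dotv u v = \sum_j u j 0 * v j 0.
Proof. by apply: eq_bigr => j _; rewrite big_ord1. Qed.

Lemma vL2_cut n (S : set T) (u : T -> 'cV[R]_n) : measurable S -> L2 mu S u -> vL2 (cut S u).
Proof.
move=> mS hu j; have [mu_ iu] := hu j 0.
have E : (fun z => cut S u z j 0) = (fun z => u z j 0) \_ S.
  by apply/funext => z; rewrite cutE patchE indicE; case: ifP; rewrite ?mul1r ?mul0r.
have m : measurable_fun setT (fun z => cut S u z j 0).
  by rewrite E; apply/(measurable_restrict _ mS measurableT); rewrite setTI.
split=> //; apply/integrableP; split; first exact/measurable_EFinP/measurable_funX.
apply: le_lt_trans iu; rewrite [leRHS]integral_mkcond.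
rewrite le_eqVlt; apply/orP; left; apply/eqP; apply: eq_integral => z _.
rewrite /= ger0_norm ?sqr_ge0// patchE cutE indicE.
by case: ifP; rewrite ?mul1r// mul0r expr0n.
Qed.

Lemma L2_vL2 n (S : set T) (u : T -> 'cV[R]_n) : measurable S -> vL2 u -> L2 mu S u.
Proof.
move=> mS hu i j; rewrite ord1; have [m iu] := hu i.
split; first exact: measurable_funS m.
have /integrableP[_] := integrableS measurableT mS (@subsetT _ S) iu.
by under eq_integral do rewrite /= ger0_norm ?sqr_ge0//.
Qed.

Lemma pairing_vip n (S : set T) (u v : T -> 'cV[R]_n) : measurable S ->
  vL2 (cut S u) -> vL2 v -> \int[mu]_(z in S) dotv (u z) (v z) = vip (cut S u) v.
Proof.
move=> mS hu hv; rewrite Rintegral_mkcond /vip /ip.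
have -> : (fun z => dotv (u z) (v z)) \_ S = (fun z => \sum_j cut S u z j 0 * v z j 0).
  apply/funext => z; rewrite patchE dotv_cV.
  have E j : cut S u z j 0 * v z j 0 = \1_S z * (u z j 0 * v z j 0) by rewrite cutE mulrA.
  under [RHS]eq_bigr do rewrite E.
  by rewrite -mulr_sumr indicE; case: ifP; rewrite ?mul1r ?mul0r.
have H (r : seq 'I_n) : mu.-integrable setT (EFin \o (fun z => \sum_(j <- r) cut S u z j 0 * v z j 0)) /\
   \int[mu]_z (\sum_(j <- r) cut S u z j 0 * v z j 0) =
   \sum_(j <- r) \int[mu]_z (cut S u z j 0 * v z j 0).
  elim: r => [|j r [ih1 ih2]].
    split; last first.
      by under eq_Rintegral do rewrite big_nil; rewrite big_nil Rintegral_cst// mul0r.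
    rewrite (_ : _ \o _ = cst 0%E); first exact: integrable0.
    by apply/funext => z; rewrite /= big_nil.
  have ij := L2T_mul (hu j) (hv j).
  have E : (fun z => \sum_(j <- j :: r) cut S u z j 0 * v z j 0) =
     (fun z => cut S u z j 0 * v z j 0 + \sum_(j <- r) cut S u z j 0 * v z j 0).
    by apply/funext => z; rewrite big_cons.
  split; first by rewrite E; exact: (integrableD measurableT ij ih1).
  by rewrite E RintegralD// ih2 big_cons.
exact: (H _).2.
Qed.

Lemma vn_ge0 n (u : T -> 'cV[R]_n) : 0 <= vn u.
Proof. by apply: sumr_ge0 => j _; exact: nrm_ge0. Qed.

Lemma le_nrm_vn n (u : T -> 'cV[R]_n) j : nrm mu (fun z => u z j 0) <= vn u.
Proof. by rewrite /vn (bigD1 j)//= lerDl sumr_ge0// => i _; exact: nrm_ge0. Qed.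

Lemma vip_le n (u v : T -> 'cV[R]_n) : vL2 u -> vL2 v -> `|vip u v| <= vn u * vn v.
Proof.
move=> hu hv; apply: le_trans (ler_norm_sum _ _ _) _; rewrite /vn mulr_suml.
apply: ler_sum => j _; apply: le_trans (cauchy_schwarz (hu j) (hv j)) _.
by rewrite ler_wpM2l ?nrm_ge0//; exact: le_nrm_vn.
Qed.

Lemma vL2B n (u v : T -> 'cV[R]_n) : vL2 u -> vL2 v -> vL2 (fun z => u z - v z).
Proof.
move=> hu hv j; have := L2TB (hu j) (hv j); congr (L2T _ _).
by apply/funext => z; rewrite !mxE.
Qed.

Lemma vL2Z n a (u : T -> 'cV[R]_n) : vL2 u -> vL2 (fun z => a *: u z).
Proof.
move=> hu j; have := L2TZ a (hu j); congr (L2T _ _).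
by apply/funext => z; rewrite !mxE.
Qed.

Lemma vipBl n (u v w : T -> 'cV[R]_n) : vL2 u -> vL2 v -> vL2 w ->
  vip (fun z => u z - v z) w = vip u w - vip v w.
Proof.
move=> hu hv hw; rewrite /vip -sumrB; apply: eq_bigr => j _.
rewrite -ipBl//; congr (ip _ _ _); by apply/funext => z; rewrite !mxE.
Qed.

Lemma vipBr n (u v w : T -> 'cV[R]_n) : vL2 u -> vL2 v -> vL2 w ->
  vip w (fun z => u z - v z) = vip w u - vip w v.
Proof.
move=> hu hv hw; rewrite /vip -sumrB; apply: eq_bigr => j _.
rewrite -ipBr//; congr (ip _ _ _); by apply/funext => z; rewrite !mxE.
Qed.

Lemma vipZl n a (u w : T -> 'cV[R]_n) : vL2 u -> vL2 w ->
  vip (fun z => a *: u z) w = a * vip u w.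
Proof.
move=> hu hw; rewrite /vip mulr_sumr; apply: eq_bigr => j _.
rewrite -ipZl//; congr (ip _ _ _); by apply/funext => z; rewrite !mxE.
Qed.

Lemma vipZr n a (u w : T -> 'cV[R]_n) : vL2 u -> vL2 w ->
  vip w (fun z => a *: u z) = a * vip w u.
Proof.
move=> hu hw; rewrite /vip mulr_sumr; apply: eq_bigr => j _.
rewrite -ipZr//; congr (ip _ _ _); by apply/funext => z; rewrite !mxE.
Qed.

Lemma nrm_norm (f : T -> R) : nrm mu (fun z => `|f z|) = nrm mu f.
Proof.
rewrite /nrm !ip_sqr; congr Num.sqrt; apply: eq_Rintegral => z _.
by rewrite real_normK// num_real.
Qed.

Lemma L2T_norm (f : T -> R) : L2T mu f -> L2T mu (fun z => `|f z|).
Proof.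
move=> [mf if2]; split; first exact: measurableT_comp.
by under eq_fun do rewrite real_normK ?num_real//.
Qed.

Lemma L2T_le (f g : T -> R) : measurable_fun setT f -> L2T mu g -> (forall z, `|f z| <= g z) -> L2T mu f.
Proof.
move=> mf [mg ig] fg; split=> //.
apply: (@integrable_le _ _ _ mu setT _ (fun z => g z ^+ 2)) => //; first exact: measurable_funX.
move=> z _; rewrite ger0_norm ?sqr_ge0// -(real_normK (num_real (f z))).
by rewrite lerXn2r ?nnegrE// (le_trans _ (fg z)).
Qed.

Lemma nrm_le (f g : T -> R) : L2T mu f -> L2T mu g -> (forall z, `|f z| <= g z) -> nrm mu f <= nrm mu g.
Proof.
move=> hf hg fg; rewrite /nrm !ip_sqr ler_wsqrtr//; apply: le_Rintegral => //.
- exact: hf.2.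
- exact: hg.2.
- move=> z _; rewrite -(real_normK (num_real (f z))).
  by rewrite lerXn2r ?nnegrE// (le_trans _ (fg z)).
Qed.

Lemma L2T_sum (I : Type) (r : seq I) (f : I -> T -> R) :
  (forall i, L2T mu (f i)) -> L2T mu (fun z => \sum_(i <- r) f i z).
Proof.
move=> hf; elim: r => [|i r ih].
  have -> : (fun z => \sum_(i <- [::]) f i z) = (fun=> 0 : R).
    by apply/funext => z; rewrite big_nil.
  exact: L2T0.
have -> : (fun z => \sum_(i <- i :: r) f i z) = (fun z => f i z + \sum_(i <- r) f i z).
  by apply/funext => z; rewrite big_cons.
exact: L2TD.
Qed.

Lemma nrm_sum (I : Type) (r : seq I) (f : I -> T -> R) :
  (forall i, L2T mu (f i)) ->
  nrm mu (fun z => \sum_(i <- r) f i z) <= \sum_(i <- r) nrm mu (f i).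
Proof.
move=> hf; elim: r => [|i r ih].
  have -> : (fun z => \sum_(i <- [::]) f i z) = (fun=> 0 : R).
    by apply/funext => z; rewrite big_nil.
  rewrite big_nil /nrm ip_sqr; under eq_Rintegral do rewrite expr0n.
  by rewrite Rintegral_cst// mul0r sqrtr0.
have -> : (fun z => \sum_(i <- i :: r) f i z) = (fun z => f i z + \sum_(i <- r) f i z).
  by apply/funext => z; rewrite big_cons.
rewrite big_cons; apply: le_trans (nrmD (hf i) (L2T_sum r hf)) _.
by rewrite lerD2l.
Qed.

Lemma nrm_L2norm_sq n (S : set T) (u : T -> 'cV[R]_n) j : measurable S -> L2 mu S u ->
  ((nrm mu (fun z => cut S u z j 0) ^+ 2)%:E <= L2norm_sq mu S u)%E.
Proof.
move=> mS hu; rewrite nrm_sqr -integral_sqr; last exact: vL2_cut.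
rewrite /L2norm_sq [leRHS]integral_mkcond; apply: ge0_le_integral => //.
- by move=> z _; rewrite lee_fin sqr_ge0.
- by apply/measurable_EFinP/measurable_funX; have [] := vL2_cut mS hu j.
- apply/(measurable_restrict _ mS measurableT); rewrite setTI; apply/measurable_EFinP.
  under eq_fun do rewrite dotv_cV.
  apply: measurable_sum => i; apply: measurable_funM; exact: (hu i 0).1.
- move=> z _; rewrite patchE cutE indicE; case: ifP => _; last by rewrite mul0r expr0n.
  rewrite mul1r lee_fin dotv_cV (bigD1 j)//= expr2 lerDl sumr_ge0// => i _.
  by rewrite -expr2 sqr_ge0.
Qed.

End L2_vector.

(** * Nonlinear terms near a compact set *)

Section compactness.
Context {R : realType}.

Lemma trmx_continuous m n : continuous (@trmx R m n).
Proof.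
move=> M A /= /nbhs_ballP[e /= e0 eA]; apply/nbhs_ballP; exists e => //= N [_ MN].
by apply: eA; split=> // i j; rewrite !mxE; exact: MN.
Qed.

Lemma compact_cV_le n (r : R) : compact [set v : 'cV[R]_n | forall i, `|v i 0| <= r].
Proof.
have -> : [set v : 'cV[R]_n | forall i, `|v i 0| <= r] =
    @trmx R 1 n @` [set v : 'rV[R]_n | forall i, `[- r, r]%classic (v ord0 i)].
  apply/seteqP; split=> [v hv|_ [v hv <-] i]; last first.
    by have := hv i; rewrite /= in_itv /= -ler_norml mxE.
  exists v^T; last by rewrite trmxK.
  by move=> i; rewrite /= in_itv /= -ler_norml mxE.
apply: continuous_compact; last exact: (rV_compact (fun=> @segment_compact R _ _)).
by apply: continuous_subspaceT; exact: trmx_continuous.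
Qed.

(** Only [p] is confined to [K]; [q] ranges over the whole space, since the values of the solutions
    are not confined to any compact set. *)
Lemma compact_unif_continuous (V : pseudoMetricType R) (I : finType) (f : I -> V -> R) (K : set V) (e : R) :
  compact K -> (forall i, continuous (f i)) -> 0 < e ->
  exists2 eta, 0 < eta & forall i p q, K p -> ball p eta q -> `|f i p - f i q| <= e.
Proof.
move=> /compact_near_coveringP cK cf e0.
have e2 : 0 < e / 2 by rewrite divr_gt0.
have : \forall eta \near 0^'+, K `<=` [set p | forall i q, ball p eta q -> `|f i p - f i q| <= e].
  apply: cK => x Kx.
  have : \forall x' \near x, forall i, `|f i x - f i x'| <= e / 2.
    by apply: filter_forall => i; have /cvgrPdist_le/(_ _ e2) := cf i x.
  move=> /nbhs_ballP[r /= r0 hr].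
  have r2 : 0 < r / 2 by rewrite divr_gt0.
  exists (ball x (r / 2), [set eta | 0 < eta < r / 2]) => /=.
    split; first exact: nbhsx_ballx.
    by near=> eta; apply/andP; split; near: eta; [exact: nbhs_right_gt|exact: nbhs_right_lt].
  move=> [x' eta] /= [xx' /andP[eta0 eta1]] i q x'q.
  have h1 : `|f i x - f i x'| <= e / 2.
    by apply: hr; apply: le_ball xx'; rewrite ler_pdivrMr// ler_peMr ?ler1n// ltW.
  have h2 : `|f i x - f i q| <= e / 2.
    apply: hr; rewrite (splitr r); apply: ball_triangle xx' _.
    by apply: le_ball x'q; exact: ltW.
  rewrite (splitr e); apply: le_trans (ler_distD (f i x) _ _) _.
  by rewrite lerD// distrC.
move=> h; have [eta [eta0 heta]] : exists eta, 0 < eta /\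
    K `<=` [set p | forall i q, ball p eta q -> `|f i p - f i q| <= e].
  near (0:R)^'+ => eta; exists eta; split; near: eta => //.
  exact: nbhs_right_gt.
by exists eta => // i p q Kp; exact: heta.
Unshelve. all: by end_near. Qed.

Lemma entry_le_norm2 m n (A : 'M[R]_(m, n)) i j : `|A i j| <= norm2 A.
Proof.
rewrite /norm2 -sqrtr_sqr ler_wsqrtr// /dotv.
rewrite (bigD1 i)//= (bigD1 j)//= expr2 -addrA lerDl addr_ge0//.
  by apply: sumr_ge0 => *; rewrite -expr2 sqr_ge0.
by apply: sumr_ge0 => *; apply: sumr_ge0 => *; rewrite -expr2 sqr_ge0.
Qed.

End compactness.

Section nonlinear_pointwise.
Context {R : realType} (d k l m : nat).
Local Notation W := ('rV[R]_d * 'cV[R]_k * 'cV[R]_l)%type.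
Variable F : 'rV[R]_d -> 'cV[R]_k -> 'cV[R]_l -> 'cV[R]_m.
Hypothesis F1 : class_C1 (fun z : W => F z.1.1 z.1.2 z.2).

Definition l1 n (v : 'cV[R]_n) : R := \sum_i `|v i 0|.

Lemma l1_ge0 n (v : 'cV[R]_n) : 0 <= l1 v.
Proof. by apply: sumr_ge0. Qed.

Lemma coord_le_l1 n (v : 'cV[R]_n) i : `|v i 0| <= l1 v.
Proof. by rewrite /l1 (bigD1 i)//= lerDl sumr_ge0. Qed.

Lemma frame_cV n : frame (fun j => delta_mx j 0 : 'cV[R]_n) (fun j v => v j 0).
Proof.
split.
- by move=> i a u v; rewrite !mxE.
- by move=> i; exact: coord_continuous.
- move=> v; rewrite {1}[v]matrix_sum_delta; apply: eq_bigr => i _.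
  by rewrite big_ord1.
- move=> i v; rewrite [`|v|]mx_normrE.
  exact: (le_bigmax _ (fun ij : 'I_n * 'I_1 => `|v ij.1 ij.2|) (i, 0)).
Qed.

Let dF x Z v : differentiable (F x Z) v.
Proof.
have [dF _] := F1.
apply: (@differentiable_comp _ _ _ _ (fun v : 'cV[R]_l => (x, Z, v) : W)
  (fun z : W => F z.1.1 z.1.2 z.2)); last exact: dF.
rewrite (_ : (fun v => _) = cst ((x, Z, 0) : W) + (fun v => (0, 0, v) : W)); last first.
  by apply/funext => u; congr (_, _, _); rewrite /= ?addr0 ?add0r.
exact: differentiableD.
Qed.

Lemma jacE x Z v i j :
  jac (F x Z) v i j = 'D_((0, 0, delta_mx j 0) : W) (fun z : W => F z.1.1 z.1.2 z.2) (x, Z, v) i 0.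
Proof.
rewrite mxE; congr ((_ : 'cV[R]_m) i 0); apply: derive_val.
apply: (@is_derive_affine _ _ _ _ (fun v : 'cV[R]_l => (x, Z, v) : W)
  (fun z : W => F z.1.1 z.1.2 z.2) v (delta_mx j 0) (0, 0, delta_mx j 0)).
  by move=> h; congr (_, _, _); rewrite /= ?scaler0 ?add0r.
by apply/derivableP/diff_derivable; exact: F1.1.
Qed.

(** Entries of the Jacobian are components of directional derivatives of the joint function, and
    these are what [class_C1] makes continuous. *)
Lemma jac_continuous i j : continuous (fun z : W => jac (F z.1.1 z.1.2) z.2 i j).
Proof.
have -> : (fun z : W => jac (F z.1.1 z.1.2) z.2 i j) =
    (fun z => 'D_((0, 0, delta_mx j 0) : W) (fun z : W => F z.1.1 z.1.2 z.2) z i 0).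
  by apply/funext => -[[x Z] v]; rewrite jacE.
move=> z; have c1 := F1.2 ((0, 0, delta_mx j 0) : W) z.
exact: (continuous_comp c1 (@coord_continuous R m 1 i 0 _)).
Qed.

Lemma line_jac x Z (v : 'cV[R]_l) i (s : R) :
  is_derive s (1 : R) (fun s : R => F x Z (s *: v) i 0)
    (\sum_j jac (F x Z) (s *: v) i j * v j 0).
Proof.
have dFi w : differentiable (fun w => F x Z w i 0) w.
  apply: (@differentiable_comp _ _ _ _ (F x Z) (fun M : 'cV[R]_m => M i 0)).
    exact: dF.
  exact: differentiable_coord.
have <- : 'D_v (fun w => F x Z w i 0) (s *: v) = \sum_j jac (F x Z) (s *: v) i j * v j 0.
  rewrite (derive_frame _ (@frame_cV l))//; apply: eq_bigr => j _.
  rewrite mulrC; congr (_ * _); rewrite mxE derive_mx ?mxE//.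
  exact/diff_derivable/dF.
apply: (@is_derive_affine _ R _ _ (fun s : R => s *: v) (fun w => F x Z w i 0) s 1 v).
  by move=> h; rewrite scalerDl [h *: 1]mulr1.
exact/derivableP/diff_derivable.
Qed.

Hypothesis F0 : forall x Z, F x Z 0 = 0.
Variable c : R.
Hypothesis Fc : forall x Z v, norm2 (jac (F x Z) v) <= c.

Lemma jac_le x Z v i j : `|jac (F x Z) v i j| <= c.
Proof. exact: le_trans (entry_le_norm2 _ i j) (Fc x Z v). Qed.

(** The mean value theorem on the segment from 0 to [e v], one component at a time: [th] depends on
    [i], which is harmless as only its range is used. *)
Lemma mean_value_jac x Z (v : 'cV[R]_l) i (e : R) : 0 < e -> exists2 th, 0 <= th <= 1 &
  e^-1 * F x Z (e *: v) i 0 = \sum_j jac (F x Z) (th *: (e *: v)) i j * v j 0.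
Proof.
move=> e0.
have dl (s : R) := line_jac x Z (e *: v) i s.
have cont : continuous (fun s : R => F x Z (s *: (e *: v)) i 0).
  by move=> s; apply/differentiable_continuous/derivable1_diffP; have [] := dl s.
have [th] := MVT_segment (@ler01 R) (fun s _ => dl s) (continuous_subspaceT cont).
rewrite in_itv /= scale1r scale0r F0 [X in _ - X]mxE !subr0 mulr1 => th01 E.
exists th => //; rewrite E mulr_sumr; apply: eq_bigr => j _.
by rewrite [(e *: v) j 0]mxE mulrCA mulKf ?gt_eqF.
Qed.

Lemma nonlinear_le x Z v i : `|F x Z v i 0| <= c * l1 v.
Proof.
have [th _] := mean_value_jac x Z v i (@ltr01 R).
rewrite invr1 mul1r scale1r => ->.
apply: le_trans (ler_norm_sum _ _ _) _; rewrite /l1 mulr_sumr.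
by apply: ler_sum => j _; rewrite normrM ler_wpM2r// jac_le.
Qed.

(** An inequality in place of almost everywhere convergence, with quotients in the style of
    Chebyshev. If their sum [q] is at least 1, the crude bound [2 c] is below [2 c q]; otherwise the
    base point lies in the compact set [C], the arguments are within [eta] of it, and uniform
    continuity gives [de]. *)
Lemma nonlinear_pointwise (K : set 'rV[R]_d) (de rho : R) :
  compact K -> 0 < de -> 0 < rho -> exists2 eta, 0 < eta &
  forall i x (Z Z0 : 'cV[R]_k) v e, K x -> 0 < e ->
  `|e^-1 * F x Z (e *: v) i 0 - \sum_j jac (F x Z0) 0 i j * v j 0| <=
  (de + 2 * c * (l1 Z0 / rho + l1 (Z - Z0) / eta + l1 (e *: v) / eta)) * l1 v.
Proof.
move=> cK de0 rho0.
pose C : set W := (K `*` [set v : 'cV[R]_k | forall i, `|v i 0| <= rho]) `*` [set 0 : 'cV[R]_l].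
have cC : compact C.
  by apply: compact_setX; [apply: compact_setX => //; exact: compact_cV_le|exact: compact_set1].
have [eta eta0 heta] := compact_unif_continuous cC
  (fun ij : 'I_m * 'I_l => @jac_continuous ij.1 ij.2) de0.
exists eta => // i x Z Z0 v e Kx e0.
have [th /andP[th0 th1] ->] := mean_value_jac x Z v i e0.
rewrite -sumrB; apply: le_trans (ler_norm_sum _ _ _) _.
rewrite [l1 v]/l1 mulr_sumr; apply: ler_sum => j _.
rewrite -mulrBl normrM ler_wpM2r//.
have c0 : 0 <= c by apply: le_trans (jac_le x Z 0 i j).
set q := l1 Z0 / rho + _ + _.
have q1 : 0 <= l1 Z0 / rho by rewrite divr_ge0 ?l1_ge0// ltW.
have q2 : 0 <= l1 (Z - Z0) / eta by rewrite divr_ge0 ?l1_ge0// ltW.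
have q3 : 0 <= l1 (e *: v) / eta by rewrite divr_ge0 ?l1_ge0// ltW.
have [q_ge1|q_lt1] := leP 1 q.
  apply: le_trans (ler_normB _ _) _.
  have := jac_le x Z (th *: (e *: v)) i j; have := jac_le x Z0 0 i j; nra.
have h1 : l1 Z0 <= rho by rewrite -[rho]mul1r -ler_pdivrMr// /q in q_lt1 *; lra.
have h2 : l1 (Z - Z0) < eta by rewrite -[eta]mul1r -ltr_pdivrMr// /q in q_lt1 *; lra.
have h3 : l1 (e *: v) < eta by rewrite -[eta]mul1r -ltr_pdivrMr// /q in q_lt1 *; lra.
apply: le_trans (_ : de <= _); last by rewrite lerDl !mulr_ge0// !addr_ge0.
rewrite distrC; apply: (heta (i, j) (x, Z0, 0) (x, Z, th *: (e *: v))).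
  by split=> //; split=> // i'; exact: le_trans (coord_le_l1 _ _) h1.
split; [split|]; split=> //= i' j'; rewrite ?ord1 /ball /=.
- by rewrite subrr normr0.
- by rewrite distrC; apply: le_lt_trans h2; have := coord_le_l1 (Z - Z0) i'; rewrite !mxE.
- rewrite !mxE sub0r normrN normrM (ger0_norm th0); apply: le_lt_trans h3.
  apply: le_trans (_ : `|(e *: v) i' 0| <= _); last exact: coord_le_l1.
  by rewrite mxE ler_piMl.
Qed.

End nonlinear_pointwise.

(** * Test functions on space-time *)

Section test_functions.
Context {R : realType}.
Variable d : nat.
Local Notation Rd := 'rV[R]_d.
Local Notation ST := (Rd * R)%type.

Lemma wt_continuous : continuous (@wt R d).
Proof.
rewrite /wt; elim: (index_enum 'I_d) => [|j r ih].
  rewrite (_ : (fun x : Rd => _) = cst 1); first exact: cst_continuous.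
  by apply/funext => x; rewrite big_nil.
rewrite (_ : (fun x : Rd => _) =
    (fun x : Rd => (1 + x 0 j * x 0 j) * \prod_(j <- r) (1 + x 0 j ^+ 2))); last first.
  by apply/funext => x; rewrite big_cons expr2.
have c1 : continuous (fun x : Rd => x 0 j) by exact: coord_continuous.
move=> x; have c2 : {for x, continuous (fun x : Rd => 1 + x 0 j * x 0 j)}.
  by apply: continuousD; [exact: cst_continuous|exact: continuousM (c1 x) (c1 x)].
exact: continuousM c2 (ih x).
Qed.

Lemma iter_derive_off (V : normedModType R) (K : set V) (f : V -> R) vs x :
  closed K -> (forall x, ~ K x -> f x = 0) -> ~ K x -> iter_derive vs f x = 0.
Proof.
move=> cK f0; elim: vs x => [|v vs ih] x nKx /=; first exact: f0.
rewrite (near_eq_derive (g := cst 0)) ?derive_cst//.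
have oK : open (~` K) by exact: closed_openC.
by near=> y; apply: ih; near: y; exact: open_nbhs_nbhs.
Unshelve. all: by end_near. Qed.

Lemma test_sch (K : set ST) (f : ST -> R) : compact K -> smooth f ->
  (forall z, ~ K z -> f z = 0) -> sch (fun _ : unit => f).
Proof.
move=> cK sf f0 M vs; split=> [_ x|]; first exact: sf.
have clK : closed K by apply: compact_closed => //; exact: norm_hausdorff.
pose h (z : ST) := wt z.1 ^+ M * iter_derive vs f z.
have ch : continuous h.
  move=> z.
  have c1 : {for z, continuous (fun z : ST => wt z.1)}.
    apply: (continuous_comp (f := fst)); first exact: cvg_fst.
    exact: wt_continuous.
  have c2 : {for z, continuous (fun z : ST => wt z.1 ^+ M)}.
    exact: (continuous_comp c1 (@exprn_continuous R M _)).
  have c3 : {for z, continuous (iter_derive vs f)}.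
    exact/differentiable_continuous/sf.
  exact: continuousM c2 c3.
have /compact_bounded [B [_ hB]] : compact (h @` K).
  by apply: continuous_compact => //; exact: continuous_subspaceT.
exists (Num.max 0 (`|B| + 1)) => _ z; rewrite le_max.
have [Kz|nKz] := pselect (K z); last first.
  by rewrite (iter_derive_off _ clK f0 nKz) normr0 mulr0 lexx.
apply/orP; right.
rewrite -[X in X * _]ger0_norm ?wtX_ge0// -normrM.
by apply: (hB (`|B| + 1)); [rewrite (le_lt_trans (ler_norm _))// ltrDl|exists z].
Qed.

Lemma compact_measurable_ST (K : set ST) : compact K ->
  measurable (K : set (Rd * measurableTypeR R)%type).
Proof.
move=> cK; have clK : closed K by apply: compact_closed => //; exact: norm_hausdorff.
pose A (v : 'rV[R]_(d + 1)) : ST := (lsubmx v, v 0 (rshift d 0)).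
pose B (z : Rd * measurableTypeR R) : 'rV[R]_(d + 1) := row_mx z.1 (z.2%:M : 'M[R]_1).
have mB : measurable_fun setT B.
  apply: measurable_mxP => i j; case: (splitP j) => k jk.
    have -> : j = lshift 1 k by apply/val_inj.
    under eq_fun do rewrite row_mxEl.
    exact: (measurableT_comp (measurable_coord _ _) measurable_fst).
  have -> : j = rshift d k by apply/val_inj.
  under eq_fun do rewrite row_mxEr mxE ord1 (ord1 k) eqxx mulr1n.
  exact: measurable_snd.
have -> : K = B @^-1` (A @^-1` K).
  apply/seteqP; split=> -[x t]; rewrite /preimage /= /A /B row_mxKl row_mxEr mxE eqxx mulr1n//.
rewrite -[X in measurable X]setTI; apply: mB => //.
rewrite -[A @^-1` K]setCK; apply: measurableC; apply: open_measurable_mx.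
have /continuousP cA := @rVuncons_continuous R d.
exact: (cA _ (closed_openC clK)).
Qed.

Lemma slab_measurable T : measurable (slab T : set (Rd * measurableTypeR R)%type).
Proof.
rewrite (_ : slab T = snd @^-1` `[0, T]%classic); last first.
  by apply/seteqP; split=> z; rewrite /slab /preimage /= in_itv.
by rewrite -[X in measurable X]setTI; apply: measurable_snd => //; exact: measurable_itv.
Qed.

Variable T : R.
Local Notation mu := (lebST R d).

(** A Schwartz family restricted to the slab is dominated by a multiple of this one function, so its
    $L^2$ norms are bounded uniformly in the index. *)
Let base (z : Rd * measurableTypeR R) : R := \1_(slab T) z * (wt z.1)^-1.

Lemma base_L2T : L2T mu base.
Proof.
have E : base = fun z => (wt z.1)^-1 * \1_`[0, T]%classic z.2.
  apply/funext => z; rewrite /base mulrC !indicE.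
  have -> : (z \in slab T) = (z.2 \in `[0, T]%classic).
    by apply/idP/idP; rewrite !inE /slab /= ?in_itv.
  by [].
have iI : (@lebesgue_measure R).-integrable setT (EFin \o \1_`[0, T]%classic).
  exact: integrable_indic_itv.
have ib : mu.-integrable setT (EFin \o base).
  by rewrite E; exact: (integrable_prod_mul (integrable_wtV d) iI).
have mb : measurable_fun setT base by apply/measurable_EFinP; exact: measurable_int ib.
split=> //; apply: (@integrable_le _ _ _ mu setT _ base) => //; first exact: measurable_funX.
move=> z _; have b0 : 0 <= base z <= 1.
  rewrite /base indicE; case: (_ \in _); rewrite ?mul0r ?lexx ?ler01// mul1r.
  by rewrite ltW ?wtV_gt0//= invf_le1 ?wt_gt0// wt_ge1.
rewrite ger0_norm ?sqr_ge0//; case/andP: b0 => b0 b1; rewrite expr2.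
exact: ler_piMl.
Qed.

Lemma sch_slab I (f : I -> ST -> R) : sch f ->
  (forall i, L2T mu (fun z => \1_(slab T) z * f i z)) /\
  exists C : R, forall i, nrm mu (fun z => \1_(slab T) z * f i z) <= C.
Proof.
move=> hf; have [_ [C hC]] := BC_BC0 (hf 1%N).
have b1 := L2TZ `|C| base_L2T.
have le i z : `|\1_(slab T) z * f i z| <= `|C| * base z.
  rewrite /base mulrCA normrM ger0_norm ?indicE// ler_wpM2l//.
  rewrite ler_pdivlMr ?wt_gt0// mulrC; have := hC i z; rewrite expr1 => /le_trans; apply.
  exact: ler_norm.
have h i : L2T mu (fun z => \1_(slab T) z * f i z).
  apply: L2T_le b1 (le i); apply: measurable_funM.
    by apply: measurable_indic; exact: slab_measurable.
  by apply: continuous_measurable_ST; apply: smooth_continuous; exact: BC_smooth (hf 0%N).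
split=> //; exists (`|C| * nrm mu base) => i; apply: le_trans (nrm_le (h i) b1 (le i)) _.
by rewrite nrmZ ?normr_id//; exact: base_L2T.
Qed.

Lemma vsch_slab n I (f : I -> ST -> 'cV[R]_n) : vsch f ->
  (forall i, vL2 mu (cut (slab T) (f i))) /\
  exists C : R, forall i, vn mu (cut (slab T) (f i)) <= C.
Proof.
move=> hf; have E i j : (fun z => cut (slab T) (f i) z j 0) = (fun z => \1_(slab T) z * f i z j 0).
  by apply/funext => z; rewrite cutE.
split=> [i j|]; first by rewrite E; exact: (sch_slab (hf j)).1.
have /choice[C hC] : forall j, exists C : R, forall i, nrm mu (fun z => \1_(slab T) z * f i z j 0) <= C.
  by move=> j; exact: (sch_slab (hf j)).2.
exists (\sum_j C j) => i; apply: ler_sum => j _; rewrite E; exact: hC.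
Qed.

Lemma sch_slice n I (f : I -> ST -> 'cV[R]_n) t : vsch f ->
  (forall i, vL2 (leb R d) (fun x => f i (x, t))) /\
  exists C : R, forall i, vn (leb R d) (fun x => f i (x, t)) <= C.
Proof.
move=> hf.
have wL : L2T (leb R d) (fun x : Rd => (wt x)^-1).
  have mw : measurable_fun setT (fun x : Rd => (wt x)^-1).
    by apply/measurable_EFinP; exact: measurable_int (integrable_wtV d).
  split=> //; apply: (@integrable_le _ _ _ (leb R d) setT _ (fun x => (wt x)^-1)) => //.
  - exact: measurable_funX.
  - move=> x _; rewrite ger0_norm ?sqr_ge0// expr2 ler_piMl ?(ltW (wtV_gt0 _))//.
    by rewrite invf_le1 ?wt_gt0// wt_ge1.
  - exact: integrable_wtV.
have /choice[C hC] : forall j, exists C : R, 0 <= C /\ forall i x, `|f i (x, t) j 0| <= C * (wt x)^-1.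
  move=> j; have [_ [C hC]] := BC_BC0 (hf j 1%N); exists `|C|; split=> // i x.
  rewrite ler_pdivlMr ?wt_gt0// mulrC; have := hC i (x, t); rewrite expr1 => /le_trans; apply.
  exact: ler_norm.
have h i : vL2 (leb R d) (fun x => f i (x, t)).
  move=> j; apply: L2T_le (L2TZ (C j) wL) ((hC j).2 i).
  apply: continuous_measurable_mx => x.
  apply: (continuous_comp (f := fun x => (x, t)) (g := fun z => f i z j 0)).
    by apply: continuous_pair => ?; [exact: cvg_id|exact: cst_continuous].
  by apply: smooth_continuous; exact: BC_smooth (hf j 0%N).
split=> //; exists (\sum_j C j * nrm (leb R d) (fun x : Rd => (wt x)^-1)) => i.
apply: ler_sum => j _; apply: le_trans (nrm_le (h i j) (L2TZ (C j) wL) ((hC j).2 i)) _.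
by rewrite nrmZ// ger0_norm ?(hC j).1.
Qed.

End test_functions.

(** * Antiderivatives in time *)

Section time_primitive.
Context {R : realType}.
Variable d : nat.
Local Notation Rd := 'rV[R]_d.
Local Notation ST := (Rd * R)%type.
Variable T : R.
Hypothesis T0 : 0 < T.

Let ind (s : R) : R := \1_`[0, T]%classic s.

Let shift_int (f : ST -> R) (s : R) (z : ST) : R := ind s * f (z.1, z.2 + s).

(** With a fixed domain of integration all derivatives pass under the integral. If [f] is supported
    in times between 0 and [T], then for [t >= 0] this is the integral of [f] over times from [t] to
    [T], and it vanishes for [|t| > T]. *)
Definition time_prim (f : ST -> R) (z : ST) : R :=
  \int[@lebesgue_measure R]_s shift_int f s z.

Let ind_ge0 s : 0 <= ind s.
Proof. by rewrite /ind indicE; case: (_ \in _). Qed.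

Let ind_integrable : (@lebesgue_measure R).-integrable setT (EFin \o ind).
Proof. exact: integrable_indic_itv. Qed.

Let shift_continuous (z : ST) : continuous (fun s : R => (z.1, z.2 + s)).
Proof.
have h (a : R) : continuous (fun s : R => a + s).
  by move=> s; apply: continuousD; [exact: cst_continuous|exact: cvg_id].
by apply: continuous_pair => //; exact: cst_continuous.
Qed.

Let sch_bounded I (f : I -> ST -> R) M : sch f ->
  exists2 C : R, 0 <= C & forall i z, wt z.1 ^+ M * `|f i z| <= C.
Proof.
move=> hf; have [_ [C hC]] := BC_BC0 (hf M); exists `|C| => // i z.
exact: le_trans (hC i z) (ler_norm C).
Qed.

Let shift_integrable I (f : I -> ST -> R) i z : sch f ->
  (@lebesgue_measure R).-integrable setT (EFin \o (fun s => shift_int (f i) s z)).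
Proof.
move=> hf; have [C C0 hC] := sch_bounded 0 hf.
apply: (@integrable_le _ _ _ (@lebesgue_measure R) setT (fun s => shift_int (f i) s z) (fun s => C * ind s)) => //.
- apply: measurable_funM; first by apply: measurable_indic; exact: measurable_itv.
  apply: continuous_measurable_fun => s.
  apply: (continuous_comp (f := fun s : R => (z.1, z.2 + s))).
    exact: shift_continuous.
  by apply: smooth_continuous; exact: BC_smooth (hf 0%N).
- move=> s _; rewrite /shift_int normrM ger0_norm// mulrC ler_wpM2r//.
  by have := hC i (z.1, z.2 + s); rewrite expr0 mul1r.
- exact: (integrableZl measurableT C ind_integrable).
Qed.

Let shift_derive (f : ST -> R) s z v : smooth f ->
  is_derive z v (shift_int f s) (shift_int ('D_v f) s z).
Proof.
move=> sf.
have D : is_derive z v (f \o (fun z : ST => (z.1, z.2 + s))) ('D_v f (z.1, z.2 + s)).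
  apply: (@is_derive_affine _ _ _ _ (fun z : ST => (z.1, z.2 + s)) f z v v).
    by move=> h; congr (_, _); rewrite /= addrA.
  exact/derivableP/diff_derivable/smooth_differentiable.
by apply: is_deriveZ.
Qed.

Let shift_smooth (f : ST -> R) s : smooth f -> smooth (shift_int f s).
Proof.
move=> sf; apply: (@BC_smooth _ _ unit (cst 0) (fun=> shift_int f s) tt).
apply: (@BC_coind _ _ unit (cst 0) (fun g => exists2 f, smooth f & g = fun=> shift_int f s)).
- move=> _ [g sg ->]; split=> [_ z|]; last by exists 0 => _ x; rewrite mul0r.
  apply: differentiableM => //.
  apply: (@differentiable_comp _ _ _ _ (fun z : ST => (z.1, z.2 + s)) g).
    rewrite (_ : (fun z : ST => _) = id + cst ((0, s) : ST)).
      exact: differentiableD.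
    by apply/funext => -[x t]; congr (_, _); rewrite /= addr0.
  exact: smooth_differentiable.
- move=> _ v [g sg ->]; exists ('D_v g); first exact: smooth_derive.
  by apply/funext => _; apply/funext => z; apply: derive_val; exact: shift_derive.
- by exists f.
Qed.

Let e (i : 'I_d + unit) : ST :=
  match i with inl i => (basis_vec R i, 0) | inr _ => (0, 1) end.

Let fr : frame e _ := frame_prod (@frame_rV R d) (@frame_R R).

Lemma derive_time_prim I (f : I -> ST -> R) i z : sch f ->
  differentiable (time_prim (f i)) z /\
  forall v, 'D_v (time_prim (f i)) z = time_prim ('D_v (f i)) z.
Proof.
move=> hf; have sf : smooth (f i) by exact: BC_smooth (hf 0%N).
have schD v : sch (fun i => 'D_v (f i)) by move=> M; exact: BC_derive.
have E v s y : 'D_v (shift_int (f i) s) y = shift_int ('D_v (f i)) s y.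
  by apply: derive_val; exact: shift_derive.
have E2 v w s y : 'D_w ('D_v (shift_int (f i) s)) y = shift_int ('D_w ('D_v (f i))) s y.
  have -> : 'D_v (shift_int (f i) s) = shift_int ('D_v (f i)) s by exact/funext.
  by apply: derive_val; exact/shift_derive/smooth_derive.
have /choice[C hC] : forall pq : ('I_d + unit) * ('I_d + unit), exists C : R, forall y,
    `|'D_(e pq.2) ('D_(e pq.1) (f i)) y| <= C.
  move=> pq; have [C _ hC] := sch_bounded 0 (fun M => BC_derive (e pq.2) (schD (e pq.1) M)).
  by exists C => y; have := hC i y; rewrite expr0 mul1r.
have C0 pq : 0 <= C pq by apply: le_trans (hC pq 0).
have [] := @derive_under_integral _ _ _ _ (@lebesgue_measure R) _ _ _
  (shift_int (f i)) z (fun s => (\sum_pq C pq) * ind s) fr.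
- by move=> s; exact: shift_smooth.
- by move=> y _; exact: shift_integrable hf.
- move=> j; have := @shift_integrable I _ i z (schD (e j)).
  by congr (_.-integrable _ _); apply/funext => s /=; rewrite E.
- exact: (integrableZl measurableT _ ind_integrable).
- move=> p q s y _; rewrite E2 /shift_int normrM ger0_norm// mulrC ler_wpM2r//.
  apply: le_trans (hC (p, q) _) _; rewrite (bigD1 (p, q))//= lerDl sumr_ge0//.
move=> dJ DJ; split=> // v; rewrite DJ; apply: eq_Rintegral => s _; exact: E.
Qed.

Lemma sch_time_prim I (f : I -> ST -> R) : sch f -> sch (fun i => time_prim (f i)).
Proof.
move=> hf M; apply: (@BC_coind _ _ I _ (fun g => exists2 f, sch f & g = fun i => time_prim (f i))).
- move=> _ [g hg ->]; split=> [i z|]; first exact: (derive_time_prim i z hg).1.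
  have [C C0 hC] := sch_bounded M hg.
  exists (C * \int[@lebesgue_measure R]_s ind s) => i z.
  have w0 : 0 < wt z.1 ^+ M by rewrite exprn_gt0// wt_gt0.
  rewrite mulrC -ler_pdivlMr// mulrAC -RintegralZl//.
  apply: integrable_normr_le => //.
  + by apply/measurable_EFinP; exact: measurable_int (shift_integrable i z hg).
  + move=> s _; rewrite /shift_int normrM ger0_norm// mulrC ler_wpM2r//.
    by rewrite ler_pdivlMr// mulrC; exact: hC i (z.1, z.2 + s).
  + exact: (integrableZl measurableT _ ind_integrable).
- move=> _ v [g hg ->]; exists (fun i => 'D_v (g i)); first by move=> M'; exact: BC_derive.
  by apply/funext => i; apply/funext => z; exact: (derive_time_prim i z hg).2.
- by exists f.
Qed.

Lemma time_prim_FTC (f : ST -> R) (z : ST) : sch (fun _ : unit => f) ->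
  'D_(0, 1) (time_prim f) z = f (z.1, z.2 + T) - f z.
Proof.
move=> hf; rewrite ((derive_time_prim tt z hf).2 (0, 1)).
have sf : smooth f by exact: (@BC_smooth _ _ unit _ (fun=> f) tt (hf 0%N)).
pose g s := f (z.1, z.2 + s); pose g' s := 'D_((0, 1) : ST) f (z.1, z.2 + s).
have dg (s : R) : is_derive s (1 : R) g (g' s).
  apply: (@is_derive_affine _ R _ _ (fun s : R => (z.1, z.2 + s)) f s 1 (0, 1)).
    by move=> h; congr (_, _); rewrite /= ?scaler0 ?add0r// addrCA.
  exact/derivableP/diff_derivable/smooth_differentiable.
have cg : continuous g.
  by move=> s; apply/differentiable_continuous/derivable1_diffP; have [] := dg s.
have cg' : continuous g'.
  move=> s; have c1 := smooth_continuous (smooth_derive ((0, 1) : ST) sf).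
  exact: (continuous_comp (@shift_continuous z s) (c1 _)).
rewrite /time_prim /Rintegral.
have -> : (\int[@lebesgue_measure R]_s (shift_int ('D_(0, 1) f) s z)%:E)%E =
   (\int[@lebesgue_measure R]_(s in `[0%R, T]) (g' s)%:E)%E.
  rewrite [RHS]integral_mkcond; apply: eq_integral => s _.
  by rewrite patchE /shift_int /ind indicE; case: ifP; rewrite ?mul1r ?mul0r.
rewrite (@continuous_FTC2 _ _ g)//.
- by rewrite /g /= addr0 -surjective_pairing.
- exact: continuous_subspaceT.
- split; [|exact/cvg_at_right_filter/cg|exact/cvg_at_left_filter/cg].
  by move=> s _; have [] := dg s.
- by move=> s _; rewrite derive1E; have [_ ->] := dg s.
Qed.

Lemma time_prim0 (f : ST -> R) z : (forall s, 0 <= s <= T -> f (z.1, z.2 + s) = 0) ->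
  time_prim f z = 0.
Proof.
move=> h; rewrite /time_prim (_ : (fun s => _) = cst 0) ?Rintegral_cst ?mul0r//.
apply/funext => s; rewrite /shift_int /ind indicE; case: (boolP (_ \in _)) => [|_].
  by rewrite inE /= in_itv /= => s0; rewrite h// mulr0.
by rewrite mul0r.
Qed.

End time_primitive.

(** * Dilated cutoffs *)

Section cutoff.
Context {R : realType}.
Variable d : nat.
Local Notation Rd := 'rV[R]_d.
Local Notation ST := (Rd * R)%type.
Variable chi : Rd -> R.
Hypothesis chi1 : chi 0 = 1.
Hypothesis chiB : BC (cst 1) (fun _ : unit => chi).

Definition tail (r : nat) (x : Rd) : R := 1 - chi (r.+1%:R^-1 *: x).

Let wtV_le1 (x : Rd) : 0 <= (wt x)^-1 <= 1.
Proof. by rewrite ltW ?wtV_gt0//= invf_le1 ?wt_gt0// wt_ge1. Qed.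

Let inv_le1 (r : nat) : `|r.+1%:R^-1 : R| <= 1.
Proof. by rewrite ger0_norm// invf_le1 ?ltr0Sn// ler1n. Qed.

(** The factor [r + 1] records the gain. At order zero, [chi 0 = 1] and the mean value theorem make
    [tail r x] of size $|x|/(r+1)$, a growth that the weight absorbs; each derivative brings out
    [1 / (r + 1)]. The cutoff needs no plateau around the origin. *)
Lemma tail_BC : BC (fun x : Rd => (wt x)^-1) (fun (r : nat) x => r.+1%:R * tail r x).
Proof.
have schi : smooth chi by exact: (BC_smooth tt chiB).
have dtail r x v : is_derive x v (fun x => r.+1%:R * tail r x)
    (- ('D_v chi (r.+1%:R^-1 *: x))).
  have D : is_derive x v (chi \o (fun y : Rd => r.+1%:R^-1 *: y))
      ('D_(r.+1%:R^-1 *: v) chi (r.+1%:R^-1 *: x)).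
    apply: (@is_derive_affine _ _ _ _ (fun y : Rd => r.+1%:R^-1 *: y) chi x v (r.+1%:R^-1 *: v)).
      by move=> h; rewrite scalerDr !scalerA mulrC.
    exact/derivableP/diff_derivable/smooth_differentiable.
  have E : - 'D_v chi (r.+1%:R^-1 *: x) =
      r.+1%:R *: (0 - 'D_(r.+1%:R^-1 *: v) chi (r.+1%:R^-1 *: x)).
    rewrite sub0r [in RHS]deriveE; last exact: smooth_differentiable.
    rewrite linearZ /= -deriveE; last exact: smooth_differentiable.
    by rewrite scalerN scalerA mulfV ?scale1r.
  rewrite E; apply: is_deriveZ; apply: is_deriveB.
apply: BC_coindS.
  split=> [r x|].
    apply/differentiableM => //; apply: differentiableB => //.
    apply: (@differentiable_comp _ _ _ _ (fun y : Rd => r.+1%:R^-1 *: y) chi).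
      exact: differentiableZ.
    exact: smooth_differentiable.
  have /choice[C hC] : forall j, exists C : R, forall x, `|'D_(basis_vec R j) chi x| <= C.
    move=> j; have [_ [C hC]] := BC_BC0 (BC_derive (basis_vec R j) chiB).
    by exists C => x; have := hC tt x; rewrite mul1r.
  exists (\sum_j C j) => r x.
  have line (s : R) : is_derive s (1 : R) (fun s : R => chi (s *: (r.+1%:R^-1 *: x)))
      ('D_(r.+1%:R^-1 *: x) chi (s *: (r.+1%:R^-1 *: x))).
    apply: (@is_derive_affine _ R _ _ (fun s : R => s *: (r.+1%:R^-1 *: x)) chi s 1).
      by move=> h; rewrite scalerDl [h *: 1]mulr1.
    exact/derivableP/diff_derivable/smooth_differentiable.
  have cl : continuous (fun s : R => chi (s *: (r.+1%:R^-1 *: x))).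
    by move=> s; apply/differentiable_continuous/derivable1_diffP; have [] := line s.
  have [s _] := MVT_segment (@ler01 R) (fun s _ => line s) (continuous_subspaceT cl).
  rewrite scale1r scale0r chi1 subr0 mulr1 => E.
  rewrite mulrC ler_pdivrMr ?wt_gt0// /tail normrM ger0_norm// distrC E.
  rewrite (derive_frame _ (@frame_rV R d)); last exact: smooth_differentiable.
  rewrite -[X in X * _ <= _]ger0_norm// -normrM mulr_sumr.
  apply: le_trans (ler_norm_sum _ _ _) _; rewrite mulr_suml; apply: ler_sum => j _.
  rewrite mxE mulrA mulrA mulfV// mul1r normrM mulrC.
  by apply: ler_pM => //; exact: coord_le_wt.
move=> v.
apply: (@BC_ext _ _ _ _ (fun r x => (-1) * 'D_v chi (r.+1%:R^-1 *: x))).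
  by move=> r x; rewrite mulN1r; apply/esym/derive_val.
apply: (@BCZ _ _ _ _ (fun=> -1) _ 1); first by move=> x; case/andP: (wtV_le1 x).
  by move=> _; rewrite normrN normr1.
have := @BC_dilation _ _ nat _ (fun r => r.+1%:R^-1) inv_le1 (BC_derive v chiB).
by apply: (@BC_weight _ _ _ _ _ _ 1) => // x; rewrite mul1r; case/andP: (wtV_le1 x).
Qed.

End cutoff.

(** * Passage to the limit in products *)

Section L2_vector_limits.
Context d (T : measurableType d) {R : realType} (mu : {measure set T -> \bar R}).

Lemma pairing_cut n (S : set T) (u v : T -> 'cV[R]_n) : measurable S ->
  vL2 mu (cut S u) -> vL2 mu (cut S v) ->
  \int[mu]_(z in S) dotv (u z) (v z) = vip mu (cut S u) (cut S v).
Proof.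
move=> mS hu hv; rewrite -pairing_vip//.
by apply: eq_Rintegral => z zS; rewrite /cut indicE zS scale1r.
Qed.

Lemma L2_subset n (K S : set T) (u : T -> 'cV[R]_n) : measurable K -> measurable S ->
  K `<=` S -> L2 mu S u -> L2 mu K u.
Proof.
move=> mK mS KS hu i j; have [m iu] := hu i j; split; first exact: measurable_funS m.
apply: le_lt_trans iu; apply: ge0_subset_integral => //.
- by apply/measurable_EFinP/measurable_funX.
- by move=> z _; rewrite lee_fin sqr_ge0.
Qed.

Lemma L2_cut n (S : set T) (u : T -> 'cV[R]_n) : measurable S -> vL2 mu (cut S u) -> L2 mu S u.
Proof.
move=> mS /(L2_vL2 mS) h i j; have [m iu] := h i j.
have E z : z \in S -> cut S u z i j = u z i j.
  by move=> zS; rewrite /cut indicE zS scale1r.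
split; first by apply: (eq_measurable_fun _ _ m) => z zS; rewrite E.
by under eq_integral => z zS do rewrite -E//.
Qed.

Lemma cutB n (S : set T) (u v : T -> 'cV[R]_n) :
  cut S (fun z => u z - v z) = fun z => cut S u z - cut S v z.
Proof. by apply/funext => z; rewrite /cut scalerBr. Qed.

Lemma cutZ n (S : set T) a (u : T -> 'cV[R]_n) :
  cut S (fun z => a *: u z) = fun z => a *: cut S u z.
Proof. by apply/funext => z; rewrite /cut !scalerA mulrC. Qed.

Lemma L2B n (S : set T) (u v : T -> 'cV[R]_n) : measurable S ->
  L2 mu S u -> L2 mu S v -> L2 mu S (fun z => u z - v z).
Proof.
by move=> mS hu hv; apply: L2_cut => //; rewrite cutB; apply: vL2B; exact: vL2_cut.
Qed.

Lemma L2Z n (S : set T) a (u : T -> 'cV[R]_n) : measurable S ->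
  L2 mu S u -> L2 mu S (fun z => a *: u z).
Proof. by move=> mS hu; apply: L2_cut => //; rewrite cutZ; apply: vL2Z; exact: vL2_cut. Qed.

Lemma L2_le n (S : set T) (u : T -> 'cV[R]_n) (g : T -> R) : measurable S ->
  (forall i, measurable_fun S (fun z => u z i 0)) -> L2T mu g ->
  (forall z i, S z -> `|u z i 0| <= g z) -> L2 mu S u.
Proof.
move=> mS mu_ hg ug; apply: L2_cut => // i; apply: (L2T_le _ (L2T_norm hg)).
  have -> : (fun z => cut S u z i 0) = (fun z => u z i 0) \_ S.
    by apply/funext => z; rewrite cutE patchE indicE; case: ifP; rewrite ?mul1r ?mul0r.
  by apply/(measurable_restrict _ mS measurableT); rewrite setTI.
move=> z; rewrite cutE indicE; case: (boolP (z \in S)) => zS; last by rewrite mul0r normr0.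
by rewrite mul1r (le_trans (ug z i (set_mem zS)))// ler_norm.
Qed.

Lemma vn_cut_cvg0 n (K : set T) (w : nat -> T -> 'cV[R]_n) : measurable K ->
  (forall h, L2 mu K (w h)) -> L2norm_sq mu K (w h) @[h --> \oo] --> 0%E ->
  vn mu (cut K (w h)) @[h --> \oo] --> 0.
Proof.
move=> mK hw /fine_cvgP[fin cv]; apply/cvgrPdist_le => e e0.
pose e' := e / n.+1%:R.
have e'0 : 0 < e' by rewrite divr_gt0.
have /cvgrPdist_lt/(_ _ (exprn_gt0 2 e'0)) cv' := cv.
near=> h.
rewrite sub0r normrN ger0_norm ?vn_ge0//.
apply: le_trans (_ : \sum_(j < n) e' <= _); last first.
  rewrite sumr_const card_ord -mulr_natl /e' mulrCA ler_piMr ?(ltW e0)//.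
  by rewrite ler_pdivrMr// mul1r ler_nat.
apply: ler_sum => j _.
have h1 := nrm_L2norm_sq j mK (hw h).
have h2 : L2norm_sq mu K (w h) \is a fin_num by near: h.
have h3 : fine (L2norm_sq mu K (w h)) < e' ^+ 2.
  have : `|0 - fine (L2norm_sq mu K (w h))| < e' ^+ 2 by near: h.
  by rewrite sub0r normrN => /(le_lt_trans (ler_norm _)).
rewrite -(fineK h2) lee_fin in h1.
rewrite -(@ler_pXn2r _ 2) ?nnegrE ?nrm_ge0 ?(ltW e'0)//.
exact: le_trans h1 (ltW h3).
Unshelve. all: by end_near. Qed.

(** Scalar uniform boundedness for each component: test vectors with a single nonzero entry isolate
    the component, and convergent sequences of products are bounded. *)
Lemma vn_weak_bounded n (S : set T) (u : nat -> T -> 'cV[R]_n) (u0 : T -> 'cV[R]_n) :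
  measurable S -> (forall h, L2 mu S (u h)) ->
  (forall g : T -> 'cV[R]_n, L2 mu S g ->
    \int[mu]_(z in S) dotv (u h z) (g z) @[h --> \oo] --> \int[mu]_(z in S) dotv (u0 z) (g z)) ->
  exists B : R, forall h, vn mu (cut S (u h)) <= B.
Proof.
move=> mS hu hw.
have hcu h : vL2 mu (cut S (u h)) by exact: vL2_cut.
have /choice[B hB] : forall j, exists B : R, forall h, nrm mu (fun z => cut S (u h) z j 0) <= B.
  move=> j; apply: L2_banach_steinhaus => [h|g hg]; first exact: hcu.
  pose G z : 'cV[R]_n := \col_i (if i == j then g z else 0).
  have hG : vL2 mu G.
    move=> i; under eq_fun do rewrite mxE.
    by case: eqP => _; [exact: hg|exact: L2T0].
  have := hw G (L2_vL2 mS hG) => cv.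
  have /cvg_seq_bounded[B [_ hB]] : cvgn (fun h => \int[mu]_(z in S) dotv (u h z) (G z)).
    by apply/cvg_ex; eexists; exact: cv.
  exists (`|B| + 1) => h.
  have := hB (`|B| + 1) _ h I; rewrite (le_lt_trans (ler_norm _)) ?ltrDl// => /(_ isT).
  rewrite /= (@pairing_vip _ _ _ mu n S (u h) G mS (hcu h) hG).
  rewrite /vip (bigD1 j)//= big1 ?addr0; last first.
    move=> i ij; rewrite /ip (_ : (fun z => _) = cst 0) ?Rintegral_cst ?mul0r//.
    by apply/funext => z; rewrite [G z i 0]mxE (negbTE ij) mulr0.
  by congr (`|ip _ _ _| <= _); apply/funext => z; rewrite mxE eqxx.
exists (\sum_j B j) => h; apply: ler_sum => j _; exact: hB.
Qed.

Lemma L2T_l1 n (u : T -> 'cV[R]_n) : vL2 mu u -> L2T mu (fun z => l1 (u z)).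
Proof. by move=> hu; apply: L2T_sum => i; apply: L2T_norm; exact: hu. Qed.

Lemma nrm_l1 n (u : T -> 'cV[R]_n) : vL2 mu u -> nrm mu (fun z => l1 (u z)) <= vn mu u.
Proof.
move=> hu; apply: le_trans (nrm_sum _ _) _; first by move=> i; apply: L2T_norm; exact: hu.
by apply: ler_sum => i _; rewrite nrm_norm.
Qed.

Lemma vip_le_nrm n (u v : T -> 'cV[R]_n) (g h : T -> R) : vL2 mu u -> vL2 mu v ->
  L2T mu g -> L2T mu h -> (forall z, \sum_i `|u z i 0 * v z i 0| <= g z * h z) ->
  `|vip mu u v| <= nrm mu g * nrm mu h.
Proof.
move=> hu hv hg hh le_.
have T1 : cut setT u = u by apply/funext => z; rewrite /cut indicT scale1r.
rewrite -T1 -pairing_vip ?T1//; apply: le_trans (_ : ip mu g h <= _); last first.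
  exact: le_trans (ler_norm _) (cauchy_schwarz hg hh).
apply: integrable_normr_le => //.
- under eq_fun do rewrite dotv_cV.
  by apply: measurable_sum => i; apply: measurable_funM; [exact: (hu i).1|exact: (hv i).1].
- by move=> z _; rewrite dotv_cV (le_trans (ler_norm_sum _ _ _)).
- exact: L2T_mul.
Qed.

End L2_vector_limits.

Section space_time.
Context {R : realType} (d : nat).
Local Notation Rd := 'rV[R]_d.
Local Notation ST := (Rd * R)%type.
Local Notation mu := (lebST R d).

Lemma pairing_supp n (A B : set ST) (u phi : ST -> 'cV[R]_n) :
  (forall z, A z -> ~ B z -> phi z = 0) -> (forall z, B z -> ~ A z -> phi z = 0) ->
  pairing A u phi = pairing B u phi.
Proof.
move=> h1 h2; rewrite /pairing Rintegral_mkcond [RHS]Rintegral_mkcond.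
have dot0 z : phi z = 0 -> dotv (u z) (phi z) = 0.
  by move=> ->; rewrite /dotv big1// => i _; rewrite big1// => j _; rewrite mxE mulr0.
apply: eq_Rintegral => z _; rewrite !patchE.
case: (boolP (z \in A)) => zA; case: (boolP (z \in B)) => zB //.
  apply: dot0; apply: h1; first exact: set_mem.
  by move=> /mem_set; rewrite (negbTE zB).
apply/esym/dot0; apply: h2; first exact: set_mem.
by move=> /mem_set; rewrite (negbTE zA).
Qed.

(** The three arguments are packed into a single row, where continuous functions are known to be
    measurable. *)
Lemma measurable_comp3 k l (f : (Rd * 'cV[R]_k * 'cV[R]_l)%type -> R)
    (D : set (Rd * measurableTypeR R)) (u : ST -> 'cV[R]_k) (v : ST -> 'cV[R]_l) :
  measurable D -> continuous f ->
  (forall i j, measurable_fun D (fun z => u z i j)) ->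
  (forall i j, measurable_fun D (fun z => v z i j)) ->
  measurable_fun D (fun z => f (z.1, u z, v z)).
Proof.
move=> mD cf mu_ mv.
pose A (w : 'rV[R]_(d + k + l)) : (Rd * 'cV[R]_k * 'cV[R]_l)%type :=
  (lsubmx (lsubmx w), (rsubmx (lsubmx w))^T, (rsubmx w)^T).
pose B (z : Rd * measurableTypeR R) : 'rV[R]_(d + k + l) := row_mx (row_mx z.1 (u z)^T) (v z)^T.
have E : (fun z => f (z.1, u z, v z)) = (fun z => (f \o A) (B z)).
  by apply/funext => z; rewrite /= /A /B !(row_mxKl, row_mxKr) !trmxK.
rewrite E; apply: measurable_comp_mx => //.
  have cl p q : continuous (fun w : 'rV[R]_(p + q) => lsubmx w).
    by move=> w; exact/differentiable_continuous/differentiable_lsubmx.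
  have cr p q : continuous (fun w : 'rV[R]_(p + q) => rsubmx w).
    by move=> w; exact/differentiable_continuous/differentiable_rsubmx.
  have c2 : continuous (fun w : 'rV[R]_(d + k + l) => (rsubmx (lsubmx w))^T : 'cV[R]_k).
    move=> w; apply: (continuous_comp (f := fun w : 'rV[R]_(d + k + l) => rsubmx (lsubmx w))).
      by apply: (continuous_comp (@cl (d + k)%N l w)); exact: cr.
    exact: trmx_continuous.
  have c3 : continuous (fun w : 'rV[R]_(d + k + l) => (rsubmx w)^T : 'cV[R]_l).
    by move=> w; apply: (continuous_comp (@cr (d + k)%N l w)); exact: trmx_continuous.
  have c1 : continuous (fun w : 'rV[R]_(d + k + l) => lsubmx (lsubmx w) : 'rV[R]_d).
    by move=> w; apply: (continuous_comp (@cl (d + k)%N l w)); exact: cl.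
  have cA : continuous A by exact: continuous_pair (continuous_pair c1 c2) c3.
  by move=> w; apply: (continuous_comp (cA w)); exact: cf.
move=> i j; rewrite /B; case: (splitP j) => [j1|j2] e; last first.
  have -> : j = rshift (d + k) j2 by apply/val_inj.
  by under eq_fun do rewrite row_mxEr mxE; exact: mv.
have -> : j = lshift l j1 by apply/val_inj.
under eq_fun do rewrite row_mxEl.
case: (splitP j1) => [j3|j4] e'.
  have -> : j1 = lshift k j3 by apply/val_inj.
  under eq_fun do rewrite row_mxEl.
  apply: measurable_funTS.
  exact: (measurableT_comp (measurable_coord _ _) measurable_fst).
have -> : j1 = rshift d j4 by apply/val_inj.
by under eq_fun do rewrite row_mxEr mxE; exact: mu_.
Qed.

(** Since [u] is real, each complex equation turns into a pair of real ones. *)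
Lemma OP_pairingE k l (A : set ST) (P : symbol R d k l) (u : ST -> 'cV[R]_l) (phi : ST -> 'cV[R]_k) :
  OP_pairing A P u phi = pairing A u (ReOPtr P phi) +i* pairing A u (ImOPtr P phi).
Proof.
rewrite /OP_pairing /cintegral /pairing; congr (_ +i* _); apply: eq_Rintegral => z _;
  rewrite dotv_cV /cdot ?Re_sum ?Im_sum; apply: eq_bigr => j _.
  by rewrite /toC [in LHS]mxE /ReOPtr [in RHS]mxE; case: (OPtr _ _ _ _ _) => a b /=; ring.
by rewrite /toC [in LHS]mxE /ImOPtr [in RHS]mxE; case: (OPtr _ _ _ _ _) => a b /=; ring.
Qed.

End space_time.

Lemma cvg_dist_le (R : realType) (u v : nat -> R) (l : R) : (forall n, `|u n - l| <= v n) ->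
  v n @[n --> \oo] --> 0 -> u n @[n --> \oo] --> l.
Proof.
move=> uv /cvgrPdist_le v0; apply/cvgrPdist_le => e e0; near=> n.
have : `|0 - v n| <= e by near: n; exact: v0.
rewrite sub0r normrN distrC; apply: le_trans; exact: le_trans (uv n) (ler_norm _).
Unshelve. all: by end_near. Qed.

Lemma norm2_le_l1 (R : realType) n (v : 'cV[R]_n) : norm2 v <= l1 v.
Proof.
rewrite -[l1 v]ger0_norm ?l1_ge0// -sqrtr_sqr ler_wsqrtr// dotv_cV expr2 mulr_suml.
apply: ler_sum => i _; apply: le_trans (ler_norm _) _.
by rewrite normrM ler_wpM2l// coord_le_l1.
Qed.

(** * Limits of the nonlinear terms *)

Section nonlinear_terms.
Context {R : realType} (d k l : nat).
Local Notation Rd := 'rV[R]_d.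
Local Notation ST := (Rd * R)%type.
Local Notation mu := (lebST R d).

Lemma test_facts n (Omega : set ST) (phi : ST -> 'cV[R]_n) : test_function Omega phi ->
  vsch (fun _ : unit => phi) /\ exists2 P, 0 <= P & forall z, l1 (phi z) <= P.
Proof.
move=> [K [cK KO [sphi phi0]]].
have vphi : vsch (fun _ : unit => phi).
  by move=> j; apply: test_sch cK (sphi j) _ => z /phi0 ->; rewrite mxE.
split=> //.
have /choice[C hC] : forall j, exists C : R, forall z, `|phi z j 0| <= C.
  move=> j; have [_ [C hC]] := BC_BC0 (vphi j 0%N).
  by exists C => z; have := hC tt z; rewrite expr0 mul1r.
exists (\sum_j C j) => [|z]; last by apply: ler_sum.
by apply: sumr_ge0 => j _; exact: le_trans (hC j 0).
Qed.

Variable T : R.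
Local Notation S := (slab T).
Variables (eps : nat -> R) (UI : nat -> ST -> 'cV[R]_k) (UII : nat -> ST -> 'cV[R]_l).
Variables (UI0 : ST -> 'cV[R]_k) (UII0 : ST -> 'cV[R]_l).
Hypothesis eps0 : forall n, 0 < eps n.
Hypothesis UI_L2 : forall n, L2 mu S (UI n).
Hypothesis UII_L2 : forall n, L2 mu S (UII n).
Hypothesis UI0_L2 : L2 mu S UI0.
Hypothesis UI_cvg : cvg_L2loc (open_slab T) UI UI0.
Hypothesis UII_cvg : cvg_L2weak S UII UII0.
Hypothesis epsUII_cvg : cvg_L2loc (open_slab T) (fun n z => eps n *: UII n z) (fun=> 0).

Let mS : measurable (S : set (Rd * measurableTypeR R)%type) := @slab_measurable R d T.

Let open_slab_sub (K : set ST) : K `<=` open_slab T -> K `<=` S.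
Proof. by move=> h z /h; rewrite /open_slab /slab /= => /andP[/ltW -> /ltW ->]. Qed.

Let epsUII_L2 n : L2 mu S (fun z => eps n *: UII n z).
Proof. exact: L2Z. Qed.

Lemma UI_vn_cvg0 (K : set ST) : compact K -> K `<=` open_slab T ->
  vn mu (cut K (fun z => UI n z - UI0 z)) @[n --> \oo] --> 0.
Proof.
move=> cK KO; have mK := compact_measurable_ST cK; have KS := open_slab_sub KO.
apply: (vn_cut_cvg0 mK) => [n|]; last exact: UI_cvg.
exact: (L2_subset mK mS KS (L2B mS (UI_L2 n) UI0_L2)).
Qed.

Lemma epsUII_vn_cvg0 (K : set ST) : compact K -> K `<=` open_slab T ->
  vn mu (cut K (fun z => eps n *: UII n z)) @[n --> \oo] --> 0.
Proof.
move=> cK KO; have mK := compact_measurable_ST cK; have KS := open_slab_sub KO.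
apply: (vn_cut_cvg0 mK) => [n|]; first exact: L2_subset mK mS KS (epsUII_L2 n).
have := epsUII_cvg cK KO; rewrite (_ : (fun n => L2norm_sq mu K (fun z => eps n *: UII n z - 0)) =
  fun n => L2norm_sq mu K (fun z => eps n *: UII n z))//.
by apply/funext => n; congr (L2norm_sq _ _ _); apply/funext => z; rewrite subr0.
Qed.

Section jacobian_term.
Variable m : nat.
Variable F : Rd -> 'cV[R]_k -> 'cV[R]_l -> 'cV[R]_m.
Hypothesis F1 : class_C1 (fun z : Rd * 'cV[R]_k * 'cV[R]_l => F z.1.1 z.1.2 z.2).
Hypothesis F0 : forall x Z, F x Z 0 = 0.
Variable c : R.
Hypothesis Fc : forall x Z v, norm2 (jac (F x Z) v) <= c.

Let c0 : 0 <= c.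
Proof. exact: le_trans (sqrtr_ge0 _) (Fc 0 0 0). Qed.

Lemma nonlinear_L2 n : L2 mu S (fun z => F z.1 (UI n z) (eps n *: UII n z)).
Proof.
apply: (@L2_le _ _ _ mu _ S _ (fun z => c * l1 (cut S (fun z => eps n *: UII n z) z)) mS) => [i||z i zS].
- apply: (@measurable_comp3 R d k l (fun z => F z.1.1 z.1.2 z.2 i 0)) => // [z|i' j'|i' j'].
  + have c1 := differentiable_continuous (F1.1 z).
    exact: (continuous_comp c1 (@coord_continuous R m 1 i 0 _)).
  + exact: (UI_L2 n i' j').1.
  + exact: (epsUII_L2 n i' j').1.
- by apply: L2TZ; apply: L2T_l1; exact: vL2_cut.
- rewrite /cut indicE mem_set// scale1r; exact: nonlinear_le.
Qed.

Let A z := jac (F z.1 (UI0 z)) 0.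

Let mA i j : measurable_fun (S : set (Rd * measurableTypeR R)%type) (fun z => A z i j).
Proof.
apply: (@measurable_comp3 R d k l (fun z => jac (F z.1.1 z.1.2) z.2 i j) _ UI0 (fun=> 0)) => //.
- exact: jac_continuous.
- by move=> i' j'; exact: (UI0_L2 i' j').1.
Qed.

Let AUII_L2 (u : ST -> 'cV[R]_l) : L2 mu S u -> L2 mu S (fun z => A z *m u z).
Proof.
move=> hu; apply: (@L2_le _ _ _ mu _ S _ (fun z => c * l1 (cut S u z)) mS) => [i||z i zS].
- under eq_fun do rewrite mxE.
  by apply: measurable_sum => j; apply: measurable_funM; [exact: mA|exact: (hu j 0).1].
- by apply: L2TZ; apply: L2T_l1; exact: vL2_cut.
- rewrite /cut indicE mem_set// scale1r mxE (le_trans (ler_norm_sum _ _ _))// mulr_sumr.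
  by apply: ler_sum => j _; rewrite normrM ler_wpM2r// jac_le.
Qed.

Variable phi : ST -> 'cV[R]_m.
Hypothesis phiT : test_function (open_slab T) phi.

Let phi_L2 : L2 mu S phi.
Proof. by apply: L2_cut => //; exact: (vsch_slab T (test_facts phiT).1).1 tt. Qed.

(** The Jacobian is taken at the limit and does not depend on [n]; its transpose moves to the test
    function, and weak convergence is applied against a fixed square-integrable function. *)
Let linear_term : pairing S (fun z => A z *m UII n z) phi @[n --> \oo] -->
  pairing S (fun z => A z *m UII0 z) phi.
Proof.
have E (u : ST -> 'cV[R]_l) : pairing S (fun z => A z *m u z) phi =
    pairing S u (fun z => (A z)^T *m phi z).
  apply: eq_Rintegral => z _; rewrite !dotv_cV.
  under eq_bigr do rewrite [(A z *m u z) _ _]mxE mulr_suml.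
  rewrite exchange_big /=; apply: eq_bigr => j _; rewrite [(_ *m phi z) _ _]mxE mulr_sumr.
  by apply: eq_bigr => i _; rewrite [(A z)^T _ _]mxE; ring.
under eq_fun do rewrite E.
rewrite E; apply: UII_cvg.
apply: (@L2_le _ _ _ mu _ S _ (fun z => c * l1 (cut S phi z)) mS) => [i||z i zS].
- under eq_fun do rewrite mxE.
  apply: measurable_sum => j; apply: measurable_funM; last exact: (phi_L2 j 0).1.
  by under eq_fun do rewrite mxE; exact: mA.
- by apply: L2TZ; apply: L2T_l1; exact: vL2_cut.
- rewrite /cut indicE mem_set// scale1r mxE (le_trans (ler_norm_sum _ _ _))// mulr_sumr.
  by apply: ler_sum => j _; rewrite normrM mxE ler_wpM2r// jac_le.
Qed.

Lemma nonlinear_limit :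
  (eps n)^-1 * pairing S (fun z => F z.1 (UI n z) (eps n *: UII n z)) phi @[n --> \oo] -->
  pairing S (fun z => jac (F z.1 (UI0 z)) 0 *m UII0 z) phi.
Proof.
pose D n := (eps n)^-1 * pairing S (fun z => F z.1 (UI n z) (eps n *: UII n z)) phi
  - pairing S (fun z => A z *m UII n z) phi.
have -> : (fun n => (eps n)^-1 * pairing S (fun z => F z.1 (UI n z) (eps n *: UII n z)) phi) =
    (fun n => D n + pairing S (fun z => A z *m UII n z) phi).
  by apply/funext => n; rewrite /D subrK.
rewrite -[X in _ --> X]add0r.
suff D0 : D n @[n --> \oo] --> 0 by exact: cvgD D0 linear_term.
have [K [cK KO [_ phi0]]] := phiT.
have [_ [P P0 hP]] := test_facts phiT.
have mK := compact_measurable_ST cK; have KS := open_slab_sub KO.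
have [B' hB'] := vn_weak_bounded mS UII_L2 UII_cvg.
pose B := B' + 1; have hB n : vn mu (cut S (UII n)) <= B by rewrite (le_trans (hB' n))// lerDl.
have B0 : 0 < B by apply: ltr_pwDr => //; exact: le_trans (vn_ge0 _ _) (hB' 0%N).
apply/cvgrPdist_le => e e0.
(* The error has four parts, one from [de] and three from the quotients. Each is made at most [t] in
   norm, and [4 t] times the bound [B] on [UII n] is [e]. *)
pose t := e / (4 * B); have t0 : 0 < t by rewrite divr_gt0// mulr_gt0.
pose L := 2 * c * P + 1.
have L0 : 0 < L by apply: ltr_pwDr => //; rewrite !mulr_ge0.
pose V := vn mu (cut S phi); pose V0 := vn mu (cut K UI0).
have [V_ge0 V0_ge0] : 0 <= V /\ 0 <= V0 by split; exact: vn_ge0.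
(* [de] and [rho] settle the first two parts; [eta] then comes from uniform continuity, and the
   other two parts are small for large [n]. *)
pose de := t / (V + 1); pose rho := L * (V0 + 1) / t.
have V1 : 0 < V + 1 by exact: ltr_pwDr.
have V01 : 0 < V0 + 1 by exact: ltr_pwDr.
have de0 : 0 < de by rewrite divr_gt0.
have rho0 : 0 < rho by rewrite divr_gt0// mulr_gt0.
have cKx : compact (fst @` K).
  by apply: continuous_compact => //; apply: continuous_subspaceT => z; exact: cvg_fst.
have [eta eta0 heta] := nonlinear_pointwise F1 F0 Fc cKx de0 rho0.
have te : 0 < t * eta / L by rewrite divr_gt0// mulr_gt0.
have /cvgrPdist_le/(_ _ te) cI := UI_vn_cvg0 cK KO.
have /cvgrPdist_le/(_ _ te) cII := epsUII_vn_cvg0 cK KO.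
near=> n.
have a_le : vn mu (cut K (fun z => UI n z - UI0 z)) <= t * eta / L.
  have : `|0 - vn mu (cut K (fun z => UI n z - UI0 z))| <= t * eta / L by near: n.
  by rewrite sub0r normrN ger0_norm ?vn_ge0.
have b_le : vn mu (cut K (fun z => eps n *: UII n z)) <= t * eta / L.
  have : `|0 - vn mu (cut K (fun z => eps n *: UII n z))| <= t * eta / L by near: n.
  by rewrite sub0r normrN ger0_norm ?vn_ge0.
set a := vn mu _ in a_le; set b := vn mu _ in b_le.
have hF := vL2_cut mS (nonlinear_L2 n).
have hA := vL2_cut mS (AUII_L2 (UII_L2 n)).
have hph := vL2_cut mS phi_L2.
have hK0 := vL2_cut mK (L2_subset mK mS KS UI0_L2).
have hKI := vL2_cut mK (L2_subset mK mS KS (L2B mS (UI_L2 n) UI0_L2)).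
have hKII := vL2_cut mK (L2_subset mK mS KS (epsUII_L2 n)).
have DE : D n = vip mu (fun z => (eps n)^-1 *: cut S (fun z => F z.1 (UI n z) (eps n *: UII n z)) z
    - cut S (fun z => A z *m UII n z) z) (cut S phi).
  by rewrite vipBl ?vipZl//; [rewrite /D /pairing !pairing_cut|exact: vL2Z].
pose h0 z := l1 (cut K UI0 z); pose h1 z := l1 (cut K (fun z => UI n z - UI0 z) z).
pose h2 z := l1 (cut K (fun z => eps n *: UII n z) z); pose h3 z := l1 (cut S phi z).
have L0' : L2T mu h0 by exact: L2T_l1.
have L1' : L2T mu h1 by exact: L2T_l1.
have L2' : L2T mu h2 by exact: L2T_l1.
have L3' : L2T mu h3 by exact: L2T_l1.
pose q z := rho^-1 * h0 z + (eta^-1 * h1 z + eta^-1 * h2 z).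
have Lq : L2T mu q by do !apply: L2TD; exact: L2TZ.
(* All factors other than [UII n], with the bound [P] on [phi] inserted, so that a single
   Cauchy-Schwarz inequality against [UII n] concludes. *)
pose h z := de * h3 z + (2 * c * P) * q z.
have Lh : L2T mu h by apply: L2TD; exact: L2TZ.
have cP0 : 0 <= 2 * c * P by rewrite !mulr_ge0.
have nq : nrm mu q <= V0 / rho + (a / eta + b / eta).
  apply: le_trans (nrmD _ (L2TD _ _)) _; try exact: L2TZ.
  apply: lerD; last apply: le_trans (nrmD _ _) (lerD _ _); try exact: L2TZ.
  - rewrite nrmZ// ger0_norm ?invr_ge0 ?(ltW rho0)// mulrC ler_wpM2r ?invr_ge0 ?(ltW rho0)//.
    exact: nrm_l1.
  - rewrite nrmZ// ger0_norm ?invr_ge0 ?(ltW eta0)// mulrC ler_wpM2r ?invr_ge0 ?(ltW eta0)//.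
    exact: nrm_l1.
  - rewrite nrmZ// ger0_norm ?invr_ge0 ?(ltW eta0)// mulrC ler_wpM2r ?invr_ge0 ?(ltW eta0)//.
    exact: nrm_l1.
have nh : nrm mu h <= 4 * t.
  apply: le_trans (nrmD _ _) _; try exact: L2TZ.
  rewrite !nrmZ// (ger0_norm (ltW de0)) (ger0_norm cP0).
  have e1 : de * nrm mu h3 <= t.
    apply: le_trans (ler_wpM2l (ltW de0) (nrm_l1 hph)) _.
    by rewrite /de mulrAC ler_pdivrMr// ler_wpM2l ?(ltW t0)// -/V lerDl.
  have PL : 2 * c * P <= L by rewrite lerDl.
  have e2 : 2 * c * P * (V0 / rho) <= t.
    rewrite mulrA ler_pdivrMr// /rho [t * _]mulrC divfK ?gt_eqF//.
    by apply: ler_pM => //; rewrite lerDl.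
  have e3 (r : R) : 0 <= r -> r <= t * eta / L -> 2 * c * P * (r / eta) <= t.
    move=> r0 rl; rewrite mulrA ler_pdivrMr//.
    apply: le_trans (_ : L * (t * eta / L) <= _); first exact: ler_pM.
    by rewrite mulrC divfK ?gt_eqF.
  have e4 := e3 a (vn_ge0 _ _) a_le; have e5 := e3 b (vn_ge0 _ _) b_le.
  have e6 := ler_wpM2l cP0 nq.
  rewrite !mulrDr in e6; lra.
rewrite sub0r normrN DE.
have LU : L2T mu (fun z => l1 (cut S (UII n) z)) by apply: L2T_l1; exact: vL2_cut.
have hDn := vL2B (vL2Z (eps n)^-1 hF) hA.
apply: le_trans (vip_le_nrm hDn hph Lh LU _) _.
- move=> z; have [Kz|nKz] := pselect (K z); last first.
    rewrite big1 ?mulr_ge0 ?l1_ge0//; last first.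
      by move=> i _; rewrite [cut S phi z _ _]cutE (phi0 _ nKz) [X in _ * (_ * X)]mxE !mulr0 normr0.
    by rewrite addr_ge0// mulr_ge0 ?l1_ge0 ?(ltW de0)// !addr_ge0// mulr_ge0 ?l1_ge0 ?invr_ge0 ?(ltW rho0) ?(ltW eta0).
  have Sz := KS z Kz.
  have cS p (u : ST -> 'cV[R]_p) : cut S u z = u z by rewrite /cut indicE mem_set// scale1r.
  have cK' p (u : ST -> 'cV[R]_p) : cut K u z = u z by rewrite /cut indicE mem_set// scale1r.
  rewrite /h /q /h0 /h1 /h2 /h3 !cS !cK'.
  apply: le_trans (_ : ((de + 2 * c * (l1 (UI0 z) / rho + l1 (UI n z - UI0 z) / eta +
      l1 (eps n *: UII n z) / eta)) * l1 (UII n z)) * l1 (phi z) <= _).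
    rewrite [leRHS]mulr_sumr; apply: ler_sum => i _.
    rewrite normrM /cut !indicE !mem_set// !scale1r ler_wpM2r//.
    have := heta i z.1 (UI n z) (UI0 z) (UII n z) (eps n).
    by rewrite !mxE; apply; [exists z|].
  rewrite mulrAC ler_wpM2r ?l1_ge0// mulrDl lerD2l -!mulrA ler_wpM2l//.
  rewrite ler_wpM2l// mulrC ler_pM ?l1_ge0//.
    by rewrite !addr_ge0// divr_ge0 ?l1_ge0 ?(ltW rho0) ?(ltW eta0).
  by rewrite -addrA !(mulrC _^-1).
apply: le_trans (_ : (4 * t) * B <= _).
  apply: ler_pM => //; try exact: nrm_ge0.
  by apply: le_trans (nrm_l1 _) (hB n); exact: vL2_cut.
by rewrite (_ : 4 * t * B = e)// /t; field; rewrite gt_eqF.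
Unshelve. all: by end_near. Qed.

End jacobian_term.

Lemma local_limit (K : set ST) (psi : ST -> 'cV[R]_k) : compact K -> K `<=` open_slab T ->
  L2 mu S psi -> (forall z, ~ K z -> psi z = 0) ->
  pairing S (UI n) psi @[n --> \oo] --> pairing S UI0 psi.
Proof.
move=> cK KO hpsi psi0.
have mK := compact_measurable_ST cK; have KS := open_slab_sub KO.
have KE u : pairing S u psi = pairing K u psi.
  by apply: pairing_supp => z => [_ /psi0//|/KS].
have hL u : L2 mu S u -> vL2 mu (cut K u) by move=> hu; exact: vL2_cut mK (L2_subset mK mS KS hu).
apply: (@cvg_dist_le _ _ (fun n => vn mu (cut K (fun z => UI n z - UI0 z)) * vn mu (cut K psi))).
  move=> n; rewrite !KE /pairing !pairing_cut//; try exact: hL.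
  rewrite -vipBl; try exact: hL.
  rewrite -cutB.
  by apply: vip_le; [apply: hL; exact: L2B|exact: hL].
rewrite -[X in _ --> X](mul0r (vn mu (cut K psi))).
by apply: cvgM; [exact: UI_vn_cvg0|exact: cvg_cst].
Qed.

(** Here nothing is divided by [eps n]: the Lipschitz bound compares directly with the limit, and
    strong convergence on the support of [phi] suffices. *)
Lemma lipschitz_limit m (G : 'cV[R]_k -> 'cV[R]_l -> 'cV[R]_m) (alpha : R) (phi : ST -> 'cV[R]_m) :
  class_C1 (fun z : 'cV[R]_k * 'cV[R]_l => G z.1 z.2) -> G 0 0 = 0 ->
  (forall Z W Z' W', norm2 (G Z W - G Z' W') <=
     alpha * Num.sqrt (norm2 (Z - Z') ^+ 2 + norm2 (W - W') ^+ 2)) ->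
  test_function (open_slab T) phi ->
  pairing S (fun z => G (UI n z) (eps n *: UII n z)) phi @[n --> \oo] -->
  pairing S (fun z => G (UI0 z) 0) phi.
Proof.
move=> G1 G00 Gl phiT.
have Gle Z W Z' W' i : `|(G Z W - G Z' W') i 0| <= `|alpha| * (l1 (Z - Z') + l1 (W - W')).
  apply: le_trans (entry_le_norm2 _ i 0) _; apply: le_trans (Gl _ _ _ _) _.
  apply: le_trans (ler_wpM2r (sqrtr_ge0 _) (ler_norm alpha)) _; rewrite ler_wpM2l//.
  have n0 p (v : 'cV[R]_p) : 0 <= norm2 v by exact: sqrtr_ge0.
  rewrite -[leRHS]ger0_norm ?addr_ge0 ?l1_ge0// -sqrtr_sqr ler_wsqrtr//.
  have := norm2_le_l1 (Z - Z'); have := norm2_le_l1 (W - W').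
  have := n0 _ (Z - Z'); have := n0 _ (W - W'); nra.
have GL2 (u : ST -> 'cV[R]_k) (v : ST -> 'cV[R]_l) : L2 mu S u -> L2 mu S v ->
    L2 mu S (fun z => G (u z) (v z)).
  move=> hu hv.
  apply: (@L2_le _ _ _ mu _ S _ (fun z => `|alpha| * (l1 (cut S u z) + l1 (cut S v z))) mS) => [i||z i zS].
  - apply: (@measurable_comp3 R d k l (fun z => G z.1.2 z.2 i 0)) => // [z|i' j'|i' j'].
    + have c1 := differentiable_continuous (G1.1 (z.1.2, z.2)).
      have c2 : {for z, continuous (fun z : Rd * 'cV[R]_k * 'cV[R]_l => (z.1.2, z.2))}.
        apply: continuous_pair => w; last exact: cvg_snd.
        by apply: (continuous_comp (f := fst)); [exact: cvg_fst|exact: cvg_snd].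
      have c3 := continuous_comp c2 c1.
      exact: (continuous_comp c3 (@coord_continuous R m 1 i 0 _)).
    + exact: (hu i' j').1.
    + exact: (hv i' j').1.
  - by apply: L2TZ; apply: L2TD; apply: L2T_l1; exact: vL2_cut.
  - rewrite /cut indicE mem_set// !scale1r.
    by have := Gle (u z) (v z) 0 0 i; rewrite G00 !subr0.
have [K [cK KO [_ phi0]]] := phiT.
have mK := compact_measurable_ST cK; have KS := open_slab_sub KO.
have hphi : vL2 mu (cut S phi) by exact: (vsch_slab T (test_facts phiT).1).1 tt.
have L20 : L2 mu S (fun=> 0 : 'cV[R]_l) by apply: L2_vL2 => // j; under eq_fun do rewrite mxE; exact: L2T0.
have hG n := vL2_cut mS (GL2 _ _ (UI_L2 n) (epsUII_L2 n)).
have hG0 := vL2_cut mS (GL2 _ _ UI0_L2 L20).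
apply: (@cvg_dist_le _ _ (fun n => (`|alpha| * (vn mu (cut K (fun z => UI n z - UI0 z)) +
   vn mu (cut K (fun z => eps n *: UII n z)))) * vn mu (cut S phi))); last first.
  rewrite -[X in _ --> X](mul0r (vn mu (cut S phi))).
  apply: cvgM; last exact: cvg_cst.
  rewrite -[X in _ --> X](mulr0 `|alpha|); apply: cvgM; first exact: cvg_cst.
  by rewrite -[X in _ --> X](addr0 0); apply: cvgD; [exact: UI_vn_cvg0|exact: epsUII_vn_cvg0].
move=> n; rewrite /pairing !pairing_cut//; try exact: hG.
  rewrite -vipBl//.
  have h1 := vL2_cut mK (L2_subset mK mS KS (L2B mS (UI_L2 n) UI0_L2)).
  have h2 := vL2_cut mK (L2_subset mK mS KS (epsUII_L2 n)).
  pose h z := `|alpha| * (l1 (cut K (fun z => UI n z - UI0 z) z) + l1 (cut K (fun z => eps n *: UII n z) z)).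
  have Lh : L2T mu h by apply: L2TZ; apply: L2TD; exact: L2T_l1.
  apply: le_trans (vip_le_nrm (vL2B (hG n) hG0) hphi Lh (L2T_l1 hphi) _) _.
    move=> z; have [Kz|nKz] := pselect (K z); last first.
      rewrite big1 ?mulr_ge0 ?addr_ge0 ?l1_ge0// => i _.
      by rewrite [cut S phi z _ _]cutE (phi0 _ nKz) [X in _ * (_ * X)]mxE !mulr0 normr0.
    have Sz := KS z Kz.
    rewrite /h /cut !indicE !mem_set// !scale1r [leRHS]mulr_sumr; apply: ler_sum => i _.
    rewrite normrM ler_wpM2r//.
    by have := Gle (UI n z) (eps n *: UII n z) (UI0 z) 0 i; rewrite subr0.
  apply: ler_pM; rewrite ?nrm_ge0//; last exact: nrm_l1.
  rewrite nrmZ ?normr_id ?ler_wpM2l//; last by apply: L2TD; exact: L2T_l1.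
  apply: le_trans (nrmD (L2T_l1 h1) (L2T_l1 h2)) _.
  by rewrite lerD// nrm_l1.
Qed.

End nonlinear_terms.

(** * Tightness *)

Section OPtr_support.
Context {R : realType} (d : nat).
Local Notation Rd := 'rV[R]_d.
Local Notation ST := (Rd * R)%type.

Lemma OPtr0 k l (P : symbol R d k l) y : OPtr P (fun=> 0 : 'cV[R]_k) y = 0.
Proof.
have c0 (f : Rd -> R[i]) : (forall x, f x = 0) -> cintegral (leb R d) setT f = 0.
  move=> f0; rewrite /cintegral; under eq_Rintegral do rewrite f0.
  by under [X in _ +i* X]eq_Rintegral do rewrite f0; rewrite Rintegral_cst// mul0r.
apply/colP => j; rewrite !mxE big1// => i _; rewrite /OP1tr /fourier c0 ?mulr0// => x.
by rewrite c0 ?mul0r// => x'; rewrite mxE mulr0 mul0r.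
Qed.

(** The operator acts on each time slice separately, so it preserves supports in time even though it
    spreads them in space. *)
Lemma ReImOPtr0 k l (P : symbol R d k l) (phi : ST -> 'cV[R]_k) z :
  (forall x, phi (x, z.2) = 0) -> ReOPtr P phi z = 0 /\ ImOPtr P phi z = 0.
Proof.
move=> phi0; rewrite /ReOPtr /ImOPtr.
have -> : (fun x => phi (x, z.2)) = fun=> 0 by apply/funext.
by rewrite OPtr0; split; apply/colP => i; rewrite !mxE.
Qed.

End OPtr_support.

Section tightness.
Context {R : realType} (d k l : nat).
Local Notation Rd := 'rV[R]_d.
Local Notation ST := (Rd * R)%type.
Local Notation mu := (lebST R d).

Lemma vn_le_L2norm_sq dT (X : measurableType dT) (nu : {measure set X -> \bar R})
    n (A : set X) (u : X -> 'cV[R]_n) (c : R) : measurable A -> L2 nu A u ->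
  (L2norm_sq nu A u <= c%:E)%E -> vn nu (cut A u) <= n%:R * (`|c| + 1).
Proof.
move=> mA hu uc; rewrite /vn -[X in X%:R * _](card_ord n) mulr_natl -sumr_const.
apply: ler_sum => j _.
have := le_trans (nrm_L2norm_sq j mA hu) uc; rewrite lee_fin => h.
have n0 := nrm_ge0 nu (fun z => cut A u z j 0).
have := ler_norm c; nra.
Qed.

Lemma integral_dotv dT (X : measurableType dT) (nu : {measure set X -> \bar R})
    n (u v : X -> 'cV[R]_n) : vL2 nu u -> vL2 nu v ->
  \int[nu]_x dotv (u x) (v x) = vip nu u v.
Proof.
have cT : cut setT u = u by apply/funext => z; rewrite /cut indicT scale1r.
by move=> hu hv; rewrite pairing_vip ?cT.
Qed.

Lemma l1Z n (a : R) (v : 'cV[R]_n) : l1 (a *: v) = `|a| * l1 v.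
Proof. by rewrite /l1 mulr_sumr; apply: eq_bigr => i _; rewrite mxE normrM. Qed.

Lemma pairing_half_slab n (T : R) (u psi : ST -> 'cV[R]_n) :
  (forall z : ST, T < z.2 -> psi z = 0) -> pairing half_space u psi = pairing (slab T) u psi.
Proof.
move=> psi0; apply: pairing_supp => z; rewrite /half_space /slab /=; last by case/andP=> ->.
by move=> -> /negP; rewrite /= -ltNge => /psi0.
Qed.

Variable T : R.
Hypothesis T0 : 0 < T.
Local Notation S := (slab T).
Variables (eps : nat -> R) (UI : nat -> ST -> 'cV[R]_k) (UII : nat -> ST -> 'cV[R]_l).
Variables (UI0 : ST -> 'cV[R]_k) (UIin : nat -> Rd -> 'cV[R]_k).
Hypothesis eps0 : forall n, 0 < eps n.
Hypothesis UI_L2 : forall n, L2 mu S (UI n).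
Hypothesis UII_L2 : forall n, L2 mu S (UII n).
Hypothesis UI0_L2 : L2 mu S UI0.
Hypothesis UI_cvg : cvg_L2loc (open_slab T) UI UI0.
Variable B : R.
Hypothesis UII_B : forall n, vn mu (cut S (UII n)) <= B.
Hypothesis UIin_L2 : forall n, L2 (leb R d) setT (UIin n).
Variable B0 : R.
Hypothesis UIin_B : forall n, vn (leb R d) (UIin n) <= B0.
Variable M12 : symbol R d k l.
Hypothesis M12_poly : polyhomogeneous 1 M12.
Variable D : Rd -> 'cV[R]_k -> 'cV[R]_l -> 'cV[R]_k.
Hypothesis D1 : class_C1 (fun z : Rd * 'cV[R]_k * 'cV[R]_l => D z.1.1 z.1.2 z.2).
Hypothesis D0 : forall x Z, D x Z 0 = 0.
Variable c : R.
Hypothesis Dc : forall x Z v, norm2 (jac (D x Z) v) <= c.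
Hypothesis eq1 : forall n psi, test_function setT psi ->
  - pairing half_space (UI n) (dt psi) - \int[leb R d]_x dotv (UIin n x) (psi (x, 0))
  + pairing half_space (UII n) (ReOPtr M12 psi) =
  (eps n)^-1 * pairing half_space (fun z => D z.1 (UI n z) (eps n *: UII n z)) psi.

Variables (chi : Rd -> R) (Kc : set Rd).
Hypothesis chi1 : chi 0 = 1.
Hypothesis chiB : BC (cst 1) (fun _ : unit => chi).
Hypothesis Kc_compact : compact Kc.
Hypothesis chi0 : forall x, ~ Kc x -> chi x = 0.

Variables (gam : ST -> 'cV[R]_k) (Kt : set R).
Hypothesis gam_sch : vsch (fun _ : unit => gam).
Hypothesis Kt_compact : compact Kt.
Hypothesis Kt_sub : Kt `<=` [set t | 0 < t < T].
Hypothesis gam0 : forall z, ~ Kt z.2 -> gam z = 0.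

Let mS : measurable (S : set (Rd * measurableTypeR R)%type) := @slab_measurable R d T.

Let c0 : 0 <= c.
Proof. exact: le_trans (sqrtr_ge0 _) (Dc 0 0 0). Qed.

Let gam_out z : ~ (0 < z.2 < T) -> gam z = 0.
Proof. by move=> h; apply: gam0 => /Kt_sub. Qed.

Let Gam (z : ST) : 'cV[R]_k := \col_i time_prim T (fun w => gam w i 0) z.

Let Gam_sch : vsch (fun _ : unit => Gam).
Proof.
move=> j; apply: (sch_ext _ (sch_time_prim T (gam_sch j))) => _ z.
by rewrite mxE.
Qed.

Let Theta (r : nat) (z : ST) : R := r.+1%:R * tail chi r z.1.

Let Theta_BC : BC (fun z : ST => (wt z.1 ^+ 1)^-1) Theta.
Proof.
have := BC_linear (L := fst) _ _ (tail_BC chi1 chiB).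
rewrite /comp /=; under [X in BC X _]eq_fun do rewrite -[wt _]expr1; apply.
  by move=> a [x t] [x' t'].
by move=> z; exact: cvg_fst.
Qed.

Let wtV0 (z : ST) : 0 <= (wt z.1 ^+ 1)^-1.
Proof. by rewrite expr1 ltW// wtV_gt0. Qed.

(** Converts the normalization [r + s + 1] of the outer cutoff into that of the inner one; it is at
    most 1 and tends to 0 as [s] grows. *)
Let rho (p : nat * nat) : R := p.1.+1%:R / (p.1 + p.2).+1%:R.

Let rho_le1 p : `|rho p| <= 1.
Proof. by rewrite ger0_norm ?divr_ge0// ler_pdivrMr// mul1r ler_nat ltnS leq_addr. Qed.

(** Written through [Theta], its bounds are uniform in both radii; [coefE] exhibits the same
    function as a difference of two cutoffs, compactly supported in [x]. *)
Let coef (p : nat * nat) (z : ST) : R := Theta p.1 z + (- rho p) * Theta (p.1 + p.2)%N z.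

Let coef_BC : BC (fun z : ST => (wt z.1 ^+ 1)^-1) coef.
Proof.
apply: BCD => //; first exact: (BC_reindex (fun p : nat * nat => p.1) Theta_BC).
apply: (BCZ wtV0 (K := 1)) => [p|]; first by rewrite normrN.
exact: (BC_reindex (fun p : nat * nat => p.1 + p.2)%N Theta_BC).
Qed.

Let Psi (p : nat * nat) (z : ST) : 'cV[R]_k := coef p z *: Gam z.

Let Psi_sch : vsch Psi.
Proof.
move=> j.
have h : sch (fun _ : nat * nat => fun z : ST => Gam z j 0).
  by move=> M; exact: (BC_reindex (fun=> tt) (Gam_sch j M)).
by apply: (sch_ext _ (schM coef_BC h)) => p z; rewrite /Psi [RHS]mxE.
Qed.

Let Gam_out z : ~ (- T <= z.2 <= T) -> Gam z = 0.
Proof.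
move=> h; apply/colP => i; rewrite !mxE; apply: time_prim0 => s /andP[s0 sT].
rewrite gam_out ?mxE// => /= /andP[a b]; apply: h; lra.
Qed.

Let coefE p z : coef p z =
  p.1.+1%:R * (chi ((p.1 + p.2).+1%:R^-1 *: z.1) - chi (p.1.+1%:R^-1 *: z.1)).
Proof. by rewrite /coef /Theta /tail /rho mulNr mulrA divfK// -mulrBr; congr (_ * _); ring. Qed.

Let Psi_test p : test_function setT (Psi p).
Proof.
pose K1 (r : nat) : set Rd := (fun x => r.+1%:R *: x) @` Kc.
have cK1 r : compact (K1 r).
  apply: continuous_compact => //; apply: continuous_subspaceT => x.
  exact: scaler_continuous.
have inK1 r x : ~ K1 r x -> chi (r.+1%:R^-1 *: x) = 0.
  move=> h; apply: chi0 => h'; apply: h; exists (r.+1%:R^-1 *: x) => //.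
  by rewrite scalerA mulfV ?scale1r.
exists ((K1 p.1 `|` K1 (p.1 + p.2)%N) `*` `[- T, T]%classic); split=> //.
  by apply: compact_setX; [exact: compactU|exact: segment_compact].
split=> [i|z nz]; first exact: (BC_smooth p (Psi_sch i 0%N)).
have [h|h] := pselect (- T <= z.2 <= T); last by rewrite /Psi Gam_out ?scaler0.
rewrite /Psi coefE !inK1 ?subrr ?mulr0 ?scale0r// => h'; apply: nz; split=> /=; rewrite ?in_itv//.
  by left.
by right.
Qed.

Let gtail (r : nat) (z : ST) : 'cV[R]_k := Theta r z *: gam z.

Let gtail_sch : vsch gtail.
Proof.
move=> j.
have h : sch (fun _ : nat => fun z : ST => gam z j 0).
  by move=> M; exact: (BC_reindex (fun=> tt) (gam_sch j M)).
by apply: (sch_ext _ (schM Theta_BC h)) => p z; rewrite /gtail [RHS]mxE.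
Qed.

(** The cutoffs do not depend on time, and for [t >= 0] the endpoint [t + T] lies beyond the support
    of [gam], so the time derivative of [Gam] is [- gam]. *)
Let dt_Psi p z : half_space z -> dt (Psi p) z = (-1) *: (gtail p.1 z - rho p *: gtail (p.1 + p.2)%N z).
Proof.
move=> z0; rewrite scaleN1r; apply/colP => i; rewrite mxE.
have sG : smooth (fun z => Gam z i 0) by exact: (BC_smooth tt (Gam_sch i 0%N)).
have dG : is_derive z ((0, 1) : ST) (fun z => Gam z i 0) (- gam z i 0).
  have -> : - gam z i 0 = 'D_(0, 1) (fun z => Gam z i 0) z.
    rewrite (_ : (fun z => _) = time_prim T (fun w => gam w i 0)); last first.
      by apply/funext => w; rewrite mxE.
    rewrite (time_prim_FTC T0)// (gam_out (z := (z.1, z.2 + T))) ?mxE ?sub0r//=.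
    by move=> /andP[_]; move: z0; rewrite /half_space /=; lra.
  exact/derivableP/diff_derivable/smooth_differentiable.
have dc : is_derive z ((0, 1) : ST) (coef p) 0.
  have h : is_derive z ((0, 1) : ST) (coef p) ('D_(0, 1) (coef p) z).
    exact/derivableP/diff_derivable/smooth_differentiable/(BC_smooth p coef_BC).
  suff -> : 0 = 'D_(0, 1) (coef p) z :> R by [].
  rewrite /derive; apply/esym.
  rewrite (_ : (fun h : R => _) = cst 0); first by apply: lim_cst; exact: norm_hausdorff.
  by apply/funext => t; rewrite /= /shift /coef /Theta /= scaler0 add0r subrr scaler0.
have -> : (fun w => Psi p w i 0) = coef p * (fun z => Gam z i 0).
  by apply/funext => w; rewrite /Psi mxE.
have [_ ->] := is_deriveM dc dG.
rewrite scaler0 addr0 !mxE /coef [_ *: _]mulrN; congr (- _).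
by ring.
Qed.

Let gtail_out r (z : ST) : T < z.2 -> gtail r z = 0.
Proof. by move=> h; rewrite /gtail gam_out ?scaler0// => /andP[_]; lra. Qed.

Let Psi_out p (z : ST) : T < z.2 -> Psi p z = 0.
Proof. by move=> h; rewrite /Psi Gam_out ?scaler0// => /andP[_]; lra. Qed.

(** Tested with [Psi p], the first equation leaves the data, the term with [M12] and the source.
    Each is bounded by a quantity uniform in [n] times a norm uniform in [p]; the source over
    [eps n] is at most [c * l1 (UII n)]. *)
Let gtail_difference_bound : exists C, forall n p,
  `|pairing S (UI n) (gtail p.1) - rho p * pairing S (UI n) (gtail (p.1 + p.2)%N)| <= C.
Proof.
have [hP [C1 hC1]] := vsch_slab T Psi_sch.
have [hM [C2 hC2]] := vsch_slab T (vsch_OPtr M12_poly Psi_sch).1.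
have [hs [C3 hC3]] := sch_slice 0 Psi_sch.
have [hg _] := vsch_slab T gtail_sch.
exists (B0 * C3 + B * C2 + c * B * C1) => n p.
have hUI := vL2_cut mS (UI_L2 n); have hUII := vL2_cut mS (UII_L2 n).
have E : - pairing half_space (UI n) (dt (Psi p)) =
    pairing S (UI n) (gtail p.1) - rho p * pairing S (UI n) (gtail (p.1 + p.2)%N).
  have -> : pairing half_space (UI n) (dt (Psi p)) =
      pairing half_space (UI n) (fun z => (-1) *: (gtail p.1 z - rho p *: gtail (p.1 + p.2)%N z)).
    by apply: eq_Rintegral => z /set_mem zh; rewrite dt_Psi.
  rewrite (@pairing_half_slab _ T); last first.
    by move=> z zT; rewrite !gtail_out// scaler0 subr0 scaler0.
  have Eg q : vL2 mu (cut S (fun z => gtail q z)) by exact: hg.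
  have hB' := vL2B (Eg p.1) (vL2Z (rho p) (Eg (p.1 + p.2)%N)).
  rewrite /pairing (pairing_cut mS hUI); last by rewrite cutZ cutB cutZ; exact: vL2Z.
  rewrite cutZ cutB cutZ (vipZr _ hB' hUI) mulN1r opprK (vipBr (Eg _) (vL2Z _ (Eg _)) hUI).
  by rewrite (vipZr _ (Eg _) hUI) (pairing_cut mS hUI (Eg _)) (pairing_cut mS hUI (Eg _)).
have data : `|\int[leb R d]_x dotv (UIin n x) (Psi p (x, 0))| <= B0 * C3.
  have hin : vL2 (leb R d) (UIin n).
    have cT : cut setT (UIin n) = UIin n by apply/funext => z; rewrite /cut indicT scale1r.
    by rewrite -cT; exact: vL2_cut.
  rewrite (integral_dotv hin (hs p)).
  apply: le_trans (vip_le hin (hs p)) _.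
  exact: ler_pM (vn_ge0 _ _) (vn_ge0 _ _) (UIin_B n) (hC3 p).
have M12_le : `|pairing half_space (UII n) (ReOPtr M12 (Psi p))| <= B * C2.
  rewrite (@pairing_half_slab _ T); last first.
    by move=> z zT; apply: (ReImOPtr0 _ _).1 => x; exact: Psi_out.
  rewrite /pairing (pairing_cut mS hUII (hM p)).
  apply: le_trans (vip_le hUII (hM p)) _.
  exact: ler_pM (vn_ge0 _ _) (vn_ge0 _ _) (UII_B n) (hC2 p).
have D_le : `|(eps n)^-1 * pairing half_space (fun z => D z.1 (UI n z) (eps n *: UII n z)) (Psi p)|
    <= c * B * C1.
  rewrite (@pairing_half_slab _ T); last by move=> z; exact: Psi_out.
  have hF := vL2_cut mS (nonlinear_L2 eps UI_L2 UII_L2 D1 D0 Dc n).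
  rewrite /pairing (pairing_cut mS hF (hP p)) -(vipZl (eps n)^-1 hF (hP p)).
  have LU := L2TZ c (L2T_l1 hUII).
  apply: le_trans (vip_le_nrm (vL2Z (eps n)^-1 hF) (hP p) LU (L2T_l1 (hP p)) _) _.
    move=> z; rewrite [leRHS]mulr_sumr; apply: ler_sum => i _.
    rewrite normrM ler_wpM2r// /cut !indicE; case: (z \in _); last first.
      by rewrite !scale0r scaler0 mxE normr0 mulr_ge0 ?l1_ge0.
    rewrite !scale1r mxE normrM ger0_norm ?invr_ge0 ?(ltW (eps0 n))// ler_pdivrMl//.
    apply: le_trans (nonlinear_le D1 D0 Dc _ _ _ _) _.
    by rewrite l1Z ger0_norm ?(ltW (eps0 n))// mulrCA.
  apply: ler_pM; rewrite ?nrm_ge0//; last exact: le_trans (nrm_l1 _) (hC1 p).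
  rewrite nrmZ ?ger0_norm ?ler_wpM2l//; last exact: L2T_l1.
  exact: le_trans (nrm_l1 _) (UII_B n).
have := eq1 n (Psi_test p); rewrite E => Eq.
move: data M12_le D_le; rewrite -{}Eq !ler_norml => /andP[a1 a2] /andP[b1 b2] /andP[d1 d2].
by apply/andP; split; lra.
Qed.

(** The crude bound on the outer term involves the norm of [UI n], but the factor [rho (r, s)] makes
    that term negligible as [s] grows with [n] and [r] fixed. For the limit [UI0] the crude bound is
    used directly. *)
Let gtail_bound : exists2 C, (forall n r, `|pairing S (UI n) (gtail r)| <= C) &
  forall r, `|pairing S UI0 (gtail r)| <= C.
Proof.
have [C hC] := gtail_difference_bound.
have [hg [C' hC']] := vsch_slab T gtail_sch.
have crude u r : L2 mu S u -> `|pairing S u (gtail r)| <= vn mu (cut S u) * C'.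
  move=> hu; have hcu := vL2_cut mS hu.
  rewrite /pairing (pairing_cut mS hcu (hg r)); apply: le_trans (vip_le hcu (hg r)) _.
  by apply: ler_wpM2l; [exact: vn_ge0|exact: hC'].
exists (Num.max C (vn mu (cut S UI0) * C')) => [n r|r]; rewrite le_max; last by rewrite crude ?orbT.
apply/orP; left; apply/ler_addgt0Pr => e e0.
pose M := vn mu (cut S (UI n)) * C'.
have M0 : 0 <= M by exact: le_trans (normr_ge0 _) (crude _ r (UI_L2 n)).
pose s := Num.bound (r.+1%:R * M / e).
have hs : r.+1%:R * M / e < s%:R.
  by apply: archi_boundP; exact: divr_ge0 (mulr_ge0 (ler0n _ _) M0) (ltW e0).
have hr : rho (r, s) * M <= e.
  rewrite /rho /= mulrAC ler_pdivrMr// -ler_pdivrMl// [e^-1 * _]mulrC; apply: le_trans (ltW hs) _.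
  by rewrite ler_nat ltnW// ltnS leq_addl.
have r0 : 0 <= rho (r, s) by rewrite divr_ge0.
have h1 := hC n (r, s); have h2 := crude _ (r + s)%N (UI_L2 n).
rewrite -[pairing S (UI n) (gtail r)](subrK (rho (r, s) * pairing S (UI n) (gtail (r + s)%N))).
apply: le_trans (ler_normD _ _) (lerD h1 _); rewrite normrM ger0_norm//.
exact: le_trans (ler_wpM2l r0 h2) hr.
Qed.

(** [near_ r] is [gam] times the cutoff, supported in a compact part of the open slab, where local
    convergence applies. The rest pairs to at most [C / (r + 1)], for every [n] and for the
    limit. *)
Lemma tight_limit : pairing S (UI n) gam @[n --> \oo] --> pairing S UI0 gam.
Proof.
have [C hC hC0] := gtail_bound.
have C_ge0 : 0 <= C by exact: le_trans (hC0 0%N).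
have [hg _] := vsch_slab T gtail_sch.
have hgam : vL2 mu (cut S gam) := (vsch_slab T gam_sch).1 tt.
pose near_ r z := gam z - r.+1%:R^-1 *: gtail r z.
have near_L2 r : vL2 mu (cut S (near_ r)).
  by rewrite cutB cutZ; exact: vL2B hgam (vL2Z _ (hg r)).
have near_cvg r : pairing S (UI n) (near_ r) @[n --> \oo] --> pairing S UI0 (near_ r).
  pose Kr : set Rd := (fun x => r.+1%:R *: x) @` Kc.
  have cKr : compact Kr.
    by apply: continuous_compact => //; apply: continuous_subspaceT => x; exact: scaler_continuous.
  apply: (@local_limit R d k T UI UI0 UI_L2 UI0_L2 UI_cvg (Kr `*` Kt)).
  - exact: compact_setX.
  - by move=> z [_ /Kt_sub].
  - exact: L2_cut mS (near_L2 r).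
  - move=> z nz; have [h|h] := pselect (Kt z.2); last first.
      by rewrite /near_ /gtail gam0// !scaler0 subr0.
    rewrite /near_ /gtail /Theta scalerA mulrA mulVf// mul1r /tail chi0 ?subr0 ?scale1r ?subrr//.
    move=> h'; apply: nz; split=> //; exists (r.+1%:R^-1 *: z.1) => //.
    by rewrite scalerA mulfV ?scale1r.
have split_ r u : L2 mu S u ->
    pairing S u gam = pairing S u (near_ r) + r.+1%:R^-1 * pairing S u (gtail r).
  move=> /(vL2_cut mS) hu.
  rewrite /pairing (pairing_cut mS hu hgam) (pairing_cut mS hu (near_L2 r)) (pairing_cut mS hu (hg r)).
  rewrite cutB cutZ (vipBr hgam (vL2Z _ (hg r)) hu) (vipZr _ (hg r) hu).
  by rewrite subrK.
apply/cvgrPdist_le => e e0.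
pose r := Num.bound (4 * C / e).
have hr : 4 * C / e < r%:R.
  by apply: archi_boundP; exact: divr_ge0 (mulr_ge0 (ler0n _ _) C_ge0) (ltW e0).
have rC : r.+1%:R^-1 * C <= e / 4.
  rewrite ler_pdivrMl// mulrA ler_pdivlMr// [C * 4]mulrC -ler_pdivrMr//.
  by apply: le_trans (ltW hr) _; rewrite ler_nat.
have e2 : 0 < e / 2 by rewrite divr_gt0.
have /cvgrPdist_le/(_ _ e2) cn := near_cvg r.
near=> n.
have h1 : `|pairing S UI0 (near_ r) - pairing S (UI n) (near_ r)| <= e / 2 by near: n.
have small u : `|pairing S u (gtail r)| <= C -> `|r.+1%:R^-1 * pairing S u (gtail r)| <= e / 4.
  by move=> h; rewrite normrM ger0_norm//; apply: le_trans rC; rewrite ler_wpM2l.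
have := small _ (hC n r); have := small _ (hC0 r).
rewrite (split_ r UI0)// (split_ r (UI n))//.
move: h1; move: (_^-1 * pairing S UI0 _) (_^-1 * pairing S (UI n) _) (pairing S UI0 _) (pairing S (UI n) _).
move=> p1 p2 p3 p4; rewrite !ler_norml => /andP[a1 a2] /andP[b1 b2] /andP[d1 d2].
by apply/andP; split; lra.
Unshelve. all: by end_near. Qed.

End tightness.

(** * Assembly of the limit system *)

Section assembly.
Context {R : realType}.

Lemma class_C1_linear (U V W : normedModType R) (f : V -> W) (L : U -> V) :
  (forall h v x, L (h *: v + x) = h *: L v + L x) -> (forall x, differentiable L x) ->
  class_C1 f -> class_C1 (f \o L).
Proof.
move=> lL dL [df cf]; split=> [x|v]; first by apply: differentiable_comp.
have -> : 'D_v (f \o L) = 'D_(L v) f \o L.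
  apply/funext => x; apply: derive_val.
  apply: (@is_derive_affine _ _ _ _ L f x v (L v)); first by move=> h.
  exact/derivableP/diff_derivable.
by move=> x; apply: (continuous_comp (differentiable_continuous (dL x))); exact: cf.
Qed.

Lemma class_C1D (V W : normedModType R) (f g : V -> W) :
  class_C1 f -> class_C1 g -> class_C1 (f \+ g).
Proof.
move=> [df cf] [dg cg]; split=> [x|v]; first exact: differentiableD.
have -> : 'D_v (f \+ g) = 'D_v f \+ 'D_v g.
  by apply/funext => x; rewrite /= -deriveD//; exact: diff_derivable.
by move=> x; exact: continuousD (cf v x) (cg v x).
Qed.

Lemma norm2_le_sum m n (A : 'M[R]_(m, n)) (c : R) : (forall i j, `|A i j| <= c) ->
  norm2 A <= \sum_(i < m) \sum_(j < n) c.
Proof.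
move=> Ac; have s0 (B : 'M[R]_(m, n)) : 0 <= \sum_i \sum_j `|B i j|.
  by do 2 apply: sumr_ge0 => ? _.
apply: le_trans (_ : \sum_i \sum_j `|A i j| <= _); last by do 2 apply: ler_sum => ? _.
rewrite -[leRHS]ger0_norm// -sqrtr_sqr ler_wsqrtr// expr2 mulr_suml.
apply: ler_sum => i _; rewrite mulr_suml; apply: ler_sum => j _.
apply: le_trans (ler_norm _) _; rewrite normrM ler_wpM2l//.
rewrite (bigD1 i)//= (bigD1 j)//= -addrA lerDl addr_ge0//; first exact: sumr_ge0.
by apply: sumr_ge0 => ? _; exact: sumr_ge0.
Qed.

Lemma eq_seq_limit (u v : nat -> R) (a b : R) : (forall n, u n = v n) ->
  u n @[n --> \oo] --> a -> v n @[n --> \oo] --> b -> a = b.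
Proof.
move=> /funext -> ua vb.
exact: (@cvg_unique _ (@norm_hausdorff _ R^o) _ _ _ _ ua vb).
Qed.

Variable d : nat.
Local Notation Rd := 'rV[R]_d.
Local Notation ST := (Rd * R)%type.
Local Notation mu := (lebST R d).

(** The cutoff is a time slice of one component of a nonzero test function, translated so that [z0]
    sits at the origin and divided by its value there. *)
Lemma test_cutoff n (Omega : set ST) (phi : ST -> 'cV[R]_n) (z0 : ST) :
  test_function Omega phi -> phi z0 <> 0 -> exists chi (Kc : set Rd),
  [/\ chi 0 = 1, BC (cst 1) (fun _ : unit => chi), compact Kc & forall x, ~ Kc x -> chi x = 0].
Proof.
move=> phiT nz; have [vphi _] := test_facts phiT; case: phiT => K [cK _ [_ phi0]].
have [i nzi] : exists i, phi z0 i 0 != 0.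
  apply/existsP; rewrite -negb_forall; apply/negP => /forallP h; apply: nz.
  by apply/colP => i; rewrite mxE; exact/eqP.
exists (fun x => (phi z0 i 0)^-1 * phi (x + z0.1, z0.2) i 0), ((fun z => z.1 - z0.1) @` K).
split.
- by rewrite add0r -surjective_pairing mulVf.
- apply: (@BCZ _ _ _ (cst 1) (fun=> (phi z0 i 0)^-1) _ `|(phi z0 i 0)^-1|) => //.
  have := BC_affine (A := fun x : Rd => (x + z0.1, z0.2)) (L := fun x => (x, 0)) _ _ (vphi i 0%N).
  move=> h; apply: (BC_weight (K := 1)) (h _ _) => //.
  + by move=> x; rewrite /= expr0 mulr1.
  + by move=> a v x; congr (_, _); rewrite /= ?scaler0 ?add0r ?addrA.
- apply: continuous_compact => //; apply: continuous_subspaceT => z.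
  by apply: continuousB; [exact: cvg_fst|exact: cst_continuous].
- move=> x nx; rewrite (phi0 (x + z0.1, z0.2)) ?mxE ?mulr0// => h; apply: nx; exists (x + z0.1, z0.2) => //=.
  by rewrite addrK.
Qed.

Lemma vsch_dt I n (phi : I -> ST -> 'cV[R]_n) : vsch phi -> vsch (fun i => dt (phi i)).
Proof.
move=> h j; apply: (sch_ext _ (fun M => BC_derive ((0, 1) : ST) (h j M))) => i z.
by rewrite mxE.
Qed.

Lemma dt_off n (K : set ST) (phi : ST -> 'cV[R]_n) z : compact K ->
  (forall z, ~ K z -> phi z = 0) -> ~ K z -> dt phi z = 0.
Proof.
move=> cK phi0 nz; apply/colP => i; rewrite !mxE.
have clK : closed K by apply: compact_closed => //; exact: norm_hausdorff.
by apply: (iter_derive_off [:: ((0, 1) : ST)] clK _ nz) => w /phi0 ->; rewrite mxE.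
Qed.

Variable T : R.

Lemma test_slab n (phi : ST -> 'cV[R]_n) : test_function (open_slab T) phi ->
  [/\ test_function setT phi, forall x, phi (x, 0) = 0, forall z, T < z.2 -> phi z = 0,
      forall z, T < z.2 -> dt phi z = 0 & L2 mu (slab T) (dt phi)].
Proof.
move=> phiT; have [vphi _] := test_facts phiT; have [K [cK KO [sphi phi0]]] := phiT.
have nK (z : ST) : T < z.2 -> ~ K z by move=> zT /KO /andP[_]; rewrite ltNge ltW.
split.
- by exists K.
- by move=> x; apply: phi0 => /KO; rewrite /open_slab /= ltxx.
- by move=> z /nK /phi0.
- by move=> z /nK; exact: (dt_off cK phi0).
- apply: L2_cut; first exact: slab_measurable.
  exact: (vsch_slab T (vsch_dt vphi)).1 tt.
Qed.

Lemma OPtr_slab k l (P : symbol R d k l) (phi : ST -> 'cV[R]_k) :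
  polyhomogeneous 1 P -> test_function (open_slab T) phi ->
  [/\ L2 mu (slab T) (ReOPtr P phi), L2 mu (slab T) (ImOPtr P phi),
      forall z, T < z.2 -> ReOPtr P phi z = 0 & forall z, T < z.2 -> ImOPtr P phi z = 0].
Proof.
move=> hP phiT; have [vphi _] := test_facts phiT; have [_ _ out _ _] := test_slab phiT.
have mS : measurable (slab T : set (Rd * measurableTypeR R)%type) by exact: slab_measurable.
have [vRe vIm] := vsch_OPtr hP vphi; split.
- exact: L2_cut mS ((vsch_slab T vRe).1 tt).
- exact: L2_cut mS ((vsch_slab T vIm).1 tt).
- by move=> z zT; apply: (ReImOPtr0 _ _).1 => x; exact: out.
- by move=> z zT; apply: (ReImOPtr0 _ _).2 => x; exact: out.
Qed.

Lemma integral_dotv0 n (u : Rd -> 'cV[R]_n) (phi : ST -> 'cV[R]_n) t :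
  (forall x, phi (x, t) = 0) -> \int[leb R d]_x dotv (u x) (phi (x, t)) = 0.
Proof.
move=> phi0; rewrite (_ : (fun x => _) = cst 0) ?Rintegral_cst ?mul0r//.
by apply/funext => x; rewrite phi0 dotv_cV big1// => i _; rewrite mxE mulr0.
Qed.

Lemma pairing_eq0 n (A : set ST) (u phi : ST -> 'cV[R]_n) :
  (forall z, phi z = 0) -> pairing A u phi = 0.
Proof.
by move=> phi0; rewrite (pairing_supp (B := set0)) /pairing ?Rintegral_set0.
Qed.

End assembly.

Theorem corollary4p6 (R : realType) (d k N : nat)
  (hd : (1 <= d)%N) (hk : (0 < k)%N) (hkN : (k < N)%N)
  (M12 : symbol R d k (N - k)) (M21 : symbol R d (N - k) k)
  (M22 : symbol R d (N - k) (N - k))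
  (Rsym : symbol R d (k + (N - k)) (k + (N - k)))
  (R11 : symbol R d k k) (R22 : symbol R d (N - k) (N - k))
  (DI : 'cV[R]_k -> 'cV[R]_(N - k) -> 'cV[R]_k)
  (DII : 'cV[R]_k -> 'cV[R]_(N - k) -> 'cV[R]_(N - k))
  (Q Q0 Q1 : 'rV[R]_d -> 'cV[R]_k -> 'cV[R]_(N - k) -> 'cV[R]_(N - k))
  (alpha lambda0 lambda1 : R)
  (* (a) *)
  (hM12 : polyhomogeneous 1 M12) (hM21 : polyhomogeneous 1 M21)
  (hM22 : polyhomogeneous 1 M22)
  (hMimag : forall q, principal_symbol 1 (system_symbol M12 M21 M22) q ->
     forall x xi, xi != 0 -> forall mu : R[i], eigenvalue (q x xi) mu -> complex.Re mu = 0)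
  (hQspan : exists s : seq ('rV[R]_d * 'cV[R]_k * 'cV[R]_(N - k))%type,
     <<[seq Q z.1.1 z.1.2 z.2 | z <- s]>>%VS = fullv)
  (* (b) *)
  (hR : S10 0 Rsym)
  (hRM : sym_part_OPS0 (fun f => OP Rsym (OP (system_symbol M12 M21 M22) f)))
  (hRpos : forall x xi, 1 < norm2 xi -> posdef (Rsym x xi))
  (hRblock : forall x xi, Rsym x xi = block_mx (R11 x xi) 0 0 (R22 x xi))
  (hR11 : forall x xi, 1 < norm2 xi -> posdef (R11 x xi))
  (hR22 : forall x xi, 1 < norm2 xi -> posdef (R22 x xi))
  (* (c) *)
  (hM21det : forall x xi, xi != 0 -> \det ((M21 x xi)^T *m M21 x xi) != 0)
  (* (d) *)
  (hDI1 : class_C1 (fun z : 'cV[R]_k * 'cV[R]_(N - k) => DI z.1 z.2))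
  (hDII1 : class_C1 (fun z : 'cV[R]_k * 'cV[R]_(N - k) => DII z.1 z.2))
  (hDI0 : forall ZI, DI ZI 0 = 0) (hDII0 : DII 0 0 = 0)
  (hDIbd : exists c : R, forall ZI ZII, norm2 (jac (DI ZI) ZII) <= c)
  (hDIIlip : forall ZI ZII YI YII,
     norm2 (DII ZI ZII - DII YI YII) <=
     alpha * Num.sqrt (norm2 (ZI - YI) ^+ 2 + norm2 (ZII - YII) ^+ 2))
  (* (e) *)
  (hQ : forall x ZI ZII, Q x ZI ZII = Q0 x ZI ZII + Q1 x ZI ZII)
  (hQ0 : forall x ZI, Q x ZI 0 = 0)
  (* (e1) *)
  (hQ0C1 : class_C1
     (fun z : 'rV[R]_d * 'cV[R]_k * 'cV[R]_(N - k) => Q0 z.1.1 z.1.2 z.2))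
  (hQ0bd : exists c : R, forall x ZI ZII, norm2 (jac (Q0 x ZI) ZII) <= c)
  (hQ0comm : exists2 S, op_sqrt R22 S &
     forall ZI ZII, op_commutes (fun x => jac (Q0 x ZI) ZII) S)
  (hlambda0 : 0 < lambda0)
  (hQ0neg : forall x ZI ZII (v : 'cV[R]_(N - k)),
     dotv v (jac (Q0 x ZI) ZII *m v) <= - lambda0 * dotv v v)
  (* (e2) *)
  (hQ1C1 : class_C1
     (fun z : 'rV[R]_d * 'cV[R]_k * 'cV[R]_(N - k) => Q1 z.1.1 z.1.2 z.2))
  (hQ1bd : exists c : R, forall x ZI ZII, norm2 (jac (Q1 x ZI) ZII) <= c)
  (hQ1norm : forall ZI ZII,
     op_mul_norm_le R22 (fun x => jac (Q1 x ZI) ZII) lambda1)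
  (hlambda1 : 0 < lambda1) (hlambda10 : lambda1 <= lambda0 / 2)
  (* solutions along a sequence of values of epsilon, and their data *)
  (eps : nat -> R) (heps : forall n, 0 < eps n)
  (heps0 : eps n @[n --> \oo] --> 0)
  (UIin : nat -> 'rV[R]_d -> 'cV[R]_k)
  (UIIin : nat -> 'rV[R]_d -> 'cV[R]_(N - k))
  (hUIin : forall n, L2 (leb R d) setT (UIin n))
  (hUIIin : forall n, L2 (leb R d) setT (UIIin n))
  (hUIinbd : exists c : R, forall n,
     (L2norm_sq (leb R d) setT (UIin n) <= c%:E)%E)
  (UI : nat -> 'rV[R]_d * R -> 'cV[R]_k)
  (UII : nat -> 'rV[R]_d * R -> 'cV[R]_(N - k))
  (hsol : forall n, cauchy_solution M12 M21 M22 DI DII Q (eps n)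
     (UIin n) (UIIin n) (UI n) (UII n))
  (* the limits *)
  (T : R) (hT : 0 < T)
  (UI0 : 'rV[R]_d * R -> 'cV[R]_k) (UII0 : 'rV[R]_d * R -> 'cV[R]_(N - k))
  (hUI0 : L2 (lebST R d) (slab T) UI0)
  (hUII0 : L2 (lebST R d) (slab T) UII0)
  (hcvgI : cvg_L2loc (open_slab T) UI UI0)
  (hcvgII : cvg_L2weak (slab T) UII UII0)
  (hcvgeps : cvg_L2loc (open_slab T) (fun n z => eps n *: UII n z) (fun=> 0))
  (hcvgdt : cvg0_Hm1loc (open_slab T)
     (fun n phi => - (eps n ^+ 2 * pairing half_space (UII n) (dt phi)))) :
  limit_solution M12 M21 DI DII Q T UI0 UII0.
Proof.
have mS : measurable (slab T : set ('rV[R]_d * measurableTypeR R)%type) by exact: slab_measurable.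
have UI_L2 n : L2 (lebST R d) (slab T) (UI n) by case: (hsol n) => /(_ T hT)[].
have UII_L2 n : L2 (lebST R d) (slab T) (UII n) by case: (hsol n) => /(_ T hT)[].
have [B hB] := vn_weak_bounded mS UII_L2 hcvgII.
have [cin hcin] := hUIinbd.
have UIin_B n : vn (leb R d) (UIin n) <= k%:R * (`|cin| + 1).
  have := vn_le_L2norm_sq measurableT (hUIin n) (hcin n).
  by rewrite (_ : cut setT _ = UIin n)//; apply/funext => z; rewrite /cut indicT scale1r.
(* A dummy space variable lets the lemmas stated for [Q] apply to [DI]. *)
pose D (_ : 'rV[R]_d) := DI.
have [cD hD] := hDIbd.
have D1 : class_C1 (fun z : 'rV[R]_d * 'cV[R]_k * 'cV[R]_(N - k) => D z.1.1 z.1.2 z.2).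
  apply: (class_C1_linear (L := fun z : 'rV[R]_d * 'cV[R]_k * 'cV[R]_(N - k) => (z.1.2, z.2)) _ _ hDI1).
    by move=> h v x.
  move=> x; apply: linear_diff => //; apply: continuous_pair => w; last exact: cvg_snd.
  by apply: (continuous_comp (f := fst)); [exact: cvg_fst|exact: cvg_snd].
have QE : (fun z : 'rV[R]_d * 'cV[R]_k * 'cV[R]_(N - k) => Q z.1.1 z.1.2 z.2) =
    (fun z => Q0 z.1.1 z.1.2 z.2) + (fun z => Q1 z.1.1 z.1.2 z.2).
  by apply/funext => z; rewrite /= hQ.
have QC1 : class_C1 (fun z : 'rV[R]_d * 'cV[R]_k * 'cV[R]_(N - k) => Q z.1.1 z.1.2 z.2).
  by rewrite QE; exact: class_C1D hQ0C1 hQ1C1.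
have [cQ hcQ] : exists c, forall x ZI ZII, norm2 (jac (Q x ZI) ZII) <= c.
  have [c0 h0] := hQ0bd; have [c1 h1] := hQ1bd.
  exists (\sum_(i < N - k) \sum_(j < N - k) (c0 + c1)) => x Z v.
  apply: norm2_le_sum => i j; rewrite (jacE QC1) QE deriveD; last 2 first.
  - exact/diff_derivable/hQ0C1.1.
  - exact/diff_derivable/hQ1C1.1.
  rewrite mxE -(jacE hQ0C1) -(jacE hQ1C1); apply: le_trans (ler_normD _ _) _.
  by apply: lerD; apply: le_trans (entry_le_norm2 _ i j) _.
(* The unknowns are real while the operators are complex: the real part carries the system, and the
   imaginary part says that the operator terms contribute nothing imaginary. *)
have eq1 n psi : test_function setT psi ->
    - pairing half_space (UI n) (dt psi) - \int[leb R d]_x dotv (UIin n x) (psi (x, 0))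
      + pairing half_space (UII n) (ReOPtr M12 psi) =
    (eps n)^-1 * pairing half_space (fun z => DI (UI n z) (eps n *: UII n z)) psi
    /\ pairing half_space (UII n) (ImOPtr M12 psi) = 0.
  move=> psiT; case: (hsol n) => _ /(_ psi psiT) E _; rewrite OP_pairingE in E.
  have := congr1 (@complex.Im R) E; have := congr1 (@complex.Re R) E.
  by rewrite /= add0r.
have eq2 n psi : test_function setT psi ->
    eps n ^+ 2 * (- pairing half_space (UII n) (dt psi)
        - \int[leb R d]_x dotv (UIIin n x) (psi (x, 0)))
      + pairing half_space (UI n) (ReOPtr M21 psi)
      + eps n * pairing half_space (UII n) (ReOPtr M22 psi) =
    (eps n)^-1 * pairing half_space (fun z => Q z.1 (UI n z) (eps n *: UII n z)) psi
      + pairing half_space (fun z => DII (UI n z) (eps n *: UII n z)) psi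
    /\ pairing half_space (UI n) (ImOPtr M21 psi)
      + eps n * pairing half_space (UII n) (ImOPtr M22 psi) = 0.
  move=> psiT; case: (hsol n) => _ _ /(_ psi psiT) E; rewrite !OP_pairingE in E.
  have := congr1 (@complex.Im R) E; have := congr1 (@complex.Re R) E.
  by rewrite /= !mul0r subr0 !addr0 add0r.
have eps_cvg (a : nat -> R) (b : R) : a n @[n --> \oo] --> b -> eps n * a n @[n --> \oo] --> 0.
  by move=> ab; rewrite -[X in _ --> X](mul0r b); exact: cvgM.
have tight gam (Kt : set R) : vsch (fun _ : unit => gam) -> compact Kt ->
    Kt `<=` [set t | 0 < t < T] -> (forall z, ~ Kt z.2 -> gam z = 0) ->
    (exists m (phi : 'rV[R]_d * R -> 'cV[R]_m) z, test_function setT phi /\ phi z <> 0) ->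
    pairing (slab T) (UI n) gam @[n --> \oo] --> pairing (slab T) UI0 gam.
  move=> vgam cKt Kt0 gam0 [m [phi [z [phiT nz]]]].
  have [chi [Kc [chi1 chiB cKc chi0]]] := test_cutoff phiT nz.
  exact: (tight_limit hT heps UI_L2 UII_L2 hUI0 hcvgI hB hUIin UIin_B hM12 D1 (fun _ => hDI0)
    (fun _ => hD) (fun n psi psiT => (eq1 n psi psiT).1) chi1 chiB cKc chi0 vgam cKt Kt0 gam0).
split=> phi phiT; have [phiT' phi_t0 out dout dL2] := test_slab phiT.
  have [ReL ImL Re_out Im_out] := OPtr_slab hM12 phiT.
  have H n := eq1 n phi phiT'.
  have E1 n : (- pairing (slab T) (UI n) (dt phi) + pairing (slab T) (UII n) (ReOPtr M12 phi)) =
      (eps n)^-1 * pairing (slab T) (fun z => DI (UI n z) (eps n *: UII n z)) phi.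
    rewrite -!(@pairing_half_slab _ _ _ T)//; have [<- _] := H n.
    by rewrite integral_dotv0// subr0.
  have E2 n : pairing (slab T) (UII n) (ImOPtr M12 phi) = 0.
    by have [_ <-] := H n; apply/esym; exact: pairing_half_slab.
  have R1 : - pairing (slab T) UI0 (dt phi) + pairing (slab T) UII0 (ReOPtr M12 phi) =
      pairing (slab T) (fun z => jac (DI (UI0 z)) 0 *m UII0 z) phi.
    apply: (eq_seq_limit E1).
      apply: cvgD; last exact: hcvgII.
      (* [dt phi] has compact support in the open slab, so local convergence is enough for this
         term. *)
      have [K [cK KO [_ phi0]]] := phiT.
      apply: cvgN; apply: (local_limit UI_L2 hUI0 hcvgI cK KO dL2) => z.
      exact: (dt_off cK phi0).
    exact: (nonlinear_limit heps UI_L2 UII_L2 hUI0 hcvgI hcvgII hcvgeps D1 (fun _ => hDI0)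
      (fun _ => hD) phiT).
  have R2 : pairing (slab T) UII0 (ImOPtr M12 phi) = 0.
    by apply: (eq_seq_limit E2); [exact: hcvgII|exact: cvg_cst].
  by apply/eqP; rewrite OP_pairingE eq_complex /= R1 R2 addr0 !eqxx.
have [Re1 Im1 Re1_out Im1_out] := OPtr_slab hM21 phiT.
have [Re2 Im2 Re2_out Im2_out] := OPtr_slab hM22 phiT.
have [K [cK KO [_ phi0]]] := phiT.
have [vphi _] := test_facts phiT.
have [vRe vIm] := vsch_OPtr hM21 vphi.
have cKt : compact (snd @` K).
  by apply: continuous_compact => //; apply: continuous_subspaceT => z; exact: cvg_snd.
have Kt0 : snd @` K `<=` [set t | 0 < t < T] by move=> _ [z /KO zT <-].
have off z : ~ (snd @` K) z.2 -> forall x, phi (x, z.2) = 0.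
  by move=> nz x; apply: phi0 => Kxz; apply: nz; exists (x, z.2).
(* The cutoff is drawn from [phi] itself; if [phi] vanishes identically, so does [gam] and both
   pairings are 0. *)
have lim_tight gam : vsch (fun _ : unit => gam) -> (forall z, ~ (snd @` K) z.2 -> gam z = 0) ->
    ((forall z, phi z = 0) -> forall z, gam z = 0) ->
    pairing (slab T) (UI n) gam @[n --> \oo] --> pairing (slab T) UI0 gam.
  move=> vgam gam0 triv; have [[z nz]|/forallNP h] := pselect (exists z, phi z <> 0).
    by apply: tight vgam cKt Kt0 gam0 _; exists (N - k)%N, phi, z.
  have {}triv := triv (fun z => contrapT (h z)).
  under eq_fun do rewrite pairing_eq0//.
  by rewrite pairing_eq0//; exact: cvg_cst.
have H n := eq2 n phi phiT'.
have E1 n : eps n ^+ 2 * - pairing (slab T) (UII n) (dt phi)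
      + pairing (slab T) (UI n) (ReOPtr M21 phi) + eps n * pairing (slab T) (UII n) (ReOPtr M22 phi) =
    (eps n)^-1 * pairing (slab T) (fun z => Q z.1 (UI n z) (eps n *: UII n z)) phi
      + pairing (slab T) (fun z => DII (UI n z) (eps n *: UII n z)) phi.
  rewrite -!(@pairing_half_slab _ _ _ T)//; have [<- _] := H n.
  by rewrite integral_dotv0// subr0.
have E2 n : pairing (slab T) (UI n) (ImOPtr M21 phi)
      + eps n * pairing (slab T) (UII n) (ImOPtr M22 phi) = 0.
  by rewrite -!(@pairing_half_slab _ _ _ T)//; have [_ <-] := H n.
have R1 : pairing (slab T) UI0 (ReOPtr M21 phi) =
    pairing (slab T) (fun z => jac (Q z.1 (UI0 z)) 0 *m UII0 z) phi +
    pairing (slab T) (fun z => DII (UI0 z) 0) phi.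
  apply: (eq_seq_limit E1).
    rewrite -[X in _ --> X]addr0 -[X in _ --> X + _]add0r.
    apply: cvgD; last exact: (eps_cvg _ _ (hcvgII _ Re2)).
    apply: cvgD.
      (* The time derivative falls on [phi]: the pairings converge by weak convergence and the
         factor [eps n ^+ 2] sends the product to 0. *)
      under eq_fun do rewrite expr2 -mulrA.
      by exact: (eps_cvg _ _ (eps_cvg _ _ (cvgN (hcvgII _ dL2)))).
    (* The transform of [phi] is confined to the times of [K] but spread over all of space, so local
       convergence has to be supplemented by tightness. *)
    apply: lim_tight => // [z nz|p0 z]; apply: (ReImOPtr0 _ _).1; last by move=> x; exact: p0.
    exact: off.
  apply: cvgD.
    exact: (nonlinear_limit heps UI_L2 UII_L2 hUI0 hcvgI hcvgII hcvgeps QC1 hQ0 hcQ phiT).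
  exact: (lipschitz_limit UI_L2 UII_L2 hUI0 hcvgI hcvgeps hDII1 hDII0 hDIIlip phiT).
have R2 : pairing (slab T) UI0 (ImOPtr M21 phi) = 0.
  apply: (eq_seq_limit E2); last exact: cvg_cst.
    rewrite -[X in _ --> X]addr0; apply: cvgD; last exact: (eps_cvg _ _ (hcvgII _ Im2)).
    apply: lim_tight => // [z nz|p0 z]; apply: (ReImOPtr0 _ _).2; last by move=> x; exact: p0.
    exact: off.
by apply/eqP; rewrite OP_pairingE eq_complex /= R1 R2 !eqxx.
Qed.
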